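(* Let $p\ge 2$ be a fixed natural number. For an undirected connected graph $G=(V,E)$ with $n=|V|$, $m=|E|$ and edge cost vectors $c_e\in\mathbb{R}^p$ ($e\in E$), the weight-set algorithm described in the context computes the set $Y_{exN}$ of all extreme supported non-dominated points and the corresponding weight set decomposition $\Lambda=\bigcup_{y\in Y_{exN}}\Lambda(y)$ for the multi-objective minimum spanning tree problem in time $\mathcal{O}(m^{2p-2}\log n)$.
   Context: Let $\mathcal{T}$ be the set of spanning trees of $G$. Each edge $e$ has a cost vector $c_e=(c_{e,1},\dots,c_{e,p})\in\mathbb{R}^p$, and a tree $T\in\mathcal{T}$ has cost $c(T)=(c_1(T),\dots,c_p(T))^\top$ with $c_i(T)=\sum_{e\in T}c_{e,i}$. The multi-objective minimum spanning tree problem is to minimize the vector $c(T)$ over $T\in\mathcal{T}$, each of the $p$ objectives being minimized. The image set is $Y=\{c(T):T\in\mathcal{T}\}$. For $y,y'\in\mathbb{R}^p$: $y\leqq y'$ iff $y_i\le y'_i$ for all $i$ (and $y\geqq y'$ iff $y'\leqq y$), and $y\le y'$ iff $y\leqq y'$ and $y\ne y'$. Let $\mathbb{R}^p_{\geqq}=\{\lambda\in\mathbb{R}^p:\lambda_i\ge0\text{ for all }i\}$ and $\mathbb{R}^p_>=\{\lambda\in\mathbb{R}^p:\lambda_i>0\text{ for all }i\}$. A tree $T\in\mathcal{T}$ is efficient if there is no $T'\in\mathcal{T}$ with $c(T')\le c(T)$; then $c(T)$ is a non-dominated point. For $\lambda\in\mathbb{R}^p_{\geqq}$, the weighted sum problem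 with respect to $\lambda$ is $\min_{T\in\mathcal{T}}\lambda^\top c(T)$. An efficient tree that can be computed with (is an optimal solution of) the weighted sum problem for some $\lambda\in\mathbb{R}^p_{\geqq}$ is supported efficient; its image is a supported non-dominated point. A supported non-dominated point that is also an extreme point of the convex hull of $Y$ is extreme supported non-dominated, and $Y_{exN}$ is the set of all such points. The weight set is $\Lambda=\{\lambda\in\mathbb{R}^p_>:\sum_{i=1}^p\lambda_i=1\}$. The weight set component of $y\in Y$ is $\Lambda(y)=\{\lambda\in\Lambda:\lambda^\top y\le\lambda^\top y'\text{ for all }y'\in Y_{exN}\}$, and $\Lambda=\bigcup_{y\in Y_{exN}}\Lambda(y)$ is the weight set decomposition. Computing it means giving $\Lambda(y)$ for each $y\in Y_{exN}$, where a component may be given as a union of polytopes. Put $w(e,\lambda)=\lambda^\top c_e$ and, for distinct $e,f\in E$, let $h(e,f)=\{\lambda\in\mathbb{R}^p:w(e,\lambda)=w(f,\lambda)\}$ be the separating hyperplane; $H^{=}$ is the set of all of them. Standing assumption: (a) no two separating hyperplanes (for different unordered pairs) are identical; (b) no separating hyperplane is vertical, i.e. none contains a line parallel to the $p$-th coordinate axis. The arrangement $A(H)$ of a finite set $H$ of hyperplanes consists of the faces obtained as intersections in which, for each hyperplane, one chooses the hyperplane itself or one of its two open half-spaces; a cell is a full-dimensional face. The incidence graph $G(A(H))$ has one node $v_c$ for each cell $c$, two nodes being adjacent if and only if their cells share a common face of codimension one. The incremental algorithm of Edelsbrunner et al. (1986) computes an arrangement by adding one hyperplane at a time and yields a point in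 the relative interior of every face and the incidences between faces. The algorithm. Input: $G$ and the cost vectors $c_e$. 1. Compute $\bar H=\{h(e,f)\in H^{=}:c_e\not\leqq c_f,\ c_e\not\geqq c_f\}$. 2. Add the hyperplanes $b_i=\{\lambda\in\mathbb{R}^p:\lambda_i=0\}$, $i=1,\dots,p$, to $\bar H$. 3. Compute $A(\bar H)$ with the algorithm of Edelsbrunner et al. Here the hyperplanes are intersected with the affine hull of $\Lambda$ and projected onto the first $p-1$ components, giving an arrangement in $\mathbb{R}^{p-1}$; the relevant cells are those corresponding to subsets of $\Lambda$. 4. Obtain the incidence graph $G(A(\bar H))$. 5. Choose a vertex $v_{c'}$ of an arbitrary cell $c'$, and compute a minimum spanning tree $T^*$ at the stored point $\lambda$ in the relative interior of $c'$. Initialize $Y_{exN}\leftarrow\{c(T^* )\}$, with component equal to the polytope of $c'$. 6. Explore $G(A(\bar H))$ by breadth-first search. For each vertex $v_c$ reached, let $R$ be the polytope in the weight set corresponding to $c$ and $\lambda$ its stored interior point. Perform a cycle test to compute a minimum spanning tree $T^*$ in $c$ from the minimum spanning tree of the neighbouring cell from which $c$ was reached, the test concerning the swap of the two edges $e,f$ defining the hyperplane $h(e,f)$ that is crossed. If $c(T^* )\notin Y_{exN}$, add $c(T^* )$ to $Y_{exN}$ and store $R$ as its component together with $\lambda$; otherwise replace the component of $z=c(T^* )$ by its union with $R$ and keep the point stored for $z$. 7. Return $Y_{exN}$ and the component of every $y\in Y_{exN}$. Cycle tests use the dynamic tree data structure of Sleator and Tarjan, taking $\mathcal{O}(\log n)$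 time each. Elementary arithmetic operations and comparisons count as constant time, and constants in the $\mathcal{O}$-notation may depend on the fixed number $p$.
   Formalization: A supported efficient tree is taken to be one optimal for some λ with all λ_i>0: if λ_i≥0 is allowed (e.g. λ=0), Y_exN can contain points that are optimal for no λ in Λ, which the algorithm cannot find. Graphs are simple. *)

(* Defs.v *)
From HB Require Import structures.
From mathcomp Require Import all_boot all_order all_algebra.
From mathcomp Require Import boolp classical_sets reals topology normedtype.

Set Implicit Arguments.
Unset Strict Implicit.
Unset Printing Implicit Defensive.

Import Order.TTheory GRing.Theory Num.Theory.
Import numFieldNormedType.Exports.

Local Open Scope classical_set_scope.
Local Open Scope ring_scope.

(* A vertex set is a finType V, and an edge is an unordered pair of distinct
   vertices, represented as a two-element {set V}.  The graph G = (V, E) is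
   thus given by E : {set {set V}}. *)
Section Graph.
Variable V : finType.
Implicit Types (F E T : {set {set V}}) (e : {set V}).

Definition simple_graph E : Prop := forall e, e \in E -> #|e| = 2%N.

Definition adj F : rel V :=
  fun u v => (u != v) && ([set u; v]%SET \in F).

Definition connected_graph F : Prop := forall u v, connect (adj F) u v.

Definition acyclic F : Prop :=
  forall s : seq V, (2 < size s)%N -> ~ ucycle (adj F) s.

Definition forest F : Prop := simple_graph F /\ acyclic F.

Definition spanning_tree E T : Prop :=
  [/\ T \subset E, connected_graph T & acyclic T].

Definition joined F e : bool :=
  [forall u in e, forall v in e, connect (adj F) u v].

End Graph.

(* There are p = d.+1 objectives.  The last coordinate (index ord_max) is the
   p-th one, and the first p - 1 coordinates are indexed by 'I_d through
   lift ord_max. *)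
Section MultiObjective.
Variables (R : realType) (d : nat).
Local Notation vec := 'rV[R]_d.+1.
Implicit Types (y z l : vec) (Y : set vec).

Definition dot n (u v : 'rV[R]_n) : R := \sum_i u 0 i * v 0 i.

Definition leqq y z : bool := [forall i, y 0 i <= z 0 i].
Definition dominates y z : Prop := leqq y z /\ y <> z.

Definition positive l : bool := [forall i, 0 < l 0 i].

Definition convex_hull Y : set vec :=
  [set x | exists k (a : 'I_k -> R) (z : 'I_k -> vec),
     [/\ forall i, 0 <= a i, \sum_i a i = 1, forall i, Y (z i)
       & x = \sum_i a i *: z i]].

Definition extreme_point (C : set vec) y : Prop :=
  C y /\ forall u v t, C u -> C v -> 0 < t < 1 ->
    y = t *: u + (1 - t) *: v -> u = y /\ v = y.

Definition weight_set : set vec :=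
  [set l | positive l /\ \sum_i l 0 i = 1].

Variables (V : finType) (E : {set {set V}}) (c : {set V} -> vec).
Implicit Types T : {set {set V}}.

Definition tree_cost T : vec := \sum_(e in T) c e.

Definition image_set : set vec :=
  [set y | exists2 T, spanning_tree E T & y = tree_cost T].

Definition efficient T : Prop :=
  spanning_tree E T /\
  forall T', spanning_tree E T' -> ~ dominates (tree_cost T') (tree_cost T).

Definition weighted_sum_optimal l T : Prop :=
  spanning_tree E T /\
  forall T', spanning_tree E T' -> dot l (tree_cost T) <= dot l (tree_cost T').

(* The weights are strictly positive.  If zero entries were allowed, l = 0
   would make every efficient tree supported; and even for l <> 0, with at
   least three objectives, a tree optimal for some such l may be optimal for
   no element of the weight set although it is efficient and its cost is an
   extreme point of the convex hull. *)
Definition supported_efficient T : Prop :=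
  efficient T /\ exists2 l, positive l & weighted_sum_optimal l T.

Definition Y_exN : set vec :=
  [set y | (exists2 T, supported_efficient T & y = tree_cost T)
           /\ extreme_point (convex_hull image_set) y].

Definition weight_component y : set vec :=
  [set l | weight_set l /\ forall z, Y_exN z -> dot l y <= dot l z].

Definition separating_hyperplane (e f : {set V}) : set vec :=
  [set l | dot l (c e) = dot l (c f)].

Definition hyperplanes_distinct : Prop :=
  forall e f e' f', e \in E -> f \in E -> e' \in E -> f' \in E ->
    e <> f -> e' <> f' -> [set e; f]%SET <> [set e'; f']%SET ->
    separating_hyperplane e f <> separating_hyperplane e' f'.

Definition no_vertical_hyperplane : Prop :=
  forall e f, e \in E -> f \in E -> e <> f ->
    ~ exists x, forall t, separating_hyperplane e f (x + t *: delta_mx 0 ord_max).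

End MultiObjective.

(* Arrangements of affine hyperplanes {x | a x + b = 0} of R^d, such a
   hyperplane being given by the pair (a, b). *)
Section Arrangement.
Variables (R : realType) (d : nat).

Definition hyp : Type := ('rV[R]_d * R)%type.

Definition heval (h : hyp) (x : 'rV[R]_d) : R := dot h.1 x + h.2.

Definition hyperplane (h : hyp) : set 'rV[R]_d := [set x | heval h x = 0].

Definition hside (h : hyp) (s : option bool) : set 'rV[R]_d :=
  match s with
  | None => hyperplane h
  | Some true => [set x | 0 < heval h x]
  | Some false => [set x | heval h x < 0]
  end.

Definition is_face (hs : seq hyp) (F : set 'rV[R]_d) : Prop :=
  F !=set0 /\
  exists s : nat -> option bool,
    F = [set x | forall i, (i < size hs)%N -> hside (nth (0, 0) hs i) (s i) x].

(* The face that contains x; faces being relatively open, x lies in its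
   relative interior. *)
Definition face_at (hs : seq hyp) (x : 'rV[R]_d) : set 'rV[R]_d :=
  [set y | forall i, (i < size hs)%N ->
     Num.sg (heval (nth (0, 0) hs i) y) = Num.sg (heval (nth (0, 0) hs i) x)].

(* X contains k + 1 affinely independent points. *)
Definition aff_indep_points (X : set 'rV[R]_d) (k : nat) : Prop :=
  exists (x0 : 'rV[R]_d) (P : 'M[R]_(k, d)),
    [/\ X x0, forall i, X (row i P) & row_free (\matrix_i (row i P - x0))].

Definition affdim (X : set 'rV[R]_d) (k : nat) : Prop :=
  aff_indep_points X k /\ forall k', aff_indep_points X k' -> (k' <= k)%N.

(* One record per face: its dimension, a point of its relative interior, the
   indices of the faces of the next dimension having it on their boundary, and,
   for a face of codimension one, the index of the hyperplane containing it. *)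
Record face_rec := FaceRec {
  fr_dim : nat;
  fr_point : 'rV[R]_d;
  fr_sup : seq nat;
  fr_hyp : nat
}.

Definition face_rec0 := FaceRec 0 0 [::] 0.

Definition fr_face (hs : seq hyp) (A : seq face_rec) (k : nat) : set 'rV[R]_d :=
  face_at hs (fr_point (nth face_rec0 A k)).

Definition describes_arrangement (hs : seq hyp) (A : seq face_rec) : Prop :=
  [/\ forall F, is_face hs F ->
        exists k, [/\ (k < size A)%N, F (fr_point (nth face_rec0 A k))
          & forall l, (l < size A)%N -> F (fr_point (nth face_rec0 A l)) -> l = k],
      forall k, (k < size A)%N ->
        affdim (fr_face hs A k) (fr_dim (nth face_rec0 A k)),
      forall k, (k < size A)%N -> uniq (fr_sup (nth face_rec0 A k)),
      forall k l, (k < size A)%N ->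
        l \in fr_sup (nth face_rec0 A k) <->
        [/\ (l < size A)%N,
            fr_dim (nth face_rec0 A l) = (fr_dim (nth face_rec0 A k)).+1
          & fr_face hs A k `<=` closure (fr_face hs A l)]
    & forall k, (k < size A)%N -> (fr_dim (nth face_rec0 A k)).+1 = d ->
        (fr_hyp (nth face_rec0 A k) < size hs)%N /\
        fr_face hs A k `<=` hyperplane (nth (0, 0) hs (fr_hyp (nth face_rec0 A k)))].

(* hs is a duplicate-free list of genuine hyperplanes. *)
Definition proper_hyps (hs : seq hyp) : Prop :=
  (forall i, (i < size hs)%N -> (nth (0, 0) hs i).1 != 0) /\
  (forall i j, (i < size hs)%N -> (j < size hs)%N -> i <> j ->
     hyperplane (nth (0, 0) hs i) <> hyperplane (nth (0, 0) hs j)).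

End Arrangement.

(* A value together with the number of steps spent on computing it. *)
Section Timed.

Definition timed (A : Type) : Type := (A * nat)%type.
Definition charge A (k : nat) (a : A) : timed A := (a, k).
Definition bind A B (m : timed A) (f : A -> timed B) : timed B :=
  ((f m.1).1, (m.2 + (f m.1).2)%N).

(* Sequences used as random-access arrays. *)
Definition aget A (x0 : A) (a : seq A) (i : nat) : timed A :=
  charge 1 (nth x0 a i).
Definition aset A (x0 : A) (a : seq A) (i : nat) (x : A) : timed (seq A) :=
  charge 1 (set_nth x0 a i x).

End Timed.

Notation "'let!' x := m 'in' k" := (bind m (fun x => k))
  (at level 200, x pattern, m at level 200, k at level 200,
   format "'[v' 'let!'  x  :=  m  'in' '/' k ']'").

(* The subroutines taken from the literature.  The arrangement algorithm of
   Edelsbrunner et al. takes O(N^d) time for N hyperplanes of R^d if d >= 2;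
   for d = 1 it is sorting, whence the summand N log N, which is subsumed by
   N^d if d >= 2. *)
Record arrangement_algorithm (R : realType) (d : nat) := ArrangementAlgorithm {
  arr_run : seq (hyp R d) -> timed (seq (face_rec R d));
  arr_correct : forall hs, proper_hyps hs ->
    describes_arrangement hs (arr_run hs).1;
  arr_const : nat;
  arr_time : forall hs, proper_hyps hs -> (0 < size hs)%N ->
    ((arr_run hs).2 <=
      arr_const * (size hs ^ d + size hs * trunc_log 2 (size hs)))%N
}.

(* Dynamic trees on the vertex set V, df_edges D being the forest that D
   represents.  Operations return a new version of the structure. *)
Record dynamic_forest (V : finType) := DynamicForest {
  df : Type;
  df_edges : df -> {set {set V}};
  df_forest : forall D, forest (df_edges D);
  df_empty : timed df;
  df_link : df -> {set V} -> timed df;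
  df_cut : df -> {set V} -> timed df;
  df_mem : df -> {set V} -> timed bool;
  df_joined : df -> {set V} -> timed bool;
  df_emptyP : df_edges df_empty.1 = finset.set0;
  df_linkP : forall D (e : {set V}), #|e| = 2%N -> ~~ joined (df_edges D) e ->
    df_edges (df_link D e).1 = (e |: df_edges D)%SET;
  df_cutP : forall D (e : {set V}), e \in df_edges D ->
    df_edges (df_cut D e).1 = (df_edges D :\ e)%SET;
  df_memP : forall D (e : {set V}), #|e| = 2%N -> (df_mem D e).1 = (e \in df_edges D);
  df_joinedP : forall D (e : {set V}), #|e| = 2%N -> (df_joined D e).1 = joined (df_edges D) e
}.

Definition logarithmic_time (DT : forall V : finType, dynamic_forest V) : Prop :=
  exists C : nat, forall V : finType, (1 < #|V|)%N ->
    ((df_empty (DT V)).2 <= C * (#|V| * trunc_log 2 #|V|))%N /\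
    forall (D : df (DT V)) (e : {set V}),
      [/\ ((df_link D e).2 <= C * trunc_log 2 #|V|)%N,
          ((df_cut D e).2 <= C * trunc_log 2 #|V|)%N,
          ((df_mem D e).2 <= C * trunc_log 2 #|V|)%N
        & ((df_joined D e).2 <= C * trunc_log 2 #|V|)%N].

(* Dictionaries as 2-3 trees. *)
Section Dictionary.
Variables (K A : Type) (cmp : K -> K -> timed comparison).

Inductive dict :=
| Leaf
| Node2 of dict & (K * A)%type & dict
| Node3 of dict & (K * A)%type & dict & (K * A)%type & dict.

(* Result of an insertion: a tree of the same height, or two trees of that
   height with a separating entry. *)
Inductive grown :=
| Same of dict
| Split of dict & (K * A)%type & dict.

(* The entry of key x becomes upd None if x was absent, and upd (Some a) if it
   was a. *)
Fixpoint insert (x : K) (upd : option A -> A) (t : dict) : timed grown :=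
  match t with
  | Leaf => charge 1 (Split Leaf (x, upd None) Leaf)
  | Node2 l a r =>
    let! o := cmp x a.1 in
    match o with
    | Eq => charge 1 (Same (Node2 l (a.1, upd (Some a.2)) r))
    | Lt =>
      let! g := insert x upd l in
      charge 1 (match g with
                | Same l' => Same (Node2 l' a r)
                | Split l1 b l2 => Same (Node3 l1 b l2 a r)
                end)
    | Gt =>
      let! g := insert x upd r in
      charge 1 (match g with
                | Same r' => Same (Node2 l a r')
                | Split r1 b r2 => Same (Node3 l a r1 b r2)
                end)
    end
  | Node3 l a m b r =>
    let! o := cmp x a.1 in
    match o with
    | Eq => charge 1 (Same (Node3 l (a.1, upd (Some a.2)) m b r))
    | Lt =>
      let! g := insert x upd l in
      charge 1 (match g with
                | Same l' => Same (Node3 l' a m b r)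
                | Split l1 z l2 => Split (Node2 l1 z l2) a (Node2 m b r)
                end)
    | Gt =>
      let! o' := cmp x b.1 in
      match o' with
      | Eq => charge 1 (Same (Node3 l a m (b.1, upd (Some b.2)) r))
      | Lt =>
        let! g := insert x upd m in
        charge 1 (match g with
                  | Same m' => Same (Node3 l a m' b r)
                  | Split m1 z m2 => Split (Node2 l a m1) z (Node2 m2 b r)
                  end)
      | Gt =>
        let! g := insert x upd r in
        charge 1 (match g with
                  | Same r' => Same (Node3 l a m b r')
                  | Split r1 z r2 => Split (Node2 l a m) b (Node2 r1 z r2)
                  end)
      end
    end
  end.

Definition upsert (x : K) (upd : option A -> A) (t : dict) : timed dict :=
  let! g := insert x upd t in
  charge 1 (match g with Same t' => t' | Split l a r => Node2 l a r end).

Fixpoint entries (t : dict) (acc : seq (K * A)) : timed (seq (K * A)) :=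
  match t with
  | Leaf => charge 1 acc
  | Node2 l a r =>
    let! s := entries r acc in
    let! s' := charge 1 (a :: s) in
    entries l s'
  | Node3 l a m b r =>
    let! s := entries r acc in
    let! s1 := charge 1 (b :: s) in
    let! s2 := entries m s1 in
    let! s3 := charge 1 (a :: s2) in
    entries l s3
  end.

End Dictionary.

Arguments Leaf {K A}.

(* Every arithmetic operation or comparison of reals, array access, or list
   operation is charged a unit of time; an operation on a whole vector is
   charged (a constant multiple of) the number of its entries. *)
Section Algorithm.
Variables (R : realType) (d : nat).
Local Notation p := d.+1.
Local Notation vec := 'rV[R]_p.

Variables (arr : arrangement_algorithm R d)
          (DT : forall V : finType, dynamic_forest V)
          (choose : seq nat -> nat)
          (V : finType) (E : {set {set V}}) (c : {set V} -> vec).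

Local Notation edge := {set V}.
Local Notation dtree := (df (DT V)).

Fixpoint lex_cmp (s t : seq R) : comparison :=
  match s, t with
  | x :: s', y :: t' =>
    if x < y then Lt else if y < x then Gt else lex_cmp s' t'
  | _, _ => Eq
  end.

Definition vcmp (y z : vec) : timed comparison :=
  charge (2 * p) (lex_cmp [seq y 0 i | i <- enum 'I_p] [seq z 0 i | i <- enum 'I_p]).

Definition vleqq (y z : vec) : timed bool := charge p (leqq y z).

Definition lighter (l : vec) (e f : edge) : timed bool :=
  charge (4 * p) (dot l (c e) < dot l (c f)).

(* An element of the arrangement's input is either h(e, f) or b_i. *)
Definition label : Type := ((edge * edge) + 'I_p)%type.

Definition normal (h : label) : vec :=
  match h with
  | inl ef => c ef.1 - c ef.2
  | inr i => delta_mx 0 i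
  end.

Fixpoint incomparable_with (e : edge) (es : seq edge) : timed (seq label) :=
  match es with
  | [::] => charge 1 [::]
  | f :: es' =>
    let! b1 := vleqq (c e) (c f) in
    let! b2 := vleqq (c f) (c e) in
    let! hs := incomparable_with e es' in
    charge 1 (if b1 || b2 then hs else inl (e, f) :: hs)
  end.

Fixpoint incomparable_pairs (es : seq edge) : timed (seq label) :=
  match es with
  | [::] => charge 1 [::]
  | e :: es' =>
    let! hs := incomparable_with e es' in
    let! hs' := incomparable_pairs es' in
    charge (size hs).+1 (hs ++ hs')
  end.

(* With x the first p - 1 entries of l and sum l = 1,
   sum_i v_i l_i = sum_(i < p) (v_i - v_p) x_i + v_p. *)
Definition project_hyp (v : vec) : hyp R d :=
  (\row_j (v 0 (lift ord_max j) - v 0 ord_max), v 0 ord_max).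

Definition project_weight (l : vec) : 'rV[R]_d := \row_j l 0 (lift ord_max j).

Definition lift_weight (x : 'rV[R]_d) : vec :=
  \row_i (if unlift ord_max i is Some j then x 0 j else 1 - \sum_j x 0 j).

Fixpoint project_all (hs : seq label) : timed (seq (hyp R d)) :=
  match hs with
  | [::] => charge 1 [::]
  | h :: hs' =>
    let! a := charge (2 * p) (project_hyp (normal h)) in
    let! r := project_all hs' in
    charge 1 (a :: r)
  end.

(* Whether a face corresponds to a subset of the weight set. *)
Definition relevant (F : face_rec R d) : timed bool :=
  charge (2 * p) (positive (lift_weight (fr_point F))).

(* Adjacency lists of the incidence graph; the entry (k, j) in the list of a
   cell records that the cell k is adjacent to it across the hyperplane j. *)
Definition graph : Type := seq (seq (nat * nat)).

Fixpoint add_facets (As : seq (face_rec R d)) (g : graph) : timed graph :=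
  match As with
  | [::] => charge 1 g
  | F :: As' =>
    let! b := relevant F in
    let! g' :=
      if ((fr_dim F).+1 == d) && b then
        match fr_sup F with
        | [:: k1; k2] =>
          let! s1 := aget [::] g k1 in
          let! g1 := aset [::] g k1 ((k2, fr_hyp F) :: s1) in
          let! s2 := aget [::] g1 k2 in
          aset [::] g1 k2 ((k1, fr_hyp F) :: s2)
        | _ => charge 1 g
        end
      else charge 1 g in
    add_facets As' g'
  end.

Definition incidence_graph (A : seq (face_rec R d)) : timed graph :=
  let! g := charge (size A).+1 (nseq (size A) [::]) in
  add_facets A g.

Fixpoint relevant_cells (k : nat) (As : seq (face_rec R d)) : timed (seq nat) :=
  match As with
  | [::] => charge 1 [::]
  | F :: As' =>
    let! b := relevant F in
    let! s := relevant_cells k.+1 As' in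
    charge 1 (if (fr_dim F == d) && b then k :: s else s)
  end.

(* Kruskal's algorithm, returning the minimum spanning tree and its cost. *)
Fixpoint insert_edge (l : vec) (e : edge) (s : seq edge) : timed (seq edge) :=
  match s with
  | [::] => charge 1 [:: e]
  | f :: s' =>
    let! b := lighter l e f in
    if b then charge 1 (e :: s)
    else let! r := insert_edge l e s' in charge 1 (f :: r)
  end.

Fixpoint sort_edges (l : vec) (s : seq edge) : timed (seq edge) :=
  match s with
  | [::] => charge 1 [::]
  | e :: s' => let! r := sort_edges l s' in insert_edge l e r
  end.

Fixpoint kruskal_loop (es : seq edge) (D : dtree) (y : vec) : timed (dtree * vec) :=
  match es with
  | [::] => charge 1 (D, y)
  | e :: es' =>
    let! b := df_joined D e in
    if b then let! y' := charge 1 y in kruskal_loop es' D y'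
    else
      let! D' := df_link D e in
      let! y' := charge p (y + c e) in
      kruskal_loop es' D' y'
  end.

Definition kruskal (l : vec) : timed (dtree * vec) :=
  let! es := sort_edges l (enum E) in
  let! D := df_empty (DT V) in
  kruskal_loop es D 0.

(* Exchange eout for ein if eout is in the tree, ein is not, and eout lies on
   the cycle that ein closes. *)
Definition swap_test (D : dtree) (y : vec) (eout ein : edge) : timed (dtree * vec) :=
  let! b1 := df_mem D eout in
  let! b2 := df_mem D ein in
  if b1 && ~~ b2 then
    let! D1 := df_cut D eout in
    let! b := df_joined D1 ein in
    if b then charge 1 (D, y)
    else
      let! D2 := df_link D1 ein in
      charge (2 * p) (D2, y - c eout + c ein)
  else charge 1 (D, y).

(* The tree for a cell with interior point l, from the tree D of the adjacent
   cell on the other side of the hyperplane h. *)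
Definition cycle_test (l : vec) (h : label) (D : dtree) (y : vec)
    : timed (dtree * vec) :=
  match h with
  | inl (e, f) =>
    let! b := lighter l e f in
    if b then swap_test D y f e else swap_test D y e f
  | inr _ => charge 1 (D, y)
  end.

(* Value stored for a point of Y_exN: a weight, and the cells whose polytopes
   make up the component. *)
Definition stored : Type := (vec * seq nat)%type.

Definition record_cell (l : vec) (k : nat) (o : option stored) : stored :=
  match o with
  | None => (l, [:: k])
  | Some (l', ks) => (l', k :: ks)
  end.

Record bfs_state := BfsState {
  visited : seq bool;
  queue : seq (nat * (dtree * vec));
  found : dict vec stored
}.

Section Bfs.
Variables (hs : seq label) (A : seq (face_rec R d)) (g : graph).

Definition cell_weight (k : nat) : timed vec :=
  let! F := aget (face_rec0 R d) A k in
  charge (2 * p) (lift_weight (fr_point F)).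

Fixpoint visit (D : dtree) (y : vec) (nbs : seq (nat * nat)) (st : bfs_state)
    : timed bfs_state :=
  match nbs with
  | [::] => charge 1 st
  | (k, j) :: nbs' =>
    let! b := aget false (visited st) k in
    let! st' :=
      if b then charge 1 st
      else
        let! vis := aset false (visited st) k true in
        let! l := cell_weight k in
        let! h := aget (inr ord0) hs j in
        let! Dy := cycle_test l h D y in
        let! t := upsert vcmp Dy.2 (record_cell l k) (found st) in
        charge 1 (BfsState vis (rcons (queue st) (k, Dy)) t) in
    visit D y nbs' st'
  end.

Fixpoint bfs (fuel : nat) (st : bfs_state) : timed bfs_state :=
  match fuel, queue st with
  | fuel'.+1, (k, (D, y)) :: q =>
    let! nbs := aget [::] g k in
    let! st' := visit D y nbs (BfsState (visited st) q (found st)) in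
    bfs fuel' st'
  | _, _ => charge 1 st
  end.

(* Every face enters the queue at most once, so that the fuel suffices. *)
Definition explore (k : nat) : timed (dict vec stored) :=
  let! l := cell_weight k in
  let! Dy := kruskal l in
  let! t := upsert vcmp Dy.2 (record_cell l k) Leaf in
  let! vis := charge (size A).+1 (nseq (size A) false) in
  let! vis' := aset false vis k true in
  let! st := bfs (size A) (BfsState vis' [:: (k, Dy)] t) in
  charge 1 (found st).

End Bfs.

(* The hyperplanes and faces of the arrangement, and the list of the pairs
   (y, (l, ks)) of a point y, the weight stored for it, and the cells ks of its
   component. *)
Record output := Output {
  out_hyps : seq (hyp R d);
  out_faces : seq (face_rec R d);
  out_entries : seq (vec * stored)
}.

Definition weight_set_algorithm : timed output :=
  let! hs1 := incomparable_pairs (enum E) in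
  let! hs := charge (size hs1 + p) (hs1 ++ [seq inr i | i <- enum 'I_p]) in
  let! as_ := project_all hs in
  let! A := arr_run arr as_ in
  let! g := incidence_graph A in
  let! cells := relevant_cells 0 A in
  let! k := charge 1 (choose cells) in
  let! t := explore hs A g k in
  let! es := entries t [::] in
  charge 1 (Output as_ A es).

(* The polytope in the weight set that corresponds to the k-th face. *)
Definition polytope (o : output) (k : nat) : set vec :=
  [set l | weight_set l /\
     closure (fr_face (out_hyps o) (out_faces o) k) (project_weight l)].

Definition computes_decomposition (o : output) : Prop :=
  [/\ uniq [seq en.1 | en <- out_entries o],
      [set` [seq en.1 | en <- out_entries o]] = Y_exN E c,
      forall en, en \in out_entries o ->
        (forall k, k \in en.2.2 -> (k < size (out_faces o))%N /\
           fr_dim (nth (face_rec0 R d) (out_faces o) k) = d) /\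
        \bigcup_(k in [set` en.2.2]) polytope o k = weight_component E c en.1
    & weight_set (R := R) (d := d) = \bigcup_(y in Y_exN E c) weight_component E c y].

End Algorithm.

(* Main.v *)
(* Intersected with the affine hull of the weight set, the hyperplanes h(e, f)
   of incomparable edges and the b_i become an arrangement of N = O(m^2)
   hyperplanes in R^d, d = p - 1, and a face is a sign vector.  On a relevant
   cell the weights order the edges strictly and in a constant way, so that the
   minimum spanning tree is unique and constant there; it stays optimal on the
   closure of the cell, as optimality of a tree T only depends on the
   comparisons of a and b for the exchanges T - a + b.  Across a facet in
   h(e, f) only the comparison of e and f changes, and on the facet both are
   equally heavy: the tree of the next cell is the old tree or its exchange of
   e and f.

   A cost vector that is optimal at a generic weight is extreme supported.
   Conversely an extreme supported point is, by Gordan's alternative, the unique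
   minimum at some weight, hence at a generic one.  So the points found are
   exactly Y_exN as soon as the search reaches every relevant cell; it does,
   since a segment between two cells can be moved so as to cross the
   hyperplanes one at a time.

   N hyperplanes of R^d have at most (2 N + 1)^d faces.  Discovering a cell
   costs O(log n), for the cycle test and for the dictionary, whose size is
   polynomial in m; Kruskal's algorithm and the pairs of edges cost O(m^2). *)

Require Import Defs.
From mathcomp Require Import all_boot all_order all_algebra.
From mathcomp Require Import boolp classical_sets reals topology normedtype.
From mathcomp Require Import zify ring lra.

Set Implicit Arguments.
Unset Strict Implicit.
Unset Printing Implicit Defensive.

Import Order.TTheory GRing.Theory Num.Theory.

(** * Spanning trees *)

Section SpanningTrees.
Local Open Scope set_scope.
Variable V : finType.
Implicit Types (F S T E : {set {set V}}) (e a b : {set V}).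

(** The standing assumption speaks of hyperplanes through the origin of R^p, while the arrangement
    lives in the affine hull of the weight set. For a facet to have a single wall, distinctness must
    pass to the traces. It does because the trace of an incomparable pair is a genuine hyperplane (a
    normal with equal entries would make the edges comparable) and determines the central
    hyperplane. Comparable pairs have no hyperplane; their order is fixed by positivity of the
    weights.

    Ties on the walls are the other obstacle: there the minimum spanning tree is not unique. Hence
    optimality is always expressed by single exchanges, a criterion that tolerates ties and rests on
    the symmetric exchange property of spanning trees.

    Topology enters only in the translation of closures of faces into the sign condition [face_le];
    from then on everything is perturbation of finitely many affine forms by [small_step].

    The search is charged per adjacency entry. As a facet yields two entries, the total is linear in
    the number of faces. *)

Lemma adj_sym F : symmetric (adj F).
Proof. by move=> u v; rewrite /adj eq_sym finset.setUC. Qed.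

Lemma connect_adjC F u v : connect (adj F) u v = connect (adj F) v u.
Proof. exact: (sym_connect_sym (@adj_sym F)). Qed.

Lemma connect_adjS F F' u v :
  F \subset F' -> connect (adj F) u v -> connect (adj F') u v.
Proof.
move=> sFF'; apply: (connect_sub (e := adj F)) => x y /andP[xy Fxy].
by apply: connect1; rewrite /adj xy (fintype.subsetP sFF').
Qed.

Lemma joinedE F e u v : e = [set u; v] -> joined F e = connect (adj F) u v.
Proof.
move=> ->; apply/forall_inP/idP => [/(_ u) | uv x].
  rewrite !inE eqxx => /(_ isT) /forall_inP/(_ v).
  by rewrite !inE eqxx orbT; apply.
rewrite !inE => xuv; apply/forall_inP => y; rewrite !inE => yuv.
by case/orP: xuv => /eqP->; case/orP: yuv => /eqP->; rewrite ?connect0 // connect_adjC.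
Qed.

Lemma joined_connect F e u v : joined F e -> u \in e -> v \in e -> connect (adj F) u v.
Proof. by move=> /forall_inP/(_ u) h /h /forall_inP; apply. Qed.

Lemma joinedS F F' e : F \subset F' -> joined F e -> joined F' e.
Proof.
move=> sFF' Fe; apply/forall_inP => x ex; apply/forall_inP => y ey.
exact: connect_adjS sFF' (joined_connect Fe ex ey).
Qed.

Lemma path_adjD1 F e w x p :
  w \in e -> w \notin x :: p -> path (adj F) x p -> path (adj (F :\ e)) x p.
Proof.
move=> we; elim: p x => //= y p IHp x.
rewrite 2!inE !negb_or => /and3P[wx wy wp] /andP[/andP[xy Fxy] yp].
rewrite IHp ?inE ?negb_or ?wy // andbT /adj xy !inE Fxy andbT.
by apply: contraTneq we => <-; rewrite !inE negb_or wx.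
Qed.

(* Unlike the absence of cycles, this form is easily transferred to the edge
   sets obtained by exchanges. *)
Lemma acyclicP F :
  acyclic F <-> forall u v, adj F u v -> ~~ connect (adj (F :\ [set u; v])) u v.
Proof.
split=> [acF u v /andP[uv Fuv] | bridgeF [|u [|v [|w s]]] //].
  apply/negP => /connectP[p up lastp].
  case/shortenP: up lastp => q uq uniq_q _ lastq.
  have{}uq' : path (adj F) u q.
    by apply: sub_path uq => x y; rewrite /adj !inE => /and3P[-> _ ->].
  apply: (acF (u :: q)); last first.
    rewrite /ucycle uniq_q andbT /cycle rcons_path uq' -lastq.
    by rewrite adj_sym /adj uv.
  case: q uq lastq {uniq_q uq'} => [|x [|y q]] //=; first by move=> _ uv'; rewrite uv' eqxx in uv.
  by rewrite andbT => ux xv; move: ux; rewrite -xv /adj !inE eqxx andbF.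
move=> _ /andP[cyc]; rewrite [uniq _]/=.
move=> /andP[]; rewrite !inE !negb_or.
move=> /and3P[uv uw us] /andP[/andP[vw vs] /andP[ws uniq_s]].
move: cyc; rewrite [cycle _ _]/= rcons_path => /andP[Fuv] /andP[Fvw] /andP[ps lasts].
have/negP[] := bridgeF _ _ Fuv.
(* The rest of the cycle, from [w] back to [u], avoids [v] and hence the edge [[set u; v]]; the step
   from [v] to [w] is another edge because [w] differs from [u]. *)
rewrite connect_adjC; apply: (@connect_trans _ _ w).
  apply: connect1; case/andP: Fvw => _ Fvw; rewrite /adj vw !inE Fvw andbT.
  apply: contraNneq uw => eq_vw; have : u \in [set u; v] by rewrite !inE eqxx.
  by rewrite -eq_vw !inE (negPf uv) => /eqP->.
apply/connectP; exists (rcons s u); last by rewrite last_rcons.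
apply: (@path_adjD1 _ _ v); first by rewrite !inE eqxx orbT.
  by rewrite inE mem_rcons inE !negb_or vw eq_sym uv.
by rewrite rcons_path ps.
Qed.

(** Repeated traversals of the new edge cancel, so a walk need use it at most once, in one direction
    or the other. *)
Lemma connect_setU1 F u v x y :
  connect (adj ([set u; v] |: F)) x y ->
  [|| connect (adj F) x y, connect (adj F) x u && connect (adj F) v y
    | connect (adj F) x v && connect (adj F) u y].
Proof.
case/connectP => p; elim: p x => [x _ -> | z p IHp x /= /andP[xz zp] /(IHp _ zp)].
  by rewrite connect0.
case/andP: xz => xz; rewrite !inE => /predU1P[xz_uv | Fxz]; last first.
  have cxz : connect (adj F) x z by apply: connect1; rewrite /adj xz.
  by case/or3P => [/(connect_trans cxz)-> // | /andP[/(connect_trans cxz)-> ->]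
    | /andP[/(connect_trans cxz)-> ->]]; rewrite ?orbT.
have xuv : x \in [set u; v] by rewrite -xz_uv !inE eqxx.
have zuv : z \in [set u; v] by rewrite -xz_uv !inE eqxx orbT.
move: xuv zuv xz; rewrite !inE.
case/orP=> /eqP->; case/orP=> /eqP->; rewrite ?eqxx // => _; rewrite !connect0 /=.
  by case/or3P=> [->|/andP[_ ->]|->]; rewrite ?orbT.
by case/or3P=> [->|->|/andP[_ ->]]; rewrite ?orbT.
Qed.

Lemma acyclicS F F' : F \subset F' -> acyclic F' -> acyclic F.
Proof.
move=> sFF' acF' s s_gt2 /andP[cyc uniqs]; apply: (acF' s s_gt2).
apply/andP; split=> //; move: cyc; apply: sub_cycle => x y.
by rewrite /adj => /andP[-> /(fintype.subsetP sFF')->].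
Qed.

Lemma acyclicU1 F u v :
  ~~ connect (adj F) u v -> acyclic F -> acyclic ([set u; v] |: F).
Proof.
move=> nuv acF.
have uv : u != v by apply: contraNneq nuv => ->.
have FNe : [set u; v] \notin F.
  by apply: contraNN nuv => Fuv; apply: connect1; rewrite /adj uv.
apply/acyclicP => x y /andP[xy]; rewrite !inE => /predU1P[xy_uv | Fxy].
  rewrite xy_uv finset.setU1K //.
  have xuv : x \in [set u; v] by rewrite -xy_uv !inE eqxx.
  have yuv : y \in [set u; v] by rewrite -xy_uv !inE eqxx orbT.
  move: xuv yuv xy; rewrite !inE.
  by case/orP=> /eqP->; case/orP=> /eqP->; rewrite ?eqxx // connect_adjC.
have brxy := (acyclicP F).1 acF x y; rewrite /adj xy Fxy in brxy.
(* As [F] is acyclic, a path from [x] to [y] beside the edge [[set x; y]] must use the new edge;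
   closing it through [[set x; y]] would connect [u] and [v] already in [F]. *)
apply/negP => cxy.
have {}cxy : connect (adj ([set u; v] |: F :\ [set x; y])) x y.
  apply: connect_adjS cxy; apply/fintype.subsetP => e; rewrite !inE.
  by case/andP=> -> /predU1P[->|->]; rewrite ?eqxx ?orbT.
have sub w z : connect (adj (F :\ [set x; y])) w z -> connect (adj F) w z.
  by apply: connect_adjS; apply: finset.subD1set.
have Cxy : connect (adj F) x y by apply: connect1; rewrite /adj xy.
case/or3P: (connect_setU1 cxy); first by apply/negP/brxy.
  case/andP=> /sub xu /sub vy; case/negP: nuv.
  by rewrite connect_adjC in xu; apply: connect_trans xu (connect_trans Cxy _); rewrite connect_adjC.
case/andP=> /sub xv /sub uy; case/negP: nuv.
by apply: connect_trans uy (connect_trans _ xv); rewrite connect_adjC.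
Qed.

Lemma spanning_tree_bridge E T u v :
  spanning_tree E T -> u != v -> [set u; v] \in T ->
  ~~ connect (adj (T :\ [set u; v])) u v.
Proof. by case=> _ _ /acyclicP br uv Tuv; apply: br; rewrite /adj uv. Qed.

Lemma edgeP E e : simple_graph E -> e \in E -> exists u v, u != v /\ e = [set u; v].
Proof. move=> simpE Ee; have/eqP/cards2P := simpE e Ee.
by case=> u [v [uv ->]]; exists u; exists v. Qed.

(** Deleting [a] leaves exactly two components, those of the ends of [a]; the exchange succeeds
    precisely when [b] runs between them. *)
Lemma spanning_tree_swapP E T a b :
  simple_graph E -> spanning_tree E T -> a \in T -> b \in E -> b \notin T ->
  ~~ joined (T :\ a) b <-> spanning_tree E (b |: T :\ a).
Proof.
move=> simpE stT Ta Eb NTb; have [sTE conT acT] := stT.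
have [u [v [uv def_b]]] := edgeP simpE Eb.
have [x [y [xy def_a]]] := edgeP simpE (fintype.subsetP sTE _ Ta).
have brxy : ~~ connect (adj (T :\ a)) x y.
  by rewrite def_a (spanning_tree_bridge stT) // -def_a.
have comp w : connect (adj (T :\ a)) w x || connect (adj (T :\ a)) w y.
  have := conT w x; rewrite -{1}(finset.setD1K Ta) {1}def_a => /connect_setU1.
  by case/or3P => [->//|/andP[-> //]|/andP[->]]; rewrite orbT.
rewrite (joinedE _ def_b); split=> [nuv | [_ _ acTb]]; last first.
  have bNT : b \notin T :\ a by rewrite !inE negb_and NTb orbT.
  have := (acyclicP _).1 acTb u v; rewrite /adj -def_b finset.setU1K // uv finset.setU11.
  by apply.
split.
- apply/fintype.subsetP => e; rewrite !inE => /predU1P[->//|/andP[_]].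
  exact: (fintype.subsetP sTE).
- have sub w z : connect (adj (T :\ a)) w z -> connect (adj (b |: T :\ a)) w z.
    by apply: connect_adjS; apply: finset.subsetUr.
  have cuv : connect (adj (b |: T :\ a)) u v.
    by apply: connect1; rewrite /adj uv -def_b finset.setU11.
  have cxy : connect (adj (b |: T :\ a)) x y.
    case/orP: (comp u) => cu; case/orP: (comp v) => cv.
    + by case/negP: nuv; apply: connect_trans cu _; rewrite connect_adjC.
    + apply: connect_trans (connect_trans cuv (sub _ _ cv)).
      by rewrite connect_adjC sub.
    + rewrite connect_adjC in cuv.
      apply: connect_trans (connect_trans cuv (sub _ _ cu)).
      by rewrite connect_adjC sub.
    + by case/negP: nuv; apply: connect_trans cu _; rewrite connect_adjC.
  have cx w : connect (adj (b |: T :\ a)) w x.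
    case/orP: (comp w) => /sub // cw; apply: connect_trans cw _.
    by rewrite connect_adjC.
  by move=> w z; apply: connect_trans (cx w) _; rewrite connect_adjC.
- rewrite def_b; apply: acyclicU1 => //.
  by apply: acyclicS acT; apply: finset.subD1set.
Qed.

(** On a simple path the two remaining pieces avoid the crossing edge, so each of its ends stays
    connected to an end of the path when that edge is deleted. *)
Lemma connect_crossing F (P : pred V) u v :
  acyclic F -> connect (adj F) u v -> P u -> ~~ P v ->
  exists x y, [/\ x != y, [set x; y] \in F, P x, ~~ P y
    & connect (adj (F :\ [set x; y])) u x && connect (adj (F :\ [set x; y])) y v].
Proof.
move=> acF /connectP[p0 path0 last0] Pu NPv.
case/shortenP: path0 last0 => p up uniq_p _ lastp.
(* That [x] and [y] lie on the path is recorded for the induction: a simple path does not return to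
   its first vertex, so the first edge differs from the crossing edge. *)
suff [x [y [xp yp xy Fxy [Px NPy cux cyv]]]] : exists x y,
    [/\ x \in u :: p, y \in u :: p, x != y, [set x; y] \in F &
      [/\ P x, ~~ P y, connect (adj (F :\ [set x; y])) u x
        & connect (adj (F :\ [set x; y])) y v]].
  by exists x, y; split=> //; rewrite cux cyv.
elim: p u Pu up uniq_p lastp {p0} => [|w p IHp] u Pu /=.
  by move=> _ _ eq_vu; rewrite eq_vu Pu in NPv.
move=> /andP[/andP[uw Fuw] wp] /andP[]; rewrite inE negb_or => /andP[_ up] uniq_p lastp.
case: (boolP (P w)) => [Pw | NPw]; last first.
  exists u, w; split; rewrite ?inE ?eqxx ?orbT //; split=> //.
  apply/connectP; exists p => //; apply: (@path_adjD1 _ _ u) => //.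
    by rewrite !inE eqxx.
  by rewrite inE negb_or uw.
have [x [y [xp yp xy Fxy [Px NPy cwx cyv]]]] := IHp w Pw wp uniq_p lastp.
exists x, y; split; rewrite ?(inE, orbT) //; try by rewrite -in_cons ?xp ?yp orbT.
split=> //; apply: connect_trans cwx; apply: connect1; rewrite /adj uw !inE Fuw andbT /=.
apply: contraTneq (finset.set21 u w) => ->; rewrite !inE negb_or.
by apply/andP; split; [move: xp | move: yp]; apply: contraTneq => <-;
  rewrite inE negb_or uw.
Qed.

(** Symmetric exchange. Deleting [b] from [S] defines a cut, and the path of [T] between the ends of
    [b] crosses it in some [a]; this one edge serves in both directions. *)
Lemma spanning_tree_exchange E S T b :
  simple_graph E -> spanning_tree E S -> spanning_tree E T -> b \in S -> b \notin T ->
  exists a, [/\ a \in T, a \notin S, spanning_tree E (b |: T :\ a)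
    & spanning_tree E (a |: S :\ b)].
Proof.
move=> simpE stS stT Sb NTb; have [sSE conS acS] := stS; have [sTE conT acT] := stT.
have Eb := fintype.subsetP sSE _ Sb.
have [u [v [uv def_b]]] := edgeP simpE Eb.
have nuv : ~~ connect (adj (S :\ b)) u v.
  by rewrite def_b (spanning_tree_bridge stS) // -def_b.
have [x [y [xy Txy ux uy /andP[cux cyv]]]] :=
  connect_crossing acT (conT u v) (connect0 (adj (S :\ b)) u) nuv.
have nxy : ~~ connect (adj (S :\ b)) x y.
  by apply: contraNN uy => /(connect_trans ux).
have NSa : [set x; y] \notin S.
  have Nab : [set x; y] != b by apply: contraNneq NTb => <-.
  apply: contraNN nxy => Sa; apply: connect1.
  by rewrite /adj xy !inE Nab Sa.
exists [set x; y]; split=> //.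
  apply/(spanning_tree_swapP simpE stT) => //; rewrite (joinedE _ def_b).
  apply: contraNN (spanning_tree_bridge stT xy Txy) => cuv.
  apply: connect_trans (connect_trans (_ : connect _ x u) cuv) _; rewrite connect_adjC //.
apply/(spanning_tree_swapP simpE stS) => //; first exact: (fintype.subsetP sTE).
by rewrite (joinedE _ (erefl _)).
Qed.

Lemma spanning_tree_eq E S T :
  simple_graph E -> spanning_tree E S -> spanning_tree E T -> S \subset T -> S = T.
Proof.
move=> simpE [sSE conS acS] stT sST; apply/eqP; rewrite finset.eqEsubset sST /=.
apply/fintype.subsetP => a Ta; have [sTE _ _] := stT.
have [x [y [xy def_a]]] := edgeP simpE (fintype.subsetP sTE _ Ta).
rewrite def_a in Ta *; apply: contraNT (spanning_tree_bridge stT xy Ta) => NSa.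
apply: connect_adjS (conS x y); apply/fintype.subsetP => e Se.
by rewrite !inE (fintype.subsetP sST) // andbT; apply: contraNneq NSa => <-.
Qed.

End SpanningTrees.

(** * Hyperplanes and faces *)

Section AffineForms.
Import numFieldNormedType.Exports.
Local Open Scope ring_scope.
Variable R : realType.

Section Dot.
Variable n : nat.
Implicit Types (u v w : 'rV[R]_n) (a : R).

Lemma dotC u v : dot u v = dot v u.
Proof. by apply: eq_bigr => i _; rewrite mulrC. Qed.

Lemma dotDr u v w : dot u (v + w) = dot u v + dot u w.
Proof. by rewrite -big_split; apply: eq_bigr => i _; rewrite mxE mulrDr. Qed.

Lemma dotZr a u v : dot u (a *: v) = a * dot u v.
Proof. by rewrite mulr_sumr; apply: eq_bigr => i _; rewrite mxE mulrCA. Qed.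

Lemma dotNr u v : dot u (- v) = - dot u v.
Proof. by rewrite -scaleN1r dotZr mulN1r. Qed.

Lemma dotBr u v w : dot u (v - w) = dot u v - dot u w.
Proof. by rewrite dotDr dotNr. Qed.

Lemma dot0r u : dot u 0 = 0.
Proof. by rewrite -(scale0r 0) dotZr mul0r. Qed.

Lemma dotDl u v w : dot (u + v) w = dot u w + dot v w.
Proof. by rewrite dotC dotDr !(dotC w). Qed.

Lemma dotZl a u v : dot (a *: u) v = a * dot u v.
Proof. by rewrite dotC dotZr dotC. Qed.

Lemma dotBl u v w : dot (u - v) w = dot u w - dot v w.
Proof. by rewrite dotC dotBr !(dotC w). Qed.

Lemma dot_sumr I (r : seq I) (P : pred I) (F : I -> 'rV[R]_n) u :
  dot u (\sum_(i <- r | P i) F i) = \sum_(i <- r | P i) dot u (F i).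
Proof. by apply: (big_morph (dot u)) => [v w|]; rewrite (dotDr, dot0r). Qed.

Lemma dot_delta u i : dot u (delta_mx 0 i) = u 0 i.
Proof.
rewrite /dot (bigD1 i) //= mxE !eqxx mulr1 big1 ?addr0 // => j ji.
by rewrite mxE (negPf ji) andbF mulr0.
Qed.

Lemma dot_trmx u v : dot u v = (u *m v^T) 0 0.
Proof. by rewrite mxE; apply: eq_bigr => i _; rewrite mxE. Qed.

Lemma dot_gt0 u : u != 0 -> 0 < dot u u.
Proof.
case/rV0Pn=> i ui; rewrite /dot (bigD1 i) //= ltr_wpDr ?sumr_ge0 //.
  by move=> j _; rewrite -expr2 sqr_ge0.
by rewrite -expr2 exprn_even_gt0.
Qed.

End Dot.

(** Signs along a segment: starting from a point of the closure of a face, the segment to a point of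
    the face is inside it from the first moment. *)
Lemma sg_comb (a b t : R) : 0 < t <= 1 ->
  Num.sg a = 0 \/ Num.sg a = Num.sg b -> Num.sg (a + t * (b - a)) = Num.sg b.
Proof.
move=> /andP[t_gt0 t_le1]; case=> [/eqP | eq_sg].
  by rewrite sgr_eq0 => /eqP->; rewrite add0r subr0 sgrM gtr0_sg ?mul1r.
rewrite -eq_sg; have [a_gt0 | a_lt0 | a0] := ltgtP 0 a.
- have b_gt0 : 0 < b by rewrite -sgr_gt0 -eq_sg sgr_gt0.
  by rewrite !gtr0_sg //; nra.
- have b_lt0 : b < 0 by rewrite -sgr_lt0 -eq_sg sgr_lt0.
  by rewrite !ltr0_sg //; nra.
move: eq_sg; rewrite -a0 sgr0 => /esym/eqP; rewrite sgr_eq0 => /eqP->.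
by rewrite subrr mulr0 addr0 sgr0.
Qed.

Section Signs.
Variable d : nat.
Implicit Types (h g : hyp R d) (hs : seq (hyp R d)) (x y z : 'rV[R]_d).

Definition signs hs x : seq R := [seq Num.sg (heval h x) | h <- hs].

(* The face containing [x] lies in the closure of the face containing [y]. *)
Definition face_le hs x y : Prop := forall h, h \in hs ->
  Num.sg (heval h x) = 0 \/ Num.sg (heval h x) = Num.sg (heval h y).

Definition off_hyps hs x : Prop := forall h, h \in hs -> heval h x != 0.

Lemma signsP hs x y : signs hs x = signs hs y <->
  forall h, h \in hs -> Num.sg (heval h x) = Num.sg (heval h y).
Proof. by rewrite /signs; split=> [/eq_in_map | ?]; last exact/eq_in_map. Qed.

Lemma face_atE hs x y : face_at hs x y <-> signs hs y = signs hs x.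
Proof.
rewrite signsP; split=> [xy h /(nthP (0, 0))[i ilt <-] | xy i ilt]; first exact: xy.
by apply: xy; apply: mem_nth.
Qed.

Lemma is_face_at hs x : is_face hs (face_at hs x).
Proof.
split; first by exists x.
pose s i := let a := heval (nth (0, 0) hs i) x in
  if a == 0 then None else Some (0 < a).
exists s; apply/seteqP; split=> y xy i ilt.
  move: (xy i ilt); rewrite /s.
  case: (sgrP (heval _ x)) => [x0|x0|x0]; rewrite ?eqxx => /eqP.
  - by rewrite sgr_eq0 => /eqP.
  - move=> /eqP y1.
    by have y0 : 0 < heval (nth (0, 0) hs i) y by rewrite -sgr_gt0 y1 ltr01.
  - move=> /eqP y1.
    by have y0 : heval (nth (0, 0) hs i) y < 0 by rewrite -sgr_lt0 y1 ltrN10.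
move: (xy i ilt); rewrite /s /hside.
case: (sgrP (heval _ x)) => [x0|x0|x0].
- by rewrite /hyperplane /= => ->; rewrite sgr0.
- by move=> /= y0; rewrite gtr0_sg.
- by move=> /= y0; rewrite ltr0_sg.
Qed.

Lemma hevalD h x v : heval h (x + v) = heval h x + dot h.1 v.
Proof. by rewrite /heval dotDr addrAC. Qed.

Lemma dot_hevalB h x y : dot h.1 (x - y) = heval h x - heval h y.
Proof. by rewrite dotBr /heval; ring. Qed.

Lemma heval_line h x z t :
  heval h (x + t *: (z - x)) = heval h x + t * (heval h z - heval h x).
Proof. by rewrite hevalD dotZr dotBr /heval; congr (_ + t * _); ring. Qed.

Lemma heval_add_normal h x t : heval h (x + t *: h.1) = heval h x + t * dot h.1 h.1.
Proof. by rewrite hevalD dotZr. Qed.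

Lemma heval_nonconst h : h.1 != 0 -> exists z, heval h z != 0.
Proof.
move=> h0; case: (eqVneq (heval h 0) 0) => [z0|]; last by exists 0.
exists (0 + 1 *: h.1); rewrite heval_add_normal z0 add0r mul1r.
by rewrite gt_eqF // dot_gt0.
Qed.

(** The perturbation principle of the whole proof: after a short step from [x] towards [z], the
    target decides only the signs that [x] leaves open. *)
Lemma small_step hs x z : exists2 e, 0 < e <= 1 & forall t, 0 < t <= e ->
  forall h, h \in hs -> Num.sg (heval h (x + t *: (z - x))) =
    if heval h x == 0 then Num.sg (heval h z) else Num.sg (heval h x).
Proof.
elim: hs => [|h hs [e /andP[e_gt0 e_le1] IH]]; first by exists 1; rewrite ?ltr01 ?lexx.
suff [e' /andP[e'_gt0 e'_le1] He'] : exists2 e', 0 < e' <= 1 & forall t, 0 < t <= e' ->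
    Num.sg (heval h (x + t *: (z - x))) =
      if heval h x == 0 then Num.sg (heval h z) else Num.sg (heval h x).
  exists (Num.min e e'); first by rewrite lt_min e_gt0 e'_gt0 ge_min e_le1.
  move=> t /andP[t_gt0]; rewrite le_min => /andP[te te'] g.
  by rewrite inE => /predU1P[-> | ghs]; [apply: He' | apply: IH]; rewrite ?t_gt0.
case: eqP => [hx0 | /eqP hx0].
  exists 1; rewrite ?ltr01 ?lexx // => t t01; rewrite heval_line.
  by apply: sg_comb t01 _; left; rewrite hx0 sgr0.
set a := heval h x in hx0 *; set b := heval h z.
(* The summand [a] in the denominator keeps it positive when [b = a]; halving the quotient makes the
   change of the form strictly smaller than its value at [x]. *)
pose e' := `|a| / (`|a| + `|b - a|).
have a_gt0 : 0 < `|a| by rewrite normr_gt0.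
have den_gt0 : 0 < `|a| + `|b - a| by rewrite ltr_wpDr.
exists (e' / 2); first by rewrite divr_gt0 ?divr_gt0 //= /e' ler_pdivrMr // ler_pdivrMr //
  ; have := normr_ge0 (b - a); nra.
move=> t /andP[t_gt0]; rewrite /e' => te; rewrite heval_line -/a -/b.
have lt_ta : `|t * (b - a)| < `|a|.
  rewrite normrM gtr0_norm //; apply: le_lt_trans (_ : t * (`|a| + `|b - a|) < _).
    by rewrite ler_pM2l // lerDr.
  rewrite -ltr_pdivlMr //; apply: le_lt_trans te _.
  by rewrite gtr_pMr ?divr_gt0 // invf_lt1 ?ltr1n.
move: lt_ta; rewrite ltr_norml => /andP[].
have [a0 | a0 | a0] := ltgtP 0 a; last by rewrite -a0 eqxx in hx0.
  by rewrite gtr0_norm // => lo hi; rewrite !gtr0_sg //; lra.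
by rewrite ltr0_norm // => lo hi; rewrite !ltr0_sg //; lra.
Qed.

Lemma generic_point hs x : (forall h, h \in hs -> exists z, heval h z != 0) ->
  exists2 y, off_hyps hs y & face_le hs x y.
Proof.
(* Only the list of forms to be made nonzero shrinks in the induction; the closure condition always
   refers to all of [hs], so that later steps do not spoil earlier ones. *)
suff gen gs : {subset gs <= hs} -> (forall h, h \in hs -> exists z, heval h z != 0) ->
    exists2 y, off_hyps gs y & face_le hs x y by exact: gen.
elim: gs => [|g gs IH] sub nz; first by exists x => // h _; right.
have [|y offy lexy] := IH _ nz; first by move=> h hgs; apply: sub; rewrite inE hgs orbT.
have [z gz] := nz g (sub g (mem_head _ _)).
have [e /andP[e_gt0 _] He] := small_step hs y z.
exists (y + e *: (z - y)) => [h hg | h hhs].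
  rewrite -sgr_eq0 He ?e_gt0 ?lexx ?sub //.
  case: (eqVneq (heval h y) 0) => [hy0 | hy0]; last by rewrite sgr_eq0.
  move: hg; rewrite inE => /predU1P[-> | /offy]; first by rewrite sgr_eq0.
  by rewrite hy0 eqxx.
rewrite He ?e_gt0 ?lexx //; case: (lexy h hhs) => [-> | eqxy]; first by left.
by case: eqP => [hy0 | _]; [left; rewrite eqxy hy0 sgr0 | right].
Qed.

Lemma signs_face_le hs x y : signs hs x = signs hs y -> face_le hs x y.
Proof. by move=> /signsP xy h hhs; right; apply: xy. Qed.

Lemma face_le_signs hs x y x' y' : signs hs x = signs hs x' -> signs hs y = signs hs y' ->
  face_le hs x y -> face_le hs x' y'.
Proof.
move=> /signsP xx' /signsP yy' xy h hhs.
by rewrite -xx' // -yy' //; apply: xy.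
Qed.

Lemma off_hyps_signs hs x y : signs hs x = signs hs y -> off_hyps hs x -> off_hyps hs y.
Proof. by move=> /signsP xy offx h hhs; rewrite -sgr_eq0 -xy // sgr_eq0 offx. Qed.

Lemma nbhs_sg_heval h x : heval h x != 0 ->
  nbhs x [set u | Num.sg (heval h u) = Num.sg (heval h x)]%classic.
Proof.
(* [D] exceeds the sum of the absolute coefficients, so on a ball of radius [e] in the maximum norm
   the form changes by less than its absolute value at [x]. *)
move=> hx; pose D := 1 + \sum_j `|h.1 0 j|; pose e := `|heval h x| / D.
have D_gt0 : 0 < D by rewrite ltr_wpDr ?sumr_ge0.
have e_gt0 : 0 < e by rewrite divr_gt0 ?normr_gt0.
apply/nbhs_ballP; exists e => //= u [_ xu].
have : `|heval h u - heval h x| < `|heval h x|.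
  rewrite -dot_hevalB; apply: le_lt_trans (ler_norm_sum _ _ _) _.
  apply: (@le_lt_trans _ _ (\sum_j `|h.1 0 j| * e)).
    apply: ler_sum => j _; rewrite normrM ler_wpM2l // !mxE distrC ltW //.
    exact: xu.
  by rewrite -mulr_suml mulrC /e -mulrA gtr_pMr ?normr_gt0 // mulrC ltr_pdivrMr // mul1r ltrDr.
rewrite ltr_norml; have [h0|h0|h0] := ltgtP 0 (heval h x); last by rewrite -h0 eqxx in hx.
  rewrite gtr0_norm // => /andP[lo _]; have u0 : 0 < heval h u by lra.
  by rewrite /= !gtr0_sg.
rewrite ltr0_norm // => /andP[_ hi]; have u0 : heval h u < 0 by lra.
by rewrite /= !ltr0_sg.
Qed.

Lemma closure_face_at hs x y : closure (face_at hs y) x <-> face_le hs x y.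
Proof.
split=> [clyx h hhs | xy B xB].
  case: (eqVneq (heval h x) 0) => [->|hx]; first by left; rewrite sgr0.
  right; have := nbhs_sg_heval hx.
  by move=> /clyx[u [/face_atE/signsP/(_ h hhs) <- /= ->]].
have /nbhs_ballP[e /= e_gt0 Be] := xB.
(* The factor [t] brings every coordinate of the step below [e]; the minimum with 1 keeps the point
   on the segment, where [sg_comb] applies. *)
pose D := 1 + \sum_j `|(y - x) 0 j|; pose t := Num.min (e / D / 2) 1.
have D_gt0 : 0 < D by rewrite ltr_wpDr ?sumr_ge0.
have t_gt0 : 0 < t by rewrite lt_min !divr_gt0 //= ltr01.
exists (x + t *: (y - x)); split.
  apply/face_atE/signsP => h hhs; rewrite heval_line.
  by apply: sg_comb; [rewrite t_gt0 ge_min lexx orbT | exact: xy].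
apply: Be; split=> // i j; rewrite ord1 /ball /= [(x + _) 0 j]mxE opprD addrA subrr sub0r normrN.
rewrite [_ 0 j]mxE normrM gtr0_norm //; set w := `|(y - x) 0 j|.
have wD : w < D by rewrite /D (bigD1 j) //= -/w addrCA ltrDl ltr_wpDr ?sumr_ge0.
have w_ge0 : 0 <= w by apply: normr_ge0.
have tD : t * D < e.
  rewrite -ltr_pdivlMr //; apply: (@le_lt_trans _ _ (e / D / 2)); first by rewrite ge_min lexx.
  by rewrite gtr_pMr ?divr_gt0 // invf_lt1 ?ltr1n.
by apply: le_lt_trans tD; rewrite ler_pM2l // ltW.
Qed.

Lemma hyperplane_eqP h h' a : h.1 != 0 -> h'.1 = a *: h.1 ->
  (exists x, hyperplane h x /\ hyperplane h' x) -> h'.1 != 0 -> hyperplane h = hyperplane h'.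
Proof.
move=> h0 h'a [x []]; rewrite /hyperplane /= => hx h'x h'0.
have a0 : a != 0 by apply: contraNneq h'0 => a0; rewrite h'a a0 scale0r.
have def_h' z : heval h' z = a * heval h z.
  have -> : z = x + (z - x) by rewrite addrC subrK.
  by rewrite !hevalD h'x hx h'a dotZl !add0r.
apply/seteqP; split=> z /= hz; first by rewrite def_h' hz mulr0.
by apply/eqP; have /eqP := hz; rewrite def_h' mulf_eq0 (negPf a0).
Qed.

(** * Dimensions of faces *)

Lemma mulmx_tr_eq0 k (M : 'M[R]_(k, d)) (u : 'rV[R]_d) :
  (forall i, dot u (row i M) = 0) -> M *m u^T = 0.
Proof.
move=> Mu; apply/matrixP => i j.
by rewrite ord1 [RHS]mxE -(Mu i) dotC dot_trmx -row_mul [RHS]mxE.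
Qed.

Lemma row_free_orth k (M : 'M[R]_(k, d)) (u : 'rV[R]_d) :
  row_free M -> u != 0 -> (forall i, dot u (row i M) = 0) -> (k < d)%N.
Proof.
move=> freeM u0 Mu; have Mu0 := mulmx_tr_eq0 Mu.
have := mulmx0_rank_max Mu0; rewrite mxrank_tr rank_rV u0 addn1.
by rewrite (eqP freeM).
Qed.

Lemma row_free_orth2 k (M : 'M[R]_(k, d)) (u v : 'rV[R]_d) :
  row_free M -> k.+1 = d -> u != 0 ->
  (forall i, dot u (row i M) = 0) -> (forall i, dot v (row i M) = 0) ->
  exists a, v = a *: u.
Proof.
move=> freeM kd u0 Mu Mv.
have Muv0 : M *m (col_mx u v)^T = 0 by rewrite tr_col_mx mul_mx_row !mulmx_tr_eq0 // row_mx0.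
have rk1 : (\rank (col_mx u v) <= 1)%N.
  by have := mulmx0_rank_max Muv0; rewrite mxrank_tr (eqP freeM); lia.
apply/sub_rVP; apply: (@submx_trans _ _ _ _ _ _ (col_mx u v)).
  by rewrite -addsmxE addsmxSr.
have le_u : (u <= col_mx u v)%MS by rewrite -addsmxE addsmxSl.
by have := geq_leqif (mxrank_leqif_sup le_u); rewrite rank_rV u0 rk1 => <-.
Qed.

Lemma aff_indep_points_lt (X : set 'rV[R]_d) k h : h.1 != 0 ->
  (X `<=` hyperplane h)%classic -> aff_indep_points X k -> (k < d)%N.
Proof.
move=> h0 Xh [x0 [P [Xx0 XP freeP]]]; apply: row_free_orth freeP h0 _ => i.
rewrite rowK; have := Xh _ (XP i); have := Xh _ Xx0; rewrite /hyperplane /=.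
by rewrite dot_hevalB => -> ->; rewrite subrr.
Qed.

(** Both normals are orthogonal to the same [d - 1] independent directions, whose orthogonal
    complement is a line. This makes the wall of a facet unambiguous. *)
Lemma aff_indep_points_eq (X : set 'rV[R]_d) k h h' : h.1 != 0 -> h'.1 != 0 ->
  (X `<=` hyperplane h)%classic -> (X `<=` hyperplane h')%classic ->
  k.+1 = d -> aff_indep_points X k -> hyperplane h = hyperplane h'.
Proof.
move=> h0 h'0 Xh Xh' kd [x0 [P [Xx0 XP freeP]]].
have orth g : (X `<=` hyperplane g)%classic ->
    forall i, dot g.1 (row i (\matrix_i (row i P - x0))) = 0.
  move=> Xg i; rewrite rowK; have := Xg _ (XP i); have := Xg _ Xx0.
  by rewrite /hyperplane /= dot_hevalB => -> ->; rewrite subrr.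
have [a h'a] := row_free_orth2 freeP kd h0 (orth h Xh) (orth h' Xh').
by apply: (hyperplane_eqP h0 h'a) => //; exists x0; split; [apply: Xh | apply: Xh'].
Qed.

(** Short steps in directions that fix the vanishing forms stay in the face. Their lengths depend on
    the direction, but positive rescaling of the rows is multiplication by an invertible diagonal
    matrix. *)
Lemma face_aff_indep hs x k (M : 'M[R]_(k, d)) : row_free M ->
  (forall h, h \in hs -> heval h x = 0 -> forall i, dot h.1 (row i M) = 0) ->
  aff_indep_points (face_at hs x) k.
Proof.
move=> freeM orthM.
have step i : exists t, 0 < t /\ forall h, h \in hs ->
    Num.sg (heval h (x + t *: row i M)) = Num.sg (heval h x).
  have [e /andP[e_gt0 _] He] := small_step hs x (x + row i M).
  exists e; split=> // h hhs; have := He e; rewrite e_gt0 lexx => /(_ isT h hhs).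
  rewrite [x + row i M]addrC addrK => ->; case: eqP => // hx0.
  by rewrite addrC hevalD orthM // addr0.
have [t Ht] := fin_all_exists step.
exists x, (\matrix_i (x + t i *: row i M)); split.
- exact/face_atE.
- by move=> i; rewrite rowK; apply/face_atE/signsP; apply: (Ht i).2.
have -> : \matrix_i (row i (\matrix_i (x + t i *: row i M)) - x)
    = diag_mx (\row_i t i) *m M.
  apply/row_matrixP => i; rewrite rowK rowK row_mul row_diag_mx -scalemxAl -rowE.
  by rewrite addrC addKr mxE.
rewrite -row_leq_rank mxrankMfree // row_leq_rank row_free_unit unitmxE det_diag.
rewrite unitfE; apply/prodf_neq0 => i _; rewrite mxE gt_eqF //; exact: (Ht i).1.
Qed.

Lemma affdim_off hs x k : off_hyps hs x -> affdim (face_at hs x) k -> k = d.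
Proof.
move=> offx [[x0 [P [_ _ freeP]]] maxk]; apply/eqP; rewrite eqn_leq; apply/andP; split.
  by rewrite -(eqP freeP) rank_leq_col.
apply: maxk; apply: (@face_aff_indep _ _ _ 1%:M).
  by rewrite row_free_unit unitmx1.
by move=> h hhs hx; have := offx h hhs; rewrite hx eqxx.
Qed.

Lemma affdim_facet hs x h0 k : h0.1 != 0 -> h0 \in hs -> heval h0 x = 0 ->
  (forall h, h \in hs -> heval h x = 0 -> h = h0) ->
  affdim (face_at hs x) k -> k.+1 = d.
Proof.
move=> nz0 h0hs hx0 only0 [indep maxk]; apply/eqP; rewrite eqn_leq; apply/andP; split.
  apply: aff_indep_points_lt nz0 _ indep => y /face_atE/signsP/(_ h0 h0hs).
  by rewrite hx0 sgr0 => /eqP; rewrite sgr_eq0 => /eqP.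
(* The kernel of the normal supplies [d - 1] directions along which the only vanishing form remains
   zero. *)
pose K := kermx h0.1^T.
have rK : \rank K = d.-1 by rewrite mxrank_ker mxrank_tr rank_rV nz0 subn1.
have d_gt0 : (0 < d)%N.
  by case/rV0Pn: nz0 => i _; apply: leq_ltn_trans (ltn_ord i).
rewrite -(prednK d_gt0) ltnS -rK; apply: maxk.
apply: (@face_aff_indep _ _ _ (row_base K)); first exact: row_base_free.
move=> h hhs /(only0 h hhs)-> i; rewrite dotC dot_trmx.
have /sub_kermxP -> : (row i (row_base K) <= kermx h0.1^T)%MS; last by rewrite mxE.
by apply: submx_trans (row_sub _ _) _; rewrite eq_row_base.
Qed.

End Signs.
End AffineForms.

(** * The number of faces *)

Section SignVectorCount.
Local Open Scope ring_scope.
Variable R : realType.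

Lemma hyperplane_param k (h : hyp R k.+1) : h.1 != 0 ->
  exists phi : 'rV[R]_k -> 'rV[R]_k.+1,
    (forall x, heval h x = 0 -> exists y, x = phi y) /\
    forall g : hyp R k.+1, exists g' : hyp R k, forall y, heval g (phi y) = heval g' y.
Proof.
case/rV0Pn=> j hj.
pose phi (y : 'rV[R]_k) : 'rV[R]_k.+1 := \row_i (if unlift j i is Some i' then y 0 i'
  else - (h.2 + \sum_i' h.1 0 (lift j i') * y 0 i') / h.1 0 j).
exists phi; split=> [x | g].
  rewrite /heval /dot (bigD1_ord j) //= => hx; exists (\row_i x 0 (lift j i)).
  apply/rowP => i; rewrite mxE; case: unliftP => [i' ->|->]; first by rewrite mxE.
  rewrite (eq_bigr (fun i' => h.1 0 (lift j i') * x 0 (lift j i'))).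
    by apply: (mulfI hj); rewrite mulrCA divff // mulr1; move: hx; lra.
  by move=> i' _; rewrite mxE.
(* Subtracting [r] times [h] from [g] removes the coordinate [j] and changes no value on the
   hyperplane. *)
pose r := g.1 0 j / h.1 0 j.
exists (\row_i (g.1 0 (lift j i) - r * h.1 0 (lift j i)), g.2 - r * h.2) => y.
rewrite /heval /dot (bigD1_ord j) //= mxE unlift_none.
rewrite (eq_bigr (fun i' : 'I_k => g.1 0 (lift j i') * y 0 i') (P := fun=> true)
  (F1 := fun i' => g.1 0 (lift j i') * phi y 0 (lift j i'))); last first.
  by move=> i' _; rewrite mxE liftK.
rewrite [in RHS](eq_bigr (fun i' => g.1 0 (lift j i') * y 0 i'
    - r * (h.1 0 (lift j i') * y 0 i'))); last first.
  by move=> i' _; rewrite mxE; ring.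
rewrite sumrB -mulr_sumr /r; set S := \sum_i h.1 0 _ * _; set S' := \sum_i _.
by field.
Qed.

(** Deletion and restriction. Vectors with first sign 0 live on the first hyperplane, and so do
    tails that occur with both nonzero signs; the distinct tails of the other vectors are sign
    vectors of the remaining [n] forms. Hence at most [2 (2 n + 1)^k + (2 n + 1)^(k + 1)] vectors in
    dimension [k + 1], which is [(2 n + 3) (2 n + 1)^k]. *)
Lemma sign_vectors_bound k (hs : seq (hyp R k)) (ss : seq (seq R)) :
  uniq ss -> (forall s, s \in ss -> exists x, s = signs hs x) ->
  (size ss <= (2 * size hs + 1) ^ k)%N.
Proof.
move def_n: (size hs) => n; elim: n k hs ss def_n => [|n IH] k [|h hs] ss //= def_n uniq_ss real_ss.
  rewrite exp1n; apply: (@uniq_leq_size _ ss [:: [::]]) => // s.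
  by case/real_ss => x ->.
case: def_n => size_hs.
have cons_ss s : s \in ss -> s = head 0 s :: behead s.
  by case/real_ss => x ->.
have uniq_behead (ts : seq (seq R)) (a : R) : uniq ts -> {subset ts <= ss} ->
    (forall s, s \in ts -> head 0 s = a) -> uniq (map behead ts).
  move=> uniq_ts sub_ts head_ts; rewrite map_inj_in_uniq // => s t tss tst eq_st.
  by rewrite (cons_ss s) ?sub_ts // (cons_ss t) ?sub_ts // !head_ts // eq_st.
case: (eqVneq h.1 0) => [h0 | h0].
  have const_h x : heval h x = h.2 by rewrite /heval h0 dotC dot0r add0r.
  rewrite -(size_map behead); apply: (leq_trans (IH k hs _ size_hs _ _)).
  - apply: (uniq_behead _ (Num.sg h.2)) => // s /real_ss[x ->] /=; by rewrite const_h.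
  - by move=> _ /mapP[s /real_ss[x ->] ->]; exists x.
  - by case: (k) => // ?; rewrite leq_exp2r //; lia.
case: k => [|k] in h hs size_hs ss uniq_ss real_ss cons_ss uniq_behead h0 *.
  by case/eqP: h0; apply/rowP => -[].
have [phi [phiP pullback]] := hyperplane_param h0.
have [pb pbP] := choice pullback.
have boundh (B : seq (seq R)) : uniq B ->
    (forall b, b \in B -> exists x, heval h x = 0 /\ b = signs hs x) ->
    (size B <= (2 * n + 1) ^ k)%N.
  move=> uniqB realB; apply: (IH k [seq pb g | g <- hs]); rewrite ?size_map //.
  move=> _ /realB[_ [/phiP[y ->] ->]]; exists y.
  by rewrite /signs -map_comp; apply: eq_map => g /=; rewrite pbP.
have bound (B : seq (seq R)) : uniq B -> (forall b, b \in B -> exists x, b = signs hs x) ->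
    (size B <= (2 * n + 1) ^ k.+1)%N by exact: IH.
pose A (a : R) := [seq behead s | s <- ss & head 0 s == a].
have uniqA a : uniq (A a).
  apply: (uniq_behead _ a); first exact: filter_uniq.
    by move=> s; rewrite mem_filter => /andP[].
  by move=> s; rewrite mem_filter => /andP[/eqP].
have realA a b : b \in A a -> exists x, Num.sg (heval h x) = a /\ b = signs hs x.
  case/mapP => s; rewrite mem_filter => /andP[/eqP <- /real_ss[x ->]] ->.
  by exists x.
have size_ss : (size ss <= size (A 0%R) + (size (A 1%R) + size (A (-1)%R)))%N.
  have : all (fun s : seq R => [|| head 0 s == 0, head 0 s == 1 | head 0 s == -1]) ss.
    by apply/allP => s /real_ss[x ->] /=; case: sgrP => _; rewrite eqxx ?orbT.
  rewrite !size_map !size_filter; elim: (ss) => //= s ss' IHs /andP[+ /IHs].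
  by case: (_ == 0); case: (_ == 1); case: (_ == -1) => //=; lia.
(* A tail realized on both sides is realized on the hyperplane too: the segment between the two
   witnesses meets it, and the other signs are constant on that segment. *)
have cap : (size [seq s <- A (-1)%R | s \in A 1%R] <= (2 * n + 1) ^ k)%N.
  apply: boundh; first exact: filter_uniq.
  move=> b; rewrite mem_filter => /andP[/realA[x [/eqP x1 bx]] /realA[y [/eqP y1 by_]]].
  have hx : 0 < heval h x by rewrite sgr_cp0 in x1.
  have hy : heval h y < 0 by rewrite sgr_cp0 in y1.
  pose t := heval h x / (heval h x - heval h y).
  have t01 : 0 < t <= 1 by rewrite /t divr_gt0 ?ler_pdivrMr //=; lra.
  exists (x + t *: (y - x)); split; first by rewrite heval_line /t; field; rewrite subr_eq0 gt_eqF // (lt_trans hy).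
  rewrite by_; apply/signsP => g ghs; rewrite heval_line; symmetry; apply: sg_comb => //.
  by right; have /signsP/(_ g ghs) : signs hs x = signs hs y by rewrite -bx -by_.
have cup : (size (A 1%R ++ [seq s <- A (-1)%R | s \notin A 1%R]) <= (2 * n + 1) ^ k.+1)%N.
  apply: bound.
    rewrite cat_uniq uniqA filter_uniq //= andbT; apply/hasPn => s.
    by rewrite mem_filter => /andP[].
  move=> b; rewrite mem_cat mem_filter.
  by case/orP => [|/andP[_]] /realA[x [_ ->]]; exists x.
have zero : (size (A 0%R) <= (2 * n + 1) ^ k)%N.
  apply: boundh => // b /realA[x [/eqP x0 ->]]; exists x; split=> //.
  by apply/eqP; rewrite sgr_eq0 in x0.
have def_AN : size (A (-1)%R) = (size [seq s <- A (-1)%R | s \in A 1%R] +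
    size [seq s <- A (-1)%R | s \notin A 1%R])%N.
  by rewrite !size_filter count_predC.
rewrite size_cat in cup; rewrite expnS in cup; rewrite expnS.
have : ((2 * n + 1) ^ k <= (2 * n.+1 + 1) ^ k)%N by case: (k) => // ?; rewrite leq_exp2r //; lia.
move=> ab; apply: (@leq_trans ((2 * n.+1 + 1) * (2 * n + 1) ^ k)); last first.
  by rewrite leq_mul2l ab orbT.
have shuffle (u v w z : nat) : (u + (v + (w + z)) = (u + w) + (v + z))%N by lia.
have -> : (2 * n.+1 + 1 = 2 + (2 * n + 1))%N by lia.
apply: leq_trans size_ss _; rewrite def_AN shuffle mulnDl leq_add //.
by rewrite mul2n -addnn leq_add.
Qed.
End SignVectorCount.

(** * Counting and minima over sequences *)

Lemma count_lt (T : eqType) (a b : pred T) (s : seq T) x :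
  {in s, forall y, a y -> b y} -> x \in s -> ~~ a x -> b x -> (count a s < count b s)%N.
Proof.
move=> + + nax bx; elim: s => //= y s IH sub; rewrite inE.
have le_s : (count a s <= count b s)%N.
  rewrite -!size_filter; apply: (@leq_trans (size [seq z <- s | a z & z \in s])).
    by rewrite !size_filter; apply/eq_leq/eq_in_count => z zs /=; rewrite zs andbT.
  rewrite !size_filter; apply: sub_count => z /= /andP[az zs].
  by apply: sub az; rewrite inE zs orbT.
case: eqP => [<- _ | _ /= xs].
  by rewrite (negPf nax) bx add0n add1n ltnS.
have aby := sub y (mem_head _ _).
rewrite -addnS leq_add //; first by case: (a y) aby => // ->.
by apply: IH => // z zs; apply: sub; rewrite inE zs orbT.
Qed.

Lemma seq_argmin disp (T : eqType) (U : orderType disp) (f : T -> U) (s : seq T) :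
  s != [::] -> exists2 x, x \in s & {in s, forall y, (f x <= f y)%O}.
Proof.
case: s => // x s _; elim: s x => [|y s IH] x.
  by exists x; rewrite ?mem_head // => y; rewrite inE => /eqP->.
have [z zs minz] := IH y; case: (leP (f x) (f z)) => [xz | zx].
  exists x; rewrite ?mem_head // => w; rewrite inE => /predU1P[-> //|/minz].
  exact: le_trans.
exists z; first by rewrite inE zs orbT.
by move=> w; rewrite inE => /predU1P[-> |/minz //]; apply: ltW.
Qed.

(** * Arrangements *)

Section Arrangements.
Local Open Scope ring_scope.
Variables (R : realType) (d : nat) (hs : seq (hyp R d)) (A : seq (face_rec R d)).
Hypotheses (proper_hs : proper_hyps hs) (A_hs : describes_arrangement hs A).

Local Notation pt k := (fr_point (nth (face_rec0 R d) A k)).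
Local Notation dim k := (fr_dim (nth (face_rec0 R d) A k)).
Local Notation sup k := (fr_sup (nth (face_rec0 R d) A k)).
Local Notation wall k := (nth (0, 0) hs (fr_hyp (nth (face_rec0 R d) A k))).

Lemma proper_hyps_neq0 h : h \in hs -> h.1 != 0.
Proof. by case/(nthP (0, 0)) => i ilt <-; apply: proper_hs.1. Qed.

Lemma proper_hyps_inj h g : h \in hs -> g \in hs -> hyperplane h = hyperplane g -> h = g.
Proof.
case/(nthP (0, 0)) => i ilt <- /(nthP (0, 0))[j jlt <-] eq_hg.
case: (eqVneq i j) => [-> // | /eqP ij].
by case: (proper_hs.2 i j ilt jlt ij).
Qed.

Lemma face_index x : exists2 k, (k < size A)%N & signs hs (pt k) = signs hs x.
Proof.
have [faces _ _ _ _] := A_hs; have [k [klt /face_atE xk _]] := faces _ (is_face_at hs x).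
by exists k.
Qed.

Lemma face_index_inj k l : (k < size A)%N -> (l < size A)%N ->
  signs hs (pt k) = signs hs (pt l) -> k = l.
Proof.
have [faces _ _ _ _] := A_hs => klt llt eq_kl.
have [i [_ _ uniq_i]] := faces _ (is_face_at hs (pt k)).
rewrite (uniq_i k klt); last exact/face_atE.
by rewrite (uniq_i l llt) //; apply/face_atE.
Qed.

Lemma face_number : (size A <= (2 * size hs + 1) ^ d)%N.
Proof.
rewrite -(size_iota 0 (size A)) -(size_map (fun k => signs hs (pt k))).
apply: sign_vectors_bound => [|s /mapP[k _ ->]]; last by exists (pt k).
rewrite map_inj_in_uniq ?iota_uniq // => k l; rewrite !mem_iota !add0n.
by move=> klt llt; apply: face_index_inj.
Qed.

Lemma dim_cell k : (k < size A)%N -> dim k = d <-> off_hyps hs (pt k).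
Proof.
have [_ dims _ _ _] := A_hs => klt; split=> [dk h hhs | offk]; last first.
  exact: affdim_off offk (dims k klt).
have [indep _] := dims k klt; apply/eqP => hk0.
suff : (dim k < d)%N by rewrite dk ltnn.
apply: (aff_indep_points_lt (proper_hyps_neq0 hhs) _ indep) => y /face_atE/signsP/(_ h hhs).
by rewrite hk0 sgr0 => /eqP; rewrite sgr_eq0 => /eqP.
Qed.

Lemma dim_facet k : (k < size A)%N -> (dim k).+1 = d ->
  [/\ wall k \in hs, heval (wall k) (pt k) = 0
    & forall h, h \in hs -> heval h (pt k) = 0 -> h = wall k].
Proof.
have [_ dims _ _ walls] := A_hs => klt dk; have [wlt subw] := walls k klt dk.
have whs : wall k \in hs by apply: mem_nth.
split=> // [|h hhs hk0]; first by apply: subw; apply/face_atE.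
have [indep _] := dims k klt.
apply: proper_hyps_inj => //.
apply: (aff_indep_points_eq _ _ _ subw dk indep); try exact: proper_hyps_neq0.
move=> y /face_atE/signsP/(_ h hhs).
by rewrite hk0 sgr0 => /eqP; rewrite sgr_eq0 => /eqP.
Qed.

Lemma mem_sup k l : (k < size A)%N ->
  l \in sup k <-> [/\ (l < size A)%N, dim l = (dim k).+1 & face_le hs (pt k) (pt l)].
Proof.
have [_ _ _ sups _] := A_hs => klt; rewrite sups //.
split=> -[llt dl kl]; split=> //.
  by apply/closure_face_at/kl/face_atE.
by move=> y /face_atE yk; apply/closure_face_at; apply: face_le_signs kl.
Qed.

Lemma facet_dim x h0 k : (k < size A)%N -> signs hs (pt k) = signs hs x ->
  h0 \in hs -> heval h0 x = 0 -> (forall h, h \in hs -> heval h x = 0 -> h = h0) ->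
  (dim k).+1 = d /\ wall k = h0.
Proof.
have [_ dims _ _ _] := A_hs => klt /signsP kx h0hs h0x only0.
have zero h : h \in hs -> heval h (pt k) = 0 <-> heval h x = 0.
  move=> hhs; have := kx h hhs.
  by split=> e; have := kx h hhs; rewrite e sgr0 => /esym/eqP; rewrite ?[0 == _]eq_sym sgr_eq0 => /eqP.
have h0k : heval h0 (pt k) = 0 by apply/zero.
have dk : (dim k).+1 = d.
  apply: (affdim_facet (proper_hyps_neq0 h0hs) h0hs h0k _ (dims k klt)) => h hhs.
  by move/(zero h hhs); apply: only0.
by split=> //; have [_ _ /(_ h0 h0hs h0k)] := dim_facet klt dk.
Qed.

(** Steps along the normal of the wall and against it reach one cell on each side. A cell above the
    facet agrees with it on all forms that do not vanish there, so its side of the wall determines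
    it. The exact two-element list is what [add_facets] matches on. *)
Lemma facet_two_cells k : (k < size A)%N -> (dim k).+1 = d ->
  exists k1 k2, sup k = [:: k1; k2].
Proof.
move=> klt dk; have [whs wk0 only0] := dim_facet klt dk.
have [_ _ /(_ k klt) uniq_sup _ _] := A_hs.
set w := wall k in whs wk0 only0 *; set x := pt k in wk0 only0 *.
have ww : 0 < dot w.1 w.1 by rewrite dot_gt0 // proper_hyps_neq0.
have side (a : R) : a != 0 -> exists2 l, l \in sup k &
    Num.sg (heval w (pt l)) = Num.sg a.
  move=> a0; have [e /andP[e_gt0 _] He] := small_step hs x (x + a *: w.1).
  have [l llt /signsP eq_l] := face_index (x + e *: (x + a *: w.1 - x)).
  have {}He h : h \in hs -> Num.sg (heval h (pt l)) =
      if heval h x == 0 then Num.sg (heval h (x + a *: w.1)) else Num.sg (heval h x).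
    by move=> hhs; rewrite eq_l // He // e_gt0 lexx.
  have sgw : Num.sg (heval w (pt l)) = Num.sg a.
    by rewrite He // wk0 eqxx heval_add_normal wk0 add0r sgrM (gtr0_sg ww) mulr1.
  exists l => //; apply/mem_sup => //; split=> //.
    rewrite dk; apply/dim_cell => // h hhs; rewrite -sgr_eq0.
    case: (eqVneq (heval h x) 0) => [/(only0 h hhs)-> | hx0]; first by rewrite sgw sgr_eq0.
    by rewrite He // (negPf hx0) sgr_eq0.
  move=> h hhs; rewrite He //; case: (eqVneq (heval h x) 0) => [->|_]; last by right.
  by left; rewrite sgr0.
have [k1 k1sup sg1] := side 1 (oner_neq0 _).
have neN0 : -1 != 0 :> R by rewrite oppr_eq0 oner_neq0.
have [k2 k2sup] := side (-1) neN0.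
rewrite sgrN => sg2; rewrite sgr1 in sg1 sg2.
have ne12 : k1 != k2 by apply/eqP => eq12; move: sg1; rewrite eq12 sg2; lra.
have only l : l \in sup k -> l \in [:: k1; k2].
  move=> lsup; have [llt dl lel] := (mem_sup l klt).1 lsup; rewrite dk in dl.
  have offl := (dim_cell llt).1 dl.
  have eq_l l' : l' \in sup k -> Num.sg (heval w (pt l')) = Num.sg (heval w (pt l)) -> l = l'.
    move=> l'sup eq_sg; have [l'lt _ lel'] := (mem_sup l' klt).1 l'sup.
    apply: face_index_inj => //; apply/signsP => h hhs.
    case: (eqVneq (heval h x) 0) => [/(only0 h hhs)-> // | hx0].
    case: (lel h hhs) => [/eqP | <-]; first by rewrite sgr_eq0 (negPf hx0).
    by case: (lel' h hhs) => [/eqP | <- //]; rewrite sgr_eq0 (negPf hx0).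
  have := offl w whs; rewrite !inE.
  case: (sgrP (heval w (pt l))) => [//|wl _|wl _].
    by rewrite (eq_l k1 k1sup) ?eqxx // sg1 gtr0_sg.
  by rewrite (eq_l k2 k2sup) ?eqxx ?orbT // sg2 ltr0_sg.
have {only} perm_sup : perm_eq (sup k) [:: k1; k2].
  apply: uniq_perm => //; first by rewrite /= inE ne12.
  move=> l; apply/idP/idP => [/only // |].
  by rewrite !inE => /orP[]/eqP->.
have := perm_size perm_sup; case: (sup k) => [|l1 [|l2 []]] // _.
by exists l1, l2.
Qed.

(** Only [h0] changes sign between the two points. Where their segment meets [h0] all other forms
    are nonzero, so the face found there is a facet with wall [h0]. *)
Lemma cell_crossing k l h0 : (k < size A)%N -> (l < size A)%N ->
  off_hyps hs (pt k) -> off_hyps hs (pt l) -> h0 \in hs ->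
  Num.sg (heval h0 (pt k)) != Num.sg (heval h0 (pt l)) ->
  (forall h, h \in hs -> h != h0 -> Num.sg (heval h (pt k)) = Num.sg (heval h (pt l))) ->
  exists f, [/\ (f < size A)%N, (dim f).+1 = d, wall f = h0, k \in sup f & l \in sup f].
Proof.
move=> klt llt offk offl h0hs ne0 eq_kl.
set x := pt k in offk ne0 eq_kl *; set y := pt l in offl ne0 eq_kl *.
have hxy : heval h0 x - heval h0 y != 0.
  by rewrite subr_eq0; apply: contraNneq ne0 => ->.
pose t := heval h0 x / (heval h0 x - heval h0 y).
have t01 : 0 < t <= 1.
  have := offk h0 h0hs; have := offl h0 h0hs; rewrite /t; move: ne0 hxy.
  case: (sgrP (heval h0 x)) => [-> | x0 | x0]; rewrite ?eqxx //.
    case: (sgrP (heval h0 y)) => [-> | y0 | y0]; rewrite ?eqxx // => _ _ _ _.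
    by rewrite divr_gt0 ?ler_pdivrMr //=; lra.
  case: (sgrP (heval h0 y)) => [-> | y0 | y0]; rewrite ?eqxx // => _ _ _ _.
  rewrite -mulrNN -invrN divr_gt0 ?ler_pdivrMr //=; lra.
pose z := x + t *: (y - x).
have h0z : heval h0 z = 0 by rewrite heval_line /t; field.
have sgz h : h \in hs -> h != h0 -> Num.sg (heval h z) = Num.sg (heval h y).
  by move=> hhs hh0; rewrite heval_line; apply: sg_comb => //; right; apply: eq_kl.
have only0 h : h \in hs -> heval h z = 0 -> h = h0.
  move=> hhs hz; apply/eqP; apply: contraT => hh0.
  by have := offl h hhs; rewrite -sgr_eq0 -sgz // hz sgr0 eqxx.
have [f flt fz] := face_index z; have [df wf] := facet_dim flt fz h0hs h0z only0.
have := fz => /signsP {}fz; exists f; split=> //; apply/mem_sup => //; rewrite df.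
  split=> //; first exact/dim_cell.
  move=> h hhs; rewrite fz //; case: (eqVneq h h0) => [-> | hh0].
    by left; rewrite h0z sgr0.
  by right; rewrite sgz // eq_kl.
split=> //; first exact/dim_cell.
move=> h hhs; rewrite fz //; case: (eqVneq h h0) => [-> | hh0].
  by left; rewrite h0z sgr0.
by right; rewrite sgz.
Qed.

(* From a generic point of the cell [k], the segment to the target cell meets
   the separating hyperplanes one at a time, so that it leaves [k] through a
   facet; one separating hyperplane less remains on the other side. *)
Lemma cells_connected (G : seq (hyp R d)) (P : nat -> Prop) k0 k1 :
  {subset G <= hs} ->
  (forall f k l, (f < size A)%N -> (dim f).+1 = d ->
     {in G, forall g, 0 < heval g (pt f)} -> k \in sup f -> l \in sup f -> P k -> P l) ->
  P k0 -> (k0 < size A)%N -> off_hyps hs (pt k0) -> {in G, forall g, 0 < heval g (pt k0)} ->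
  (k1 < size A)%N -> off_hyps hs (pt k1) -> {in G, forall g, 0 < heval g (pt k1)} -> P k1.
Proof.
move=> sGhs closedP Pk0 k0lt off0 G0 k1lt off1 G1.
set y := pt k1 in off1 G1.
pose sep k h := Num.sg (heval h (pt k)) != Num.sg (heval h y).
have [n] := ubnP (count (sep k0) hs).
elim: n k0 => // n IH k in Pk0 k0lt off0 G0 *; rename k0lt into klt.
rewrite ltnS => count_n; case: (eqVneq [seq h <- hs | sep k h] [::]) => [none | some].
  suff <- : k = k1 by [].
  apply: face_index_inj => //; apply/signsP => h hhs.
  apply/eqP; apply: contraT => sep_h.
  have : h \in [seq h <- hs | sep k h] by rewrite mem_filter /sep sep_h.
  by rewrite none.
(* With [y] fixed, this form vanishes at [z] when the segment from [z] to [y] meets [g] and [h] at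
   the same parameter; a point off all these forms meets the separating hyperplanes at different
   moments. *)
pose comb g h : hyp R d := (heval h y *: g.1 - heval g y *: h.1, heval h y * g.2 - heval g y * h.2).
have combE g h z : heval (comb g h) z = heval h y * heval g z - heval g y * heval h z.
  by rewrite /heval /comb /= dotBl !dotZl /heval; ring.
have [|x offx lex] := @generic_point _ _
    (hs ++ [seq comb gh.1 gh.2 | gh <- [seq gh <- allpairs pair hs hs | gh.1 != gh.2]]) (pt k).
  move=> h; rewrite mem_cat => /orP[/proper_hyps_neq0|/mapP[[g g']]]; first exact: heval_nonconst.
  rewrite mem_filter => /andP[/= gg' /allpairsP[[a b] [/= ghs g'hs [eq_a eq_b]]]] ->.
  (* Were the form identically zero, the two hyperplanes would coincide, as neither contains [y]. *)
  subst a b; apply: contrapT => /forallNP zero; case/eqP: gg'.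
  apply: proper_hyps_inj => //; apply/seteqP; split=> z; have /negP := zero z.
    rewrite negbK combE /hyperplane /= => /[swap] ->; rewrite mulr0 sub0r oppr_eq0 mulf_eq0.
    by rewrite (negPf (off1 _ ghs)) => /eqP.
  rewrite negbK combE /hyperplane /= => /[swap] ->; rewrite mulr0 subr0 mulf_eq0.
  by rewrite (negPf (off1 _ g'hs)) => /eqP.
have offx_hs : off_hyps hs x by move=> h hhs; apply: offx; rewrite mem_cat hhs.
have sgx h : h \in hs -> Num.sg (heval h x) = Num.sg (heval h (pt k)).
  move=> hhs; have [|/eqP|<-//] := lex h; first by rewrite mem_cat hhs.
  by rewrite sgr_eq0 (negPf (off0 h hhs)).
have comb0 g h : g \in hs -> h \in hs -> g != h -> heval h y * heval g x != heval g y * heval h x.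
  move=> ghs hhs gh; rewrite -subr_eq0 -combE offx // mem_cat; apply/orP; right.
  apply/mapP; exists (g, h) => //; rewrite mem_filter gh; apply/allpairsP.
  by exists (g, h).
pose t h := heval h x / (heval h x - heval h y).
(* [h0] is the separating hyperplane that the segment meets first. *)
have [h0] := seq_argmin t some; rewrite mem_filter => /andP[sep0 h0hs] min0.
have sepP h : h \in hs -> sep k h ->
    (0 < heval h x /\ heval h y < 0) \/ (heval h x < 0 /\ 0 < heval h y).
  move=> hhs; rewrite /sep -sgx //; move: (offx_hs h hhs) (off1 h hhs).
  by case: (sgrP (heval h x)) => [?|?|?] //; case: (sgrP (heval h y)) => [?|?|?] //;
    rewrite ?eqxx // => _ _ _; [left | right].
have t0 : 0 < t h0 < 1.
  rewrite /t; case: (sepP h0 h0hs sep0) => -[hx hy].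
    by rewrite divr_gt0 ?ltr_pdivrMr //=; lra.
  by rewrite -mulrNN -invrN divr_gt0 ?ltr_pdivrMr //=; lra.
pose x' := x + t h0 *: (y - x).
have h0x' : heval h0 x' = 0.
  rewrite heval_line /t; field; case: (sepP h0 h0hs sep0) => -[hx hy].
    by rewrite subr_eq0 gt_eqF // (lt_trans hy).
  by rewrite subr_eq0 lt_eqF // (lt_trans hx).
have sgx' h : h \in hs -> h != h0 -> Num.sg (heval h x') = Num.sg (heval h x).
  move=> hhs hh0; rewrite heval_line; case: (boolP (sep k h)) => [sep_h | ]; last first.
    rewrite negbK -sgx // => /eqP eq_sg; rewrite eq_sg.
    by apply: sg_comb; [case/andP: t0 => -> /ltW | right].
  have lt_t : t h0 < t h.
    rewrite lt_neqAle min0 ?mem_filter ?sep_h // andbT.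
    apply: contraNneq (comb0 h0 h h0hs hhs _); rewrite 1?eq_sym //.
    rewrite /t => eq_t; apply/eqP; move: eq_t.
    have d0 : heval h0 x - heval h0 y != 0.
      by case: (sepP h0 h0hs sep0) => -[? ?]; [rewrite gt_eqF // | rewrite lt_eqF //]; lra.
    have d1 : heval h x - heval h y != 0.
      by case: (sepP h hhs sep_h) => -[? ?]; [rewrite gt_eqF // | rewrite lt_eqF //]; lra.
    by move=> /eqP; rewrite eqr_div // => /eqP; lra.
  case: (sepP h hhs sep_h) lt_t => -[hx hy]; rewrite /t.
    by rewrite ltr_pdivlMr ?subr_gt0 ?(lt_trans hy) // => lt_t; rewrite !gtr0_sg //; lra.
  rewrite -[X in _ < X]mulrNN -invrN ltr_pdivlMr; last by lra.
  by move=> lt_t; rewrite !ltr0_sg //; lra.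
(* A short step beyond [x'] flips the sign of [h0] alone; the face reached is the neighbouring cell
   [l]. *)
have [e /andP[e_gt0 _] He] := small_step hs x' y.
have [l llt /signsP eq_l] := face_index (x' + e *: (y - x')).
have {}He h : h \in hs -> Num.sg (heval h (pt l)) =
    if h == h0 then Num.sg (heval h y) else Num.sg (heval h (pt k)).
  move=> hhs; rewrite eq_l // He ?e_gt0 ?lexx //; case: (eqVneq h h0) => [->|hh0].
    by rewrite h0x' eqxx.
  have hx'0 : heval h x' != 0 by rewrite -sgr_eq0 sgx' // sgr_eq0 offx_hs.
  by rewrite (negPf hx'0) sgx' // sgx.
(* Both ends are on the positive side of every member of [G], so none of these is ever crossed and
   the walk stays inside the region that they bound. *)
have Gh0 g : g \in G -> g != h0.
  move=> gG; apply: contraTneq sep0 => <-; rewrite negbK.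
  by rewrite !gtr0_sg ?eqxx // ?G0 ?G1.
have offl : off_hyps hs (pt l).
  move=> h hhs; rewrite -sgr_eq0 He //; by case: (h == h0); rewrite sgr_eq0; [exact: off1 | exact: off0].
have [f [flt df wf kf lf]] : exists f,
    [/\ (f < size A)%N, (dim f).+1 = d, wall f = h0, k \in sup f & l \in sup f].
  apply: cell_crossing => //; first by rewrite He // eqxx.
  by move=> h hhs hh0; rewrite He // (negPf hh0).
apply: (IH l) => //.
- apply: (closedP f k l) => // g gG; have ghs := sGhs g gG.
  have [_ _ only0] := dim_facet flt df.
  have [_ _ /(_ g ghs) lefk] := (mem_sup k flt).1 kf.
  rewrite -sgr_gt0; case: lefk => [/eqP | ->]; last by rewrite sgr_gt0 G0.
  by rewrite sgr_eq0 => /eqP/(only0 g ghs)/eqP; rewrite wf (negPf (Gh0 g gG)).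
- by move=> g gG; rewrite -sgr_gt0 He ?sGhs // (negPf (Gh0 g gG)) sgr_gt0 G0.
apply: leq_trans count_n; apply: (@count_lt _ _ _ _ h0) => //.
  by move=> h hhs; rewrite /sep He //; case: (h == h0); rewrite ?eqxx.
by rewrite /sep He // !eqxx.
Qed.

End Arrangements.

(** * 2-3 trees *)

Section TwoThreeTrees.
Variables (K : eqType) (T : Type) (cmp : K -> K -> timed comparison) (lt : rel K) (c : nat).
Hypothesis lt_trans : transitive lt.
Hypothesis cmpP : forall x y,
  match (cmp x y).1 with Lt => lt x y | Eq => x = y | Gt => lt y x end.
Hypothesis cmp_time : forall x y, (cmp x y).2 <= c.
Implicit Types (t : dict K T) (g : grown K T) (s u v : seq (K * T)).

Fixpoint inorder t : seq (K * T) :=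
  match t with
  | Leaf => [::]
  | Node2 l a r => inorder l ++ a :: inorder r
  | Node3 l a m b r => inorder l ++ a :: inorder m ++ b :: inorder r
  end.

Definition keys s := [seq e.1 | e <- s].

Fixpoint has_height (h : nat) t : Prop :=
  match h, t with
  | 0, Leaf => True
  | h'.+1, Node2 l _ r => has_height h' l /\ has_height h' r
  | h'.+1, Node3 l _ m _ r => [/\ has_height h' l, has_height h' m & has_height h' r]
  | _, _ => False
  end.

Definition grown_inorder g :=
  match g with Same t => inorder t | Defs.Split l a r => inorder l ++ a :: inorder r end.

Definition grown_height h g :=
  match g with Same t => has_height h t | Defs.Split l _ r => has_height h l /\ has_height h r end.

(** Insertion and replacement in one relation: [o] is the old value under [x], if any. The order
    bounds on both sides are what preserves sortedness. *)
Definition updated (x : K) (upd : option T -> T) s s' : Prop :=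
  exists s1 s2 o, [/\ s = s1 ++ (if o is Some a then (x, a) :: s2 else s2),
    s' = s1 ++ (x, upd o) :: s2, all (lt^~ x) (keys s1) & all (lt x) (keys s2)].

(** Carries the effect of a recursive call from a subtree to the whole inorder sequence. Since only
    that sequence matters, a split and an unsplit result are treated alike. *)
Lemma updated_context x upd s s' u v w w' : updated x upd s s' ->
  w = u ++ s ++ v -> w' = u ++ s' ++ v ->
  all (lt^~ x) (keys u) -> all (lt x) (keys v) -> updated x upd w w'.
Proof.
move=> [s1 [s2 [o [-> -> lt1 lt2]]]] -> -> ltu ltv; exists (u ++ s1), (s2 ++ v), o; split.
- by rewrite -!catA; case: o.
- by rewrite -!catA.
- by rewrite /keys map_cat all_cat ltu.
by rewrite /keys map_cat all_cat ltv andbT.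
Qed.

Lemma sorted_catP u v a : sorted lt (keys (u ++ a :: v)) ->
  [/\ sorted lt (keys u), sorted lt (keys v),
    all (lt^~ a.1) (keys u) & all (lt a.1) (keys v)].
Proof.
rewrite /keys map_cat sorted_pairwise // pairwise_cat /= allrel_consr.
by case/and3P=> /andP[ua _] su /andP[av sv]; rewrite !sorted_pairwise.
Qed.

Lemma all_lt_trans x y s : lt x y -> all (lt y) (keys s) -> all (lt x) (keys s).
Proof. by move=> xy; apply: sub_all => z; apply: lt_trans. Qed.

Lemma all_gt_trans x y s : lt x y -> all (lt^~ x) (keys s) -> all (lt^~ y) (keys s).
Proof. by move=> xy; apply: sub_all => z /lt_trans; apply. Qed.

Lemma keys_cat u v : keys (u ++ v) = keys u ++ keys v.
Proof. exact: map_cat. Qed.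

Lemma insertP x upd t : sorted lt (keys (inorder t)) ->
  updated x upd (inorder t) (grown_inorder (insert cmp x upd t).1).
Proof.
have eq_upd u a v : all (lt^~ x) (keys u) -> all (lt x) (keys v) ->
    updated x upd (u ++ (x, a) :: v) (u ++ (x, upd (Some a)) :: v).
  by move=> ltu ltv; exists u, v, (Some a).
elim: t => [|l IHl [ak av] r IHr | l IHl [ak av] m IHm [bk bv] r IHr] /=.
- by move=> _; exists [::], [::], None.
- move=> /sorted_catP[/= /IHl{}IHl /IHr{}IHr la ar]; have /= := cmpP x ak.
  case: (cmp x ak).1 => [eq_xa | xa | ax] /=.
  + by rewrite -eq_xa in la ar *; apply: eq_upd.
  + apply: (@updated_context _ _ _ _ [::] ((ak, av) :: inorder r) _ _ IHl) => //=.
      by case: (insert _ _ _ l).1 => [?|? ? ?] //=; rewrite -catA.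
    by rewrite xa (all_lt_trans xa).
  apply: (@updated_context _ _ _ _ (inorder l ++ [:: (ak, av)]) [::] _ _ IHr) => //=.
  + by rewrite cats0 -catA.
  + by rewrite cats0 -catA; case: (insert _ _ _ r).1 => [?|? ? ?] //=.
  by rewrite keys_cat all_cat (all_gt_trans ax) //= ax.
move=> /sorted_catP[/= /IHl{}IHl /sorted_catP[/= /IHm{}IHm /IHr{}IHr mb br] la].
rewrite keys_cat all_cat /= => /and3P[am ab ar].
have /= := cmpP x ak; case: (cmp x ak).1 => [eq_xa | xa | ax] /=.
- by rewrite -eq_xa in la ab am ar *; apply: eq_upd; rewrite // keys_cat all_cat am /= ab.
- apply: (@updated_context _ _ _ _ [::] ((ak, av) :: inorder m ++ (bk, bv) :: inorder r) _ _ IHl) => //=.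
    by case: (insert _ _ _ l).1 => [?|? ? ?] //=; rewrite -!catA.
  rewrite xa keys_cat all_cat /= (all_lt_trans xa) //= (lt_trans xa ab).
  by rewrite (all_lt_trans xa).
have /= := cmpP x bk; case: (cmp x bk).1 => [eq_xb | xb | bx] /=.
- rewrite -eq_xb in mb br ab *; rewrite -!cat_cons !catA.
  apply: eq_upd => //; rewrite keys_cat all_cat /= ax mb andbT.
  by rewrite (all_gt_trans ax).
- apply: (@updated_context _ _ _ _ (inorder l ++ [:: (ak, av)]) ((bk, bv) :: inorder r) _ _ IHm) => /=.
  + by rewrite -catA.
  + by case: (insert _ _ _ m).1 => [?|? ? ?] //=; rewrite -!catA //= -!catA.
  + by rewrite keys_cat all_cat (all_gt_trans ax) //= ax.
  by rewrite xb (all_lt_trans xb).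
apply: (@updated_context _ _ _ _ (inorder l ++ (ak, av) :: inorder m ++ [:: (bk, bv)]) [::] _ _ IHr) => //=.
- by rewrite cats0 -!catA /= -!catA.
- by case: (insert _ _ _ r).1 => [?|? ? ?] //=; rewrite cats0 -!catA /= -!catA.
rewrite keys_cat all_cat (all_gt_trans ax) //= ax keys_cat all_cat (all_gt_trans bx) //=.
by rewrite bx.
Qed.

Lemma updated_sorted x upd s s' : sorted lt (keys s) -> updated x upd s s' ->
  sorted lt (keys s').
Proof.
move=> + [s1 [s2 [o [def_s -> lt1 lt2]]]].
rewrite def_s !keys_cat !sorted_pairwise // !pairwise_cat /= lt2 allrel_consr lt1 /=.
case: o {def_s} => [a|] /=; last by case/and3P=> -> -> ->.
by rewrite allrel_consr => /and3P[/andP[_ ->] -> /andP[_ ->]].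
Qed.

Lemma insert_height h x upd t : has_height h t -> grown_height h (insert cmp x upd t).1.
Proof.
elim: t h => [|l IHl a r IHr | l IHl a m IHm b r IHr] [|h] //=.
  case=> hl hr; case: (cmp x a.1).1 => //=.
    by have := IHl h hl; case: (insert _ _ _ l).1 => [?|? ? ?] //= [].
  by have := IHr h hr; case: (insert _ _ _ r).1 => [?|? ? ?] //= [].
case=> hl hm hr; case: (cmp x a.1).1 => //=.
  by have := IHl h hl; case: (insert _ _ _ l).1 => [?|? ? ?] //= [].
case: (cmp x b.1).1 => //=.
  by have := IHm h hm; case: (insert _ _ _ m).1 => [?|? ? ?] //= [].
by have := IHr h hr; case: (insert _ _ _ r).1 => [?|? ? ?] //= [].
Qed.

(** Each level costs at most two comparisons of keys and one unit for rebuilding. *)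
Lemma insert_time h x upd t : has_height h t ->
  (insert cmp x upd t).2 <= (2 * c + 2) * h.+1.
Proof.
elim: t h => [|l IHl a r IHr | l IHl a m IHm b r IHr] [|h] //=.
- by move=> _; lia.
- case=> hl hr; have := cmp_time x a.1; have := IHl h hl; have := IHr h hr.
  by case: (cmp x a.1) => -[] ? /=; lia.
case=> hl hm hr; have := cmp_time x a.1; have := cmp_time x b.1.
have := IHl h hl; have := IHm h hm; have := IHr h hr.
by case: (cmp x a.1) => -[] ? /=; case: (cmp x b.1) => -[] ? /=; lia.
Qed.

Lemma has_height_size h t : has_height h t -> 2 ^ h <= (size (inorder t)).+1.
Proof.
elim: t h => [|l IHl a r IHr | l IHl a m IHm b r IHr] [|h] //=.
  case=> /IHl hl /IHr hr; rewrite size_cat /= expnS; lia.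
case=> /IHl hl /IHm hm /IHr hr; rewrite !size_cat /= size_cat /= expnS; lia.
Qed.

Definition balanced t := sorted lt (keys (inorder t)) /\ exists h, has_height h t.

Lemma upsertP x upd t : balanced t ->
  balanced (upsert cmp x upd t).1 /\
  updated x upd (inorder t) (inorder (upsert cmp x upd t).1).
Proof.
case=> st [h ht]; have upd_t := insertP x upd st.
have sg := updated_sorted st upd_t; have := insert_height x upd ht.
rewrite /upsert /=; case: (insert _ _ _ t).1 upd_t sg => [t' | l a r] /= upd_t sg hg.
  by split=> //; split=> //; exists h.
by split=> //; split=> //; exists h.+1.
Qed.

Lemma upsert_time x upd t : balanced t ->
  (upsert cmp x upd t).2 <= (2 * c + 2) * (trunc_log 2 (size (inorder t)).+1).+1 + 1.
Proof.
case=> _ [h ht]; rewrite /upsert /= leq_add2r.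
apply: leq_trans (insert_time x upd ht) _; rewrite leq_mul2l ltnS trunc_log_max ?orbT //.
exact: has_height_size.
Qed.

Lemma entriesP t (acc : seq (K * T)) : (entries t acc).1 = inorder t ++ acc /\
  (entries t acc).2 <= 4 * size (inorder t) + 1.
Proof.
elim: t acc => [|l IHl a r IHr | l IHl a m IHm b r IHr] acc //=.
  have [-> ?] := IHr acc; have [-> ?] := IHl (a :: inorder r ++ acc).
  by rewrite size_cat -catA /=; split=> //; lia.
have [-> ?] := IHr acc; have [-> ?] := IHm (b :: inorder r ++ acc).
have [-> ?] := IHl (a :: inorder m ++ b :: inorder r ++ acc).
by rewrite !size_cat /= size_cat /= -!catA /= -!catA; split=> //; lia.
Qed.

End TwoThreeTrees.

(** * Minimum spanning trees *)

Section MinimumSpanningTrees.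
Local Open Scope ring_scope.
Variables (R : realType) (d : nat) (V : finType) (E : {set {set V}}).
Variable c : {set V} -> 'rV[R]_d.+1.
Hypothesis simpE : simple_graph E.
Implicit Types (l : 'rV[R]_d.+1) (S T D : {set {set V}}) (a b e f : {set V}).

Local Notation W l e := (dot l (c e)).

Lemma tree_costU1 T b : b \notin T -> tree_cost c (b |: T)%SET = c b + tree_cost c T.
Proof. by move=> NTb; rewrite /tree_cost big_setU1. Qed.

Lemma tree_costD1 T a : a \in T -> tree_cost c (T :\ a)%SET = tree_cost c T - c a.
Proof. by move=> Ta; rewrite /tree_cost [in RHS](big_setD1 a) //= addrC addrK. Qed.

Lemma tree_cost_swap T a b : a \in T -> b \notin T ->
  tree_cost c (b |: T :\ a)%SET = tree_cost c T - c a + c b.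
Proof.
by move=> Ta NTb; rewrite tree_costU1 ?inE ?(negPf NTb) ?andbF // tree_costD1 // addrC.
Qed.

Lemma optimal_swap l T a b : weighted_sum_optimal E c l T -> a \in T -> b \notin T ->
  spanning_tree E (b |: T :\ a)%SET -> W l a <= W l b.
Proof.
move=> [_ opt] Ta NTb /opt; rewrite tree_cost_swap // dotDr dotBr.
by rewrite -addrA lerDl addrC subr_ge0.
Qed.

(** A competitor [S] is moved towards [T] edge by edge: the hypothesis on the exchange in [T] says
    that the reverse exchange in [S] does not increase its weight. Optimality thereby depends only
    on comparisons of edges. *)
Lemma locally_optimal l T : spanning_tree E T ->
  (forall a b, a \in T -> b \in E -> b \notin T -> spanning_tree E (b |: T :\ a)%SET ->
     W l a <= W l b) ->
  weighted_sum_optimal E c l T.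
Proof.
move=> stT loc; split=> // S; have [n] := ubnP #|S :\: T|%SET.
elim: n S => // n IH S; rewrite ltnS => leS stS.
case: (boolP (S \subset T)) => [sST | /subsetPn[b Sb NTb]].
  by rewrite (spanning_tree_eq simpE stS stT sST).
have [a [Ta NSa stTa stSb]] := spanning_tree_exchange simpE stS stT Sb NTb.
have Eb : b \in E by case: stS => /fintype.subsetP/(_ b Sb).
have ab := loc a b Ta Eb NTb stTa.
apply: (@le_trans _ _ (dot l (tree_cost c (a |: S :\ b)%SET))).
  apply: IH => //; apply: leq_trans leS; apply: proper_card.
  apply/properP; split.
    apply/fintype.subsetP => e; rewrite !inE => /andP[NTe /predU1P[ea | /andP[_ Se]]].
      by rewrite ea Ta in NTe.
    by rewrite NTe.
  by exists b; rewrite !inE ?NTb ?Sb //= eqxx orbF; apply: contraNneq NSa => <-.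
by rewrite tree_cost_swap // dotDr dotBr -addrA gerDl addrC subr_le0.
Qed.

(** The symmetric exchange bounds the weights of [a] and [b] by each other; injectivity then
    identifies the two edges. *)
Lemma optimal_unique l S T : {in E &, injective (fun e => W l e)} ->
  weighted_sum_optimal E c l S -> weighted_sum_optimal E c l T -> S = T.
Proof.
move=> inj optS optT; have [stS _] := optS; have [stT _] := optT.
case: (boolP (S \subset T)) => [| /subsetPn[b Sb NTb]].
  by move=> sST; apply: (spanning_tree_eq simpE stS stT).
have [a [Ta NSa stTa stSb]] := spanning_tree_exchange simpE stS stT Sb NTb.
have Eb : b \in E by case: stS => /fintype.subsetP/(_ b Sb).
have Ea : a \in E by case: stT => /fintype.subsetP/(_ a Ta).
have le_ab := optimal_swap optT Ta NTb stTa.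
have le_ba := optimal_swap optS Sb NSa stSb.
by case/negP: NTb; rewrite -(inj a b Ea Eb _) //; apply: le_anti; rewrite le_ab.
Qed.

(** * Kruskal's algorithm and the cycle test *)

Section Kruskal.
Variables (l : 'rV[R]_d.+1) (DT : forall V : finType, dynamic_forest V).

Lemma insert_edgeP e s : let r := insert_edge c l e s in
  [/\ perm_eq r.1 (e :: s),
      sorted (fun a b => W l a <= W l b) s -> sorted (fun a b => W l a <= W l b) r.1
    & (r.2 <= (4 * d.+1 + 1) * size s + 1)%N].
Proof.
elim: s => [|f s [IHp IHs IHt]] //=; first by rewrite muln0.
case: ltP => [ef | fe] /=.
  by split; [exact: perm_refl | move=> fs; rewrite (ltW ef) | nia].
split; last by nia.
  apply: (@perm_trans _ (f :: e :: s)); first by rewrite perm_cons.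
  by rewrite (perm_catCA [:: f] [:: e] s).
have tr : transitive (fun a b => W l a <= W l b) by move=> ? ? ?; apply: le_trans.
rewrite !(path_sortedE tr) => /andP[fs /IHs ->]; rewrite andbT.
by rewrite (perm_all _ IHp) /= fe.
Qed.

Lemma sort_edgesP s : let r := sort_edges c l s in
  [/\ perm_eq r.1 s, sorted (fun a b => W l a <= W l b) r.1
    & (r.2 <= (4 * d.+1 + 2) * (size s).+1 ^ 2)%N].
Proof.
elim: s => [|e s [IHp IHs IHt]] /=; first by split=> //; lia.
have [Ip Is It] := insert_edgeP e (sort_edges c l s).1; split.
- by apply: perm_trans Ip _; rewrite perm_cons.
- exact: Is.
rewrite (perm_size IHp) in It.
apply: leq_trans (leq_add IHt It) _; set k := (4 * d.+1)%N; set n := size s.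
rewrite -!mulnn; have : ((k + 1) * n + 1 <= (k + 2) * (2 * n + 3))%N by nia.
by lia.
Qed.

(** The final forest may contain edges heavier than a rejected [b], accepted later. The certificate
    of rejection is therefore the forest [F] of that moment, which joins the ends of [b] by edges no
    heavier than [b]. *)
Lemma kruskal_loopP (es : seq {set V}) (D : df (DT V)) (y : 'rV[R]_d.+1) :
  {subset es <= E} -> y = tree_cost c (df_edges D) ->
  sorted (fun a b => W l a <= W l b) es ->
  {in df_edges D & es, forall a b, W l a <= W l b} ->
  let r := (kruskal_loop c es D y).1 in
  [/\ df_edges D \subset df_edges r.1,
      {subset df_edges r.1 <= [predU df_edges D & es]},
      r.2 = tree_cost c (df_edges r.1)
    & {in es, forall b, b \in df_edges r.1 \/
         exists F : {set {set V}}, [/\ F \subset df_edges r.1, joined F b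
                                     & {in F, forall a, W l a <= W l b}]}].
Proof.
have tr : transitive (fun a b => W l a <= W l b) by move=> ? ? ?; apply: le_trans.
elim: es D y => [|e es IH] D y sub_es def_y sorted_es le_D /=.
  by split=> // a aD; rewrite inE /= aD.
have /andP[e_es es_sorted] : all (fun b => W l e <= W l b) es && sorted (fun a b => W l a <= W l b) es.
  by rewrite -path_sortedE.
have sub_es' : {subset es <= E} by move=> a aes; apply: sub_es; rewrite inE aes orbT.
have e2 : #|e| = 2%N by apply/simpE/sub_es/mem_head.
rewrite df_joinedP //; case: ifPn => [De | NDe].
  have [|sub1 sub2 def_r rej] := IH D y sub_es' def_y es_sorted.
    by move=> a b aD bes; apply: le_D; rewrite // inE bes orbT.
  split=> //.
    by move=> a /sub2; rewrite !inE /= => /orP[->|->]; rewrite ?orbT.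
  move=> b; rewrite inE => /predU1P[->|/rej //]; right.
  by exists (df_edges D); split=> // a aD; apply: le_D; rewrite ?mem_head.
have NeD : e \notin df_edges D.
  apply: contra NDe => eD; have [u [v [uv def_e]]] := edgeP simpE (sub_es e (mem_head _ _)).
  by rewrite (joinedE _ def_e); apply: connect1; rewrite /adj uv -def_e.
have edges_link := df_linkP e2 NDe.
have [||sub1 sub2 def_r rej] := IH (df_link D e).1 (y + c e) sub_es' _ es_sorted.
- by rewrite edges_link tree_costU1 // def_y addrC.
- move=> a b; rewrite edges_link !inE => /predU1P[-> bes|aD bes]; first exact: (allP e_es).
  by apply: le_D; rewrite // inE bes orbT.
rewrite edges_link in sub1 sub2.
split=> //.
- by apply: fintype.subset_trans sub1; apply: finset.subsetUr.
- by move=> a /sub2; rewrite !inE /= => /orP[/orP[->|->]|->]; rewrite ?orbT.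
move=> b; rewrite inE => /predU1P[->|/rej //]; left.
by apply: (fintype.subsetP sub1); rewrite !inE eqxx.
Qed.

Lemma kruskalP : connected_graph E ->
  let r := (kruskal DT E c l).1 in
  weighted_sum_optimal E c l (df_edges r.1) /\ r.2 = tree_cost c (df_edges r.1).
Proof.
move=> conE; rewrite /kruskal /=.
have [perm_es sorted_es _] := sort_edgesP (enum E).
set es := (sort_edges _ _ _).1 in perm_es sorted_es *.
have mem_es e : (e \in es) = (e \in E) by rewrite (perm_mem perm_es) mem_enum.
have [||| |_ subT -> rej] := @kruskal_loopP es (df_empty (DT V)).1 0.
- by move=> e; rewrite mem_es.
- by rewrite df_emptyP /tree_cost big_set0.
- by [].
- by move=> a b; rewrite df_emptyP inE.
set r := kruskal_loop _ _ _ _ in subT rej *; set T := df_edges r.1.1 in subT rej *.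
split=> //; have stT : spanning_tree E T.
  split; last by case: (df_forest r.1.1).
    by apply/fintype.subsetP => a /subT; rewrite !inE df_emptyP inE /= mem_es.
  move=> u v; apply: connect_sub (conE u v) => x y /andP[xy Exy].
  have [Txy | [F [sFT Fxy _]]] := rej _ (etrans (mem_es _) Exy).
    by apply: connect1; rewrite /adj xy.
  by apply: connect_adjS sFT _; apply: (joined_connect Fxy); rewrite !inE eqxx ?orbT.
apply: locally_optimal => // a b Ta Eb NTb stTb.
have [Tb | [F [sFT Fb leF]]] := rej _ (etrans (mem_es b) Eb); first by rewrite Tb in NTb.
(* Were [a] outside [F], then [F] would join the ends of [b] in the tree without [a], and the
   exchange would close a cycle. *)
apply: leF; have := (spanning_tree_swapP simpE stT Ta Eb NTb).2 stTb.
apply: contraNT => NFa; apply: joinedS Fb; apply/fintype.subsetP => f Ff.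
by rewrite !inE (fintype.subsetP sFT) // andbT; apply: contraNneq NFa => <-.
Qed.

Lemma kruskal_time (L : nat) :
  (forall (D : df (DT V)) e, (df_link D e).2 <= L /\ (df_joined D e).2 <= L)%N ->
  ((kruskal DT E c l).2 <= (4 * d.+1 + 2) * #|E|.+1 ^ 2 + (df_empty (DT V)).2
     + #|E| * (2 * L + d.+1 + 1) + 1)%N.
Proof.
move=> opL; rewrite /kruskal /=.
have [perm_es _] := sort_edgesP (enum E); rewrite -cardE => time_es.
suff loop es (D : df (DT V)) y :
    ((kruskal_loop c es D y).2 <= size es * (2 * L + d.+1 + 1) + 1)%N.
  have := loop (sort_edges c l (enum E)).1 (df_empty (DT V)).1 0.
  rewrite (perm_size perm_es) -cardE => time_loop.
  by apply: leq_trans (leq_add time_es (leq_add (leqnn _) time_loop)) _; rewrite !addnA.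
elim: es D y => [|e es IH] D y //=; have [_ joinL] := opL D e.
case: ifP => _ /=.
  by have := IH D y; set w := (2 * L + _ + 1)%N; rewrite mulSn /w; lia.
have [linkL _] := opL D e; have := IH (df_link D e).1 (y + c e).
by set w := (2 * L + _ + 1)%N; rewrite mulSn /w; lia.
Qed.

(** In the application [l0] lies on the crossed facet and [l] in the new cell. Only trading [eout]
    for [ein] can improve the tree on passing to [l]. If this exchange is possible, its result is
    still optimal at [l0] and no longer contains [eout], so that no improving exchange is left; if
    not, the old tree has none either. *)
Lemma swap_testP l0 (D : df (DT V)) y eout ein :
  weighted_sum_optimal E c l0 (df_edges D) -> y = tree_cost c (df_edges D) ->
  eout \in E -> ein \in E -> eout != ein -> W l0 eout = W l0 ein ->
  {in E &, forall a b, (a, b) != (eout, ein) -> a != b -> W l0 a <= W l0 b -> W l a <= W l b} ->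
  let r := (swap_test c D y eout ein).1 in
  weighted_sum_optimal E c l (df_edges r.1) /\ r.2 = tree_cost c (df_edges r.1).
Proof.
move=> opt0 def_y Eout Ein ne eq0 mono.
have [st0 _] := opt0; have [sTE _ _] := st0.
have [out2 in2] := (simpE Eout, simpE Ein).
rewrite /swap_test /= !df_memP //.
have unchanged : (eout \in df_edges D -> ein \notin df_edges D ->
      joined (df_edges D :\ eout)%SET ein) ->
    weighted_sum_optimal E c l (df_edges D).
  move=> noswap; apply: locally_optimal => // a b Ta Eb NTb stTab.
  have Ea := fintype.subsetP sTE _ Ta.
  apply: mono => //; last exact: optimal_swap opt0 Ta NTb stTab.
    apply: contraNneq (_ : ~~ joined (df_edges D :\ a)%SET b) => [[eq_a eq_b]|].
      by rewrite eq_a eq_b in Ta NTb *; apply: noswap.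
    exact/(spanning_tree_swapP simpE).
  by apply: contraNneq NTb => <-.
case: ifPn => [/andP[Tout NTin] | no_out]; last first.
  split=> //; apply: unchanged => Tout NTin; by rewrite Tout NTin in no_out.
rewrite /= df_joinedP // df_cutP //; case: ifPn => [noswap | swap] /=.
  by split=> //; apply: unchanged.
have stT' := (spanning_tree_swapP simpE st0 Tout Ein NTin).1 swap.
rewrite df_linkP // df_cutP //; split; last by rewrite tree_cost_swap // def_y.
have opt0' : weighted_sum_optimal E c l0 (ein |: df_edges D :\ eout)%SET.
  split=> // S stS; rewrite tree_cost_swap // dotDr dotBr eq0 subrK.
  exact: opt0.2.
apply: locally_optimal => // a b Ta Eb NTb stTab.
have [sTE' _ _] := stT'; have Ea := fintype.subsetP sTE' _ Ta.
apply: mono => //; last exact: optimal_swap opt0' Ta NTb stTab.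
  apply: contraTneq Ta => -[-> _]; rewrite !inE eqxx orbF; exact: ne.
by apply: contraNneq NTb => <-.
Qed.

Lemma swap_test_time (L : nat) (D : df (DT V)) y eout ein :
  (forall (D : df (DT V)) e, [/\ (df_link D e).2 <= L, (df_cut D e).2 <= L,
     (df_mem D e).2 <= L & (df_joined D e).2 <= L]%N) ->
  ((swap_test c D y eout ein).2 <= 5 * L + 2 * d.+1 + 1)%N.
Proof.
move=> opL; rewrite /swap_test /=.
have [_ _ + _] := opL D eout; have [_ _ + _] := opL D ein; have [_ + _ _] := opL D eout.
case: ifP => _ /=; last by lia.
have [_ _ _] := opL (df_cut D eout).1 ein; have [+ _ _ _] := opL (df_cut D eout).1 ein.
by case: ifP => _ /=; lia.
Qed.

End Kruskal.
End MinimumSpanningTrees.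

Lemma In_rcons (T : Type) (s : seq T) x y : List.In x (rcons s y) <-> x = y \/ List.In x s.
Proof.
elim: s => [|z s IH] /=; first by split=> [[->|//]|[->|//]]; left.
by rewrite IH; split=> [[|[|]]|[|[|]]]; auto.
Qed.

(** * The lexicographic order of cost vectors *)

Section LexicographicOrder.
Local Open Scope ring_scope.
Variable R : realType.
Implicit Types s t u : seq R.

Definition lex_lt s t : bool := if lex_cmp s t is Lt then true else false.

Lemma lex_lt_irr s : lex_lt s s = false.
Proof. by elim: s => //= x s; rewrite /lex_lt /= ltxx. Qed.

Lemma lex_lt_trans : transitive lex_lt.
Proof.
move=> t s; elim: s t => [|x s IH] [|y t] [|z u] //; rewrite /lex_lt /=.
have [xy|xy|eq_xy] := ltgtP x y => //; have [yz|yz|eq_yz] := ltgtP y z => // lt_st lt_tu.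
- by rewrite (lt_trans xy yz).
- by rewrite -eq_yz xy.
- by rewrite eq_xy yz.
by rewrite eq_xy eq_yz ltxx; apply: IH lt_st lt_tu.
Qed.

Lemma lex_cmp_sym s t : lex_cmp s t = Gt -> lex_cmp t s = Lt.
Proof. by elim: s t => [|x s IH] [|y t] //=; have [||_ /IH] := ltgtP x y. Qed.

Lemma lex_cmp_eq s t : size s = size t -> lex_cmp s t = Eq -> s = t.
Proof.
elim: s t => [|x s IH] [|y t] //= [size_st].
by have [||-> /(IH t size_st) ->] := ltgtP x y.
Qed.

End LexicographicOrder.

Section VectorKeys.
Local Open Scope ring_scope.
Variables (R : realType) (d : nat).
Implicit Types x y : 'rV[R]_d.+1.

Definition vec_lt x y : bool := lex_lt [seq x 0 i | i <- enum 'I_d.+1] [seq y 0 i | i <- enum 'I_d.+1].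

Lemma vec_lt_irr : irreflexive vec_lt.
Proof. by move=> x; apply: lex_lt_irr. Qed.

Lemma vec_lt_trans : transitive vec_lt.
Proof. by move=> y x z; apply: lex_lt_trans. Qed.

Lemma vcmpP x y :
  match (vcmp x y).1 with Lt => vec_lt x y | Eq => x = y | Gt => vec_lt y x end.
Proof.
rewrite /= /vec_lt /lex_lt.
case cmp_xy: (lex_cmp _ _) => //; last by rewrite (lex_cmp_sym cmp_xy).
move: cmp_xy => /lex_cmp_eq eq_xy; apply/rowP => i.
by have /eq_in_map/(_ i (mem_enum _ _)) := eq_xy (etrans (size_map _ _) (esym (size_map _ _))).
Qed.

End VectorKeys.

(** * The incidence graph *)

Section IncidenceGraph.
Local Open Scope ring_scope.
Variables (R : realType) (d : nat).
Implicit Types (F : face_rec R d) (As : seq (face_rec R d)) (g : graph).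

Definition relevant_facet F : bool := ((fr_dim F).+1 == d) && positive (lift_weight (fr_point F)).

(* [F] is a facet that contributes the entry [(k', j)] to the list of [k]. *)
Definition joins F (k k' j : nat) : Prop :=
  [/\ relevant_facet F, fr_hyp F = j & fr_sup F = [:: k; k'] \/ fr_sup F = [:: k'; k]].

Lemma sum_delta n k : (\sum_(i < n) (i == k :> nat) <= 1)%N.
Proof.
have [klt | kge] := ltnP k n; last first.
  rewrite big1 // => i _; case: eqP => // ik; have := ltn_ord i.
  by rewrite ik ltnNge kge.
by rewrite (bigD1 (Ordinal klt)) //= eqxx big1 // => i /negPf; rewrite -val_eqE /= => ->.
Qed.

Definition degree g k := size (nth [::] g k).

(** Only an inequality, since the index [k] may lie outside the range of summation. *)
Lemma degree_set g k e n :
  (\sum_(i < n) degree (set_nth [::] g k (e :: nth [::] g k)) i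
     <= \sum_(i < n) degree g i + 1)%N.
Proof.
rewrite (eq_bigr (fun i : 'I_n => (i == k :> nat) + degree g i)%N).
  by rewrite big_split /= addnC leq_add2l sum_delta.
move=> i _; rewrite /degree nth_set_nth /=; case: eqP => // ->.
by rewrite add1n.
Qed.

(** Every facet adds at most two entries. The degree sum is bounded over an arbitrary range [n], so
    that the length of the array need not be followed. *)
Lemma add_facetsP As g : let r := add_facets As g in
  [/\ forall k k' j, (k', j) \in nth [::] r.1 k -> (k', j) \in nth [::] g k \/
        exists2 i, (i < size As)%N & joins (nth (face_rec0 R d) As i) k k' j,
      forall k, {subset nth [::] g k <= nth [::] r.1 k},
      forall i k k' j, (i < size As)%N -> joins (nth (face_rec0 R d) As i) k k' j ->
        (k', j) \in nth [::] r.1 k,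
      forall n, (\sum_(i < n) degree r.1 i <= \sum_(i < n) degree g i + 2 * size As)%N
    & (r.2 <= (2 * d.+1 + 4) * size As + 1)%N].
Proof.
elim: As g => [|F As IH] g /=.
  split.
  - by move=> k k' j inj; left.
  - by move=> k e.
  - by move=> i; rewrite ltn0.
  - by move=> n; rewrite muln0 addn0.
  by rewrite muln0.
pose facet := ((fr_dim F).+1 == d) && positive (lift_weight (fr_point F)).
rewrite -/facet; set step := (if facet then _ else _).
have [sub step_in step_all step_deg step_time] : [/\ forall k, {subset nth [::] g k <= nth [::] step.1 k},
    forall k k' j, (k', j) \in nth [::] step.1 k -> (k', j) \in nth [::] g k \/ joins F k k' j,
    forall k k' j, joins F k k' j -> (k', j) \in nth [::] step.1 k,
    forall n, (\sum_(i < n) degree step.1 i <= \sum_(i < n) degree g i + 2)%N & (step.2 <= 4)%N].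
  rewrite /step; case facetF: facet; last first.
    split; [by move=> k e | by move=> k k' j inj; left | | by move=> n; apply: leq_addr | by []].
    by move=> k k' j []; rewrite /relevant_facet -/facet facetF.
  case supF: (fr_sup F) => [|k1 [|k2 [|? ?]]]; try by
    split; [move=> k e | move=> k k' j inj; left | move=> k k' j [_ _]; rewrite supF => -[]
      | move=> n; apply: leq_addr | ].
  rewrite /=; set g1 := set_nth [::] g k1 _; set g2 := set_nth [::] g1 k2 _.
  have nth_g1 k : nth [::] g1 k = if k == k1 then (k2, fr_hyp F) :: nth [::] g k1 else nth [::] g k.
    by rewrite nth_set_nth.
  have nth_g2 k : nth [::] g2 k = if k == k2 then (k1, fr_hyp F) :: nth [::] g1 k2 else nth [::] g1 k.
    by rewrite nth_set_nth.
  have sub1 k : {subset nth [::] g k <= nth [::] g1 k}.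
    by move=> e eg; rewrite nth_g1; case: eqP eg => [->|//]; rewrite inE => ->; rewrite orbT.
  have sub2 k : {subset nth [::] g1 k <= nth [::] g2 k}.
    by move=> e eg; rewrite nth_g2; case: eqP eg => [->|//]; rewrite inE => ->; rewrite orbT.
  have mem1 : (k2, fr_hyp F) \in nth [::] g1 k1 by rewrite nth_g1 eqxx mem_head.
  have mem2 : (k1, fr_hyp F) \in nth [::] g2 k2 by rewrite nth_g2 eqxx mem_head.
  split=> //.
  - by move=> k e /sub1/sub2.
  - move=> k k' j; rewrite nth_g2; have in_g1 k0 : (k', j) \in nth [::] g1 k0 ->
        (k', j) \in nth [::] g k0 \/ joins F k0 k' j.
      rewrite nth_g1; case: eqP => [->|]; last by left.
      rewrite inE => /predU1P[[-> ->]|]; last by left.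
      by right; split=> //; left.
    case: eqP => [->|_]; last exact: in_g1.
    rewrite inE => /predU1P[[-> ->]|/in_g1 //].
    by right; split=> //; right.
  - move=> k k' j [_ <-]; rewrite supF => -[[<- <-]|[<- <-]] //.
    exact: sub2.
  move=> n; apply: leq_trans (degree_set _ _ _ _) _.
  by rewrite -[2%N]/(1 + 1)%N addnA leq_add2r degree_set.
have [IHin IHsub IHall IHdeg IHtime] := IH step.1; split.
- move=> k k' j /IHin[/step_in[|joinF]|[i ilt joini]]; first by left.
    by right; exists 0%N.
  by right; exists i.+1.
- by move=> k e /sub/IHsub.
- by case=> [|i] k k' j ilt /=; [move/step_all/IHsub | apply: IHall].
- move=> n; apply: leq_trans (IHdeg n) _.
  by rewrite mulnS addnA leq_add2r.
by rewrite mulnS; lia.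
Qed.

Lemma incidence_graphP As : let r := incidence_graph As in
  [/\ forall k k' j, (k', j) \in nth [::] r.1 k <->
        exists2 i, (i < size As)%N & joins (nth (face_rec0 R d) As i) k k' j,
      forall n, (\sum_(i < n) degree r.1 i <= 2 * size As)%N
    & (r.2 <= (2 * d.+1 + 5) * size As + 2)%N].
Proof.
rewrite /incidence_graph /=; set g0 := nseq _ _.
have nth_g0 k : nth [::] g0 k = [::] by rewrite nth_nseq if_same.
have [sound _ complete deg time] := add_facetsP As g0; split.
- move=> k k' j; split=> [/sound[|//]|[i ilt joini]]; first by rewrite nth_g0.
  exact: complete ilt joini.
- move=> n; apply: leq_trans (deg n) _; rewrite big1 // => i _.
  by rewrite /degree nth_g0.
have -> : (2 * d.+1 + 5 = 2 * d.+1 + 4 + 1)%N by lia.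
by rewrite mulnDl; lia.
Qed.

Lemma relevant_cellsP k As : let r := relevant_cells k As in
  (forall i, i \in r.1 <-> exists2 j, i = (k + j)%N & [/\ (j < size As)%N,
     fr_dim (nth (face_rec0 R d) As j) = d
     & positive (lift_weight (fr_point (nth (face_rec0 R d) As j)))]) /\
  (r.2 <= (2 * d.+1 + 1) * size As + 1)%N.
Proof.
elim: As k => [|F As IH] k /=.
  by split=> [i|]; [split=> [|[j _ []]] | rewrite muln0].
have [mem time] := IH k.+1; split; last by rewrite mulnS; lia.
have tail i : i \in (relevant_cells k.+1 As).1 <-> exists2 j, i = (k + j.+1)%N & [/\ (j < size As)%N,
     fr_dim (nth (face_rec0 R d) As j) = d
     & positive (lift_weight (fr_point (nth (face_rec0 R d) As j)))].
  by rewrite mem; split=> -[j -> ?]; exists j; rewrite ?addSnnS.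
move=> i; case: ifPn => [/andP[/eqP dimF posF] | irr].
  rewrite inE; split=> [/predU1P[->|/tail[j -> ?]]|[[|j] -> ?]].
  - by exists 0%N; rewrite ?addn0.
  - by exists j.+1.
  - by rewrite addn0 eqxx.
  by apply/orP; right; apply/tail; exists j.
split=> [/tail[j -> ?]|[[|j] -> [? dimF posF]]]; first by exists j.+1.
  by rewrite dimF eqxx posF in irr.
by apply/tail; exists j.
Qed.

End IncidenceGraph.

(** * Strict separation *)

Section StrictSeparation.
Local Open Scope ring_scope.
Variables (R : realType) (n : nat).
Implicit Types (u v : 'rV[R]_n) (vs : seq 'rV[R]_n).

Lemma perturb_positive vs u v : v != 0 -> dot u v = 0 ->
  {in vs, forall w, 0 < dot u w} -> exists u', {in v :: vs, forall w, 0 < dot u' w}.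
Proof.
move=> v0 uv pos; pose form w : hyp R n := (w, 0).
have formE w z : heval (form w) z = dot z w by rewrite /heval addr0 dotC.
have [e /andP[e_gt0 _] He] := small_step [seq form w | w <- v :: vs] u (u + v).
exists (u + e *: (u + v - u)) => w wvs.
have := He e; rewrite e_gt0 lexx => /(_ isT (form w) (map_f _ wvs)).
rewrite !formE => sgw; rewrite -sgr_gt0 sgw; move: wvs; rewrite inE.
case/predU1P => [-> | /pos uw]; first by rewrite uv eqxx dotDl uv add0r sgr_gt0 dot_gt0.
by rewrite gt_eqF // sgr_gt0.
Qed.

(* Gordan's alternative, by Fourier-Motzkin elimination. *)
Lemma gordan vs :
  (exists u, {in vs, forall v, 0 < dot u v}) \/
  (exists a : nat -> R, [/\ forall i, 0 <= a i, exists2 i, (i < size vs)%N & 0 < a i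
                          & \sum_(i < size vs) a i *: vs`_i = 0]).
Proof.
have [m] := ubnP (size vs); elim: m vs => // m IH [|v vs] /=; first by left; exists 0.
rewrite ltnS => size_vs; have [[u pos] | [a [a_ge0 [i ilt a_gt0] sum0]]] := IH vs size_vs; last first.
  right; exists (fun k => if k is k'.+1 then a k' else 0); split.
  - by case.
  - by exists i.+1.
  by rewrite big_ord_recl scale0r add0r; apply: sum0.
have [uv | uv | uv] := ltgtP 0 (dot u v).
- by left; exists u => w; rewrite inE => /predU1P[->|/pos].
(* The elimination step: [w - r w *: v] is the projection of [w] along [v] onto the hyperplane
   orthogonal to [u]. *)
- pose r w := dot u w / dot u v.
  have ruv w : r w * dot u v = dot u w by rewrite /r mulfVK // lt_eqF.
  have [|[u' pos'] | [a [a_ge0 [i ilt a_gt0] sum0]]] := IH [seq w - r w *: v | w <- vs].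
  + by rewrite size_map.
  (* [u1] is orthogonal to [v], and its value at [w] is that of [u'] at the projection of [w]; it
     remains to make it positive at [v] itself. *)
  + left; pose u1 := u' - (dot u' v / dot u v) *: u.
    have u1v : dot u1 v = 0 by rewrite dotBl dotZl mulfVK ?subrr // lt_eqF.
    have v0 : v != 0 by apply: contraTneq uv => ->; rewrite dot0r ltxx.
    apply: (perturb_positive v0 u1v) => w wvs.
    suff -> : dot u1 w = dot u' (w - r w *: v) by apply: pos'; apply: map_f.
    have -> : dot u1 w = dot u1 (w - r w *: v) by rewrite dotBr dotZr u1v mulr0 subr0.
    rewrite dotBl dotZl.
    by rewrite [dot u (w - _)]dotBr dotZr ruv subrr mulr0 subr0.
  rewrite size_map in ilt sum0.
  (* The coefficient of [v] is nonnegative because [r] is negative on [vs]: [u] is positive there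
     and negative at [v]. *)
  right; exists (fun k => if k is k'.+1 then a k' else - \sum_(j < size vs) a j * r vs`_j); split.
  + case=> [|k] //; rewrite -sumrN sumr_ge0 // => j _.
    rewrite -mulrN mulr_ge0 // /r -mulrN -invrN divr_ge0 ?oppr_ge0 ?ltW //.
    by rewrite pos // mem_nth.
  + by exists i.+1.
  rewrite big_ord_recl scaleNr scaler_suml addrC -sumrB -[RHS]sum0.
  by apply: eq_bigr => j _ /=; rewrite (nth_map 0) // scalerBr scalerA.
case: (eqVneq v 0) => [-> | v0]; last by left; apply: perturb_positive v0 _ pos.
right; exists (fun k => if k is k'.+1 then 0 else 1); split.
- by case.
- by exists 0%N; rewrite ?ltr01.
by rewrite big_ord_recl scaler0 add0r big1 // => j _; rewrite scale0r.
Qed.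

End StrictSeparation.

(** * The weight set *)

Section WeightSet.
Local Open Scope ring_scope.
Variables (R : realType) (d : nat) (V : finType) (E : {set {set V}}).
Variable c : {set V} -> 'rV[R]_d.+1.
Hypotheses (d_gt0 : (0 < d)%N) (simpE : simple_graph E).
Hypotheses (distinctE : hyperplanes_distinct E c) (no_vertical : no_vertical_hyperplane E c).
Implicit Types (l u v : 'rV[R]_d.+1) (S T : {set {set V}}) (a b e f : {set V}) (x : 'rV[R]_d).

Local Notation W l e := (dot l (c e)).

(** Equal costs would make the separating hyperplane the whole space, which contains vertical
    lines. *)
Lemma cost_inj : {in E &, injective c}.
Proof.
move=> e f Ee Ef eq_c; apply/eqP; apply: contraT => /eqP ne.
by case: (no_vertical Ee Ef ne); exists 0 => t; rewrite /separating_hyperplane /= eq_c.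
Qed.

Lemma dot_leqq l u v : positive l -> leqq u v -> dot l u <= dot l v.
Proof.
move=> /forallP pos /forallP uv; apply: ler_sum => i _.
by rewrite ler_wpM2l // ltW.
Qed.

(** Strict positivity of the weights fixes the order of two comparable edges of different cost; this
    is why such pairs may be left out of the arrangement. *)
Lemma dot_leqq_lt l u v : positive l -> leqq u v -> u != v -> dot l u < dot l v.
Proof.
move=> pos uv; rewrite lt_neqAle dot_leqq // andbT; apply: contraNneq => eq_uv.
have ge0 i : 0 <= l 0 i * (v - u) 0 i.
  by rewrite mulr_ge0 ?(ltW (forallP pos i)) // !mxE subr_ge0 (forallP uv).
have : dot l (v - u) == 0 by rewrite dotBr eq_uv subrr.
rewrite psumr_eq0 // => /allP zero; rewrite eq_sym -subr_eq0; apply/eqP/rowP => i.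
have := zero i (mem_index_enum _); rewrite mulf_eq0 (gt_eqF (forallP pos i)) /= => /eqP->.
by rewrite mxE.
Qed.

Lemma heval_project v x : heval (project_hyp v) x = dot v (lift_weight x).
Proof.
rewrite /heval /dot /= [RHS](bigD1_ord ord_max) //= [lift_weight x 0 _]mxE unlift_none.
rewrite (eq_bigr (fun j => v 0 (lift ord_max j) * x 0 j - v 0 ord_max * x 0 j)); last first.
  by move=> j _; rewrite mxE mulrBl.
rewrite [X in _ = _ + X](eq_bigr (fun j => v 0 (lift ord_max j) * x 0 j)); last first.
  by move=> j _; rewrite mxE liftK.
by rewrite sumrB -mulr_sumr; ring.
Qed.

Lemma lift_weight_sum x : \sum_i lift_weight x 0 i = 1.
Proof.
rewrite (bigD1_ord ord_max) //= mxE unlift_none.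
rewrite [X in _ + X](eq_bigr (fun j => x 0 j)) ?subrK // => j _.
by rewrite mxE liftK.
Qed.

Lemma project_weightK l : \sum_i l 0 i = 1 -> lift_weight (project_weight l) = l.
Proof.
move=> suml; apply/rowP => i; rewrite mxE; case: unliftP => [j ->|->]; first by rewrite mxE.
rewrite -suml (bigD1_ord ord_max) //= [X in _ - X](eq_bigr (fun j => l 0 (lift ord_max j))) ?addrK // => j _.
by rewrite mxE.
Qed.

Lemma lift_weight_line x z t :
  lift_weight (x + t *: (z - x)) = (1 - t) *: lift_weight x + t *: lift_weight z.
Proof.
rewrite -[RHS]project_weightK.
  congr lift_weight; apply/rowP => j; rewrite !mxE !liftK; ring.
rewrite (eq_bigr (fun i => (1 - t) * lift_weight x 0 i + t * lift_weight z 0 i)).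
  by rewrite big_split /= -!mulr_sumr !lift_weight_sum !mulr1 subrK.
by move=> i _; rewrite !mxE.
Qed.

(** * The list of hyperplanes and their traces *)

Definition incomparable e f : bool := ~~ (leqq (c e) (c f) || leqq (c f) (c e)).

Lemma incomparable_withP e es : let r := incomparable_with c e es in
  r.1 = [seq inl (e, f) | f <- es & incomparable e f] /\ (r.2 <= (2 * d.+1 + 1) * size es + 1)%N.
Proof.
elim: es => [|f es [IH1 IH2]] /=; first by rewrite muln0.
split; last by lia.
by rewrite /incomparable IH1; case: ifP.
Qed.

Lemma incomparable_neq e f : incomparable e f -> e != f.
Proof.
apply: contraTneq => ->; rewrite negbK.
by have -> : leqq (c f) (c f) by apply/forallP => i.
Qed.

Lemma incomparable_pairsP es : uniq es -> let r := incomparable_pairs c es in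
  [/\ forall h, h \in r.1 -> exists e f, [/\ h = inl (e, f), e \in es, f \in es,
        (index e es < index f es)%N & incomparable e f],
      {in es &, forall e f, (index e es < index f es)%N -> incomparable e f ->
        inl (e, f) \in r.1},
      uniq r.1, (size r.1 <= size es ^ 2)%N
    & (r.2 <= (2 * d.+1 + 3) * (size es).+1 ^ 2)%N].
Proof.
elim: es => [|e es IH] /=; first by split=> //; lia.
case/andP=> Nes uniq_es; have [IHin IHall IHuniq IHsize IHtime] := IH uniq_es.
have [-> with_time] := incomparable_withP e es.
set we := [seq _ | f <- _ & _].
have size_we : (size we <= size es)%N by rewrite size_map size_filter count_size.
have idx f : f \in es -> (e == f) = false by move=> fes; apply: contraNF Nes => /eqP->.
split.
- move=> h; rewrite mem_cat => /orP[/mapP[f] | /IHin[a [b [-> aes bes ab inc]]]].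
    rewrite mem_filter => /andP[inc fes] ->; exists e, f.
    by rewrite eqxx idx // !inE eqxx fes orbT.
  by exists a, b; rewrite !idx // !inE aes bes !orbT.
- move=> a b; rewrite !inE => /predU1P[-> | aes] /predU1P[-> | bes] /=; rewrite ?eqxx ?ltnn ?idx //.
    move=> _ inc; rewrite mem_cat; apply/orP; left; apply/mapP; exists b => //.
    by rewrite mem_filter inc.
  by rewrite ltnS => ab inc; rewrite mem_cat IHall ?orbT.
- rewrite cat_uniq IHuniq andbT map_inj_uniq ?filter_uniq //; last by move=> ? ? [].
  apply/hasPn => h /IHin[a [b [-> aes _ _ _]]]; apply/negP => /mapP[f _ [ea _]].
  by rewrite -ea aes in Nes.
- by rewrite size_cat; apply: leq_trans (leq_add size_we IHsize) _; set n := size es; nia.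
rewrite -mulnn; rewrite -mulnn in IHtime.
apply: leq_trans (leq_add with_time (leq_add IHtime (_ : (_.+1 <= (size es).+1)%N))) _ => //.
by set n := size es; set k := (2 * d.+1)%N; nia.
Qed.

Lemma project_allP hs : let r := project_all c hs in
  r.1 = [seq project_hyp (normal c h) | h <- hs] /\ (r.2 <= (2 * d.+1 + 1) * size hs + 1)%N.
Proof.
elim: hs => [|h hs [IH1 IH2]] /=; first by rewrite muln0.
by rewrite IH1; split=> //; lia.
Qed.

Definition labels : seq (label d V) :=
  (incomparable_pairs c (enum E)).1 ++ [seq inr i | i <- enum 'I_d.+1].

Definition hyps : seq (hyp R d) := [seq project_hyp (normal c h) | h <- labels].

Lemma labels_pair e f : inl (e, f) \in labels ->
  [/\ e \in E, f \in E, incomparable e f & (index e (enum E) < index f (enum E))%N].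
Proof.
have [in_pairs _ _ _ _] := incomparable_pairsP (enum_uniq E).
rewrite mem_cat => /orP[/in_pairs[a [b [[-> ->] Ea Eb ab inc]]] | /mapP[] //].
by rewrite !mem_enum in Ea Eb.
Qed.

Lemma labels_axis i : inr i \in labels.
Proof. by rewrite mem_cat (map_f _ (mem_enum _ _)) ?orbT // mem_enum. Qed.

Lemma pair_in_labels e f : e \in E -> f \in E -> incomparable e f ->
  inl (e, f) \in labels \/ inl (f, e) \in labels.
Proof.
have [_ all_pairs _ _ _] := incomparable_pairsP (enum_uniq E).
rewrite -(mem_enum E) -(mem_enum E f) => Ee Ef inc.
have [ef | fe | eq_ef] := ltngtP (index e (enum E)) (index f (enum E)).
- by left; rewrite mem_cat all_pairs.
- by right; rewrite mem_cat all_pairs // /incomparable orbC.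
have := incomparable_neq inc; rewrite -(nth_index e Ee) eq_ef nth_index // eqxx.
by [].
Qed.

Lemma labels_uniq : uniq labels.
Proof.
have [in_pairs _ uniq_pairs _ _] := incomparable_pairsP (enum_uniq E).
rewrite cat_uniq uniq_pairs map_inj_uniq ?enum_uniq ?andbT; last by move=> ? ? [].
by apply/hasPn => _ /mapP[i _ ->]; apply/negP => /in_pairs[? [? []]].
Qed.

(** The projected normal vanishes only if all entries of [v] are equal, and then [v] is comparable
    with 0. *)
Lemma project_hyp_neq0 v : ~~ leqq v 0 -> ~~ leqq 0 v -> (project_hyp v).1 != 0.
Proof.
move=> nle0 nge0; apply/eqP => /rowP proj0.
have const i : v 0 i = v 0 ord_max.
  case: (unliftP ord_max i) => [j ->|-> //]; have := proj0 j; rewrite !mxE => /eqP.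
  by rewrite subr_eq0 => /eqP.
case/orP: (le_total (v 0 ord_max) 0) => le0.
  by case/negP: nle0; apply/forallP => i; rewrite const mxE.
by case/negP: nge0; apply/forallP => i; rewrite const mxE.
Qed.

Lemma hyps_neq0 h : h \in labels -> (project_hyp (normal c h)).1 != 0.
Proof.
case: h => [[e f] /labels_pair[_ _ inc _] | i _] /=.
  have [ef fe] := norP inc; apply: project_hyp_neq0.
    apply: contraNN ef => /forallP h; apply/forallP => i.
    by have := h i; rewrite !mxE subr_le0.
  apply: contraNN fe => /forallP h; apply/forallP => i.
  by have := h i; rewrite !mxE subr_ge0.
apply/rV0Pn; case: (unliftP ord_max i) => [j ->|->].
  by exists j; rewrite !mxE !eqxx /= (negPf (neq_lift _ _)) subr0 oner_neq0.
exists (Ordinal d_gt0); rewrite !mxE !eqxx /= [lift _ _ == _]eq_sym (negPf (neq_lift _ _)).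
by rewrite sub0r oppr_eq0 oner_neq0.
Qed.

(* A central hyperplane is determined by its trace on the affine hull of the
   weight set, provided that the trace is a hyperplane. *)
Lemma hyperplane_projectP u v : (project_hyp u).1 != 0 ->
  hyperplane (project_hyp u) = hyperplane (project_hyp v) ->
  forall l, dot u l = 0 -> dot v l = 0.
Proof.
move=> u0 eq_uv.
have eq0 x : dot u (lift_weight x) = 0 -> dot v (lift_weight x) = 0.
  move=> ux; rewrite -heval_project; rewrite -[_ = 0]/(hyperplane (project_hyp v) x).
  by rewrite -eq_uv /hyperplane /= heval_project.
have {}eq0 l : \sum_i l 0 i = 1 -> dot u l = 0 -> dot v l = 0.
  by move=> suml; rewrite -(project_weightK suml); apply: eq0.
(* A base point on the trace, the foot of the perpendicular from the origin of the projected space.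
   Adding it brings a vector of sum zero into the affine hull; any other vector is rescaled. *)
have [l1 suml1 ul1] : exists2 l1 : 'rV[R]_d.+1, \sum_i l1 0 i = 1 & dot u l1 = 0.
  set h := project_hyp u in u0; pose x := 0 + (- heval h 0 / dot h.1 h.1) *: h.1.
  exists (lift_weight x); first exact: lift_weight_sum.
  rewrite -heval_project -/h heval_add_normal divfK ?subrr //.
  by rewrite gt_eqF // dot_gt0.
have eq_l1 := eq0 l1 suml1 ul1 => l ul; have [suml | suml] := eqVneq (\sum_i l 0 i) 0.
  have : dot v (l + l1) = 0.
    apply: eq0; last by rewrite dotDr ul ul1 addr0.
    rewrite (eq_bigr (fun i => l 0 i + l1 0 i)) ?big_split /= ?suml ?suml1 ?add0r // => i _.
    by rewrite mxE.
  by rewrite dotDr eq_l1 addr0.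
have : dot v ((\sum_i l 0 i)^-1 *: l) = 0.
  apply: eq0; last by rewrite dotZr ul mulr0.
  rewrite (eq_bigr (fun i => (\sum_i l 0 i)^-1 * l 0 i)); last by move=> i _; rewrite mxE.
  by rewrite -mulr_sumr mulVf.
by rewrite dotZr => /eqP; rewrite mulf_eq0 invr_eq0 (negPf suml) => /eqP.
Qed.

(** The standing assumption covers two pairs of edges. A pair cannot share its hyperplane with a
    coordinate axis label [i] either: the costs of its edges would differ in coordinate [i] only and
    be comparable. *)
Lemma hyps_inj h h' : h \in labels -> h' \in labels ->
  hyperplane (project_hyp (normal c h)) = hyperplane (project_hyp (normal c h')) -> h = h'.
Proof.
move=> hl h'l eq_hh'; have le := hyperplane_projectP (hyps_neq0 hl) eq_hh'.
have ge := hyperplane_projectP (hyps_neq0 h'l) (esym eq_hh').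
have axis_pair i e f : inl (e, f) \in labels ->
    ~ (forall l, dot (delta_mx 0 i) l = 0 -> dot (c e - c f) l = 0).
  move=> /labels_pair[_ _ /norP[/negP ef /negP fe] _] sub.
  have zero j : j != i -> c e 0 j = c f 0 j.
    move=> ji; have := sub (delta_mx 0 j); rewrite !dot_delta !mxE (negPf ji) andbF.
    by move=> /(_ erefl)/eqP; rewrite subr_eq0 => /eqP.
  case/orP: (le_total (c e 0 i) (c f 0 i)) => le_i; [case: ef | case: fe];
    by apply/forallP => j; have [-> //|/zero->] := eqVneq j i.
case: h hl le ge {eq_hh'} => [[e f]|i] hl le ge; case: h' h'l le ge => [[e' f']|i'] h'l le ge.
- have [Ee Ef inc idx] := labels_pair hl; have [Ee' Ef' inc' idx'] := labels_pair h'l.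
  case: (eqVneq [set e; f]%SET [set e'; f']%SET) => [eq_set | /eqP ne_set]; last first.
    case: (distinctE Ee Ef Ee' Ef' _ _ ne_set).
    + exact/eqP/incomparable_neq.
    + exact/eqP/incomparable_neq.
    apply/seteqP; split=> l; rewrite /separating_hyperplane /= => eq_l; apply/eqP.
      by rewrite -subr_eq0 -dotBr dotC le // dotC dotBr eq_l subrr.
    by rewrite -subr_eq0 -dotBr dotC ge // dotC dotBr eq_l subrr.
  have ein : e \in [set e'; f']%SET by rewrite -eq_set !inE eqxx.
  have fin : f \in [set e'; f']%SET by rewrite -eq_set !inE eqxx orbT.
  have ne := incomparable_neq inc.
  move: ein fin ne; rewrite !inE.
  case/orP=> /eqP eq_e; case/orP=> /eqP eq_f; rewrite eq_e eq_f ?eqxx // => _.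
  (* The reversed pair is excluded because a label lists its edges in the order of [enum E]. *)
  by rewrite eq_e eq_f ltnNge ltnW in idx.
- by case: (axis_pair i' e f hl ge).
- by case: (axis_pair i e' f' h'l le).
case: (eqVneq i i') => [-> // | ii'].
have := le (delta_mx 0 i'); rewrite !dot_delta !mxE !eqxx /= [i' == i]eq_sym (negPf ii').
by move=> /(_ erefl)/eqP; rewrite oner_eq0.
Qed.

Lemma hyps_proper : proper_hyps hyps.
Proof.
have nth_hyps i : (i < size hyps)%N ->
    nth (0, 0) hyps i = project_hyp (normal c (nth (inr ord0) labels i)).
  by rewrite size_map => ilt; rewrite (nth_map (inr ord0)).
split=> [i ilt | i j ilt jlt ij].
  by rewrite nth_hyps // hyps_neq0 // mem_nth // -(size_map (fun h => project_hyp (normal c h))).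
rewrite !nth_hyps // => /hyps_inj eq_ij; case: ij; apply/eqP.
rewrite size_map in ilt jlt.
by rewrite -(nth_uniq (inr ord0) ilt jlt labels_uniq) eq_ij ?mem_nth.
Qed.

Lemma mem_hyps h : h \in labels -> project_hyp (normal c h) \in hyps.
Proof. exact: map_f. Qed.

Lemma hevalBE e f x :
  heval (project_hyp (c e - c f)) x = W (lift_weight x) e - W (lift_weight x) f.
Proof. by rewrite heval_project dotC dotBr. Qed.

Lemma positive_liftP x :
  positive (lift_weight x) <-> forall i, 0 < heval (project_hyp (normal c (inr i))) x.
Proof.
split=> [/forallP pos i | pos]; first by rewrite heval_project dotC dot_delta.
by apply/forallP => i; have := pos i; rewrite heval_project dotC dot_delta.
Qed.

Lemma face_le_positive x y : positive (lift_weight x) -> face_le hyps x y ->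
  positive (lift_weight y).
Proof.
rewrite !positive_liftP => pos xy i; have := xy _ (mem_hyps (labels_axis i)).
rewrite -sgr_gt0; case=> [/eqP | <-]; last by rewrite sgr_gt0.
by rewrite sgr_eq0 gt_eqF.
Qed.

Lemma positive_signs x y : signs hyps x = signs hyps y ->
  positive (lift_weight x) -> positive (lift_weight y).
Proof.
move=> /signsP xy; rewrite !positive_liftP => pos i.
by rewrite -sgr_gt0 -xy ?sgr_gt0 // mem_hyps ?labels_axis.
Qed.

(** The order of an incomparable pair is the sign of one of the forms, and passing to the closure
    can at worst turn a strict comparison into a tie; a comparable pair is ordered alike at all
    positive weights. *)
Lemma order_face_le x y a b : face_le hyps x y -> positive (lift_weight x) ->
  positive (lift_weight y) -> a \in E -> b \in E ->
  W (lift_weight y) a <= W (lift_weight y) b -> W (lift_weight x) a <= W (lift_weight x) b.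
Proof.
move=> xy posx posy Ea Eb; have [-> // | ab] := eqVneq a b.
have ne_c : c b != c a by apply: contraNneq ab => /cost_inj->.
case: (boolP (incomparable a b)) => [inc | ]; last first.
  rewrite negbK => /orP[le_ab _ | le_ba]; first exact: dot_leqq.
  by rewrite leNgt dot_leqq_lt.
have sgle v : project_hyp v \in hyps ->
    Num.sg (dot v (lift_weight x)) = 0 \/
    Num.sg (dot v (lift_weight x)) = Num.sg (dot v (lift_weight y)).
  by move=> /xy; rewrite !heval_project.
rewrite -(subr_le0 (W (lift_weight x) b)) -(subr_le0 (W (lift_weight y) b)) -!dotBr.
case: (pair_in_labels Ea Eb inc) => /mem_hyps /sgle; rewrite /= ![dot (_ - _) _]dotC.
  by rewrite -(sgr_le0 (dot (lift_weight x) _)) -(sgr_le0 (dot (lift_weight y) _)) => -[-> | ->].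
have opp v : dot v (c a - c b) = - dot v (c b - c a) by rewrite -dotNr opprB.
rewrite !opp !oppr_le0.
by rewrite -(sgr_ge0 (dot (lift_weight x) _)) -(sgr_ge0 (dot (lift_weight y) _)) => -[-> | ->].
Qed.

Lemma equal_weights_label x a b : positive (lift_weight x) -> a \in E -> b \in E -> a != b ->
  W (lift_weight x) a = W (lift_weight x) b ->
  exists h, [/\ h \in labels, h = inl (a, b) \/ h = inl (b, a)
              & heval (project_hyp (normal c h)) x = 0].
Proof.
move=> posx Ea Eb ab eq_ab.
have ne_c e f : e \in E -> f \in E -> e != f -> c e != c f.
  by move=> Ee Ef; apply: contraNneq => /cost_inj->.
have inc : incomparable a b.
  apply/negP => /orP[] le_ab; have := dot_leqq_lt posx le_ab; rewrite eq_ab ltxx.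
    by move=> /(_ (ne_c a b Ea Eb ab)).
  by move=> /(_ (ne_c b a Eb Ea _)); rewrite eq_sym ab => /(_ isT).
case: (pair_in_labels Ea Eb inc) => hl.
  by exists (inl (a, b)); split=> //; [left | rewrite hevalBE eq_ab subrr].
by exists (inl (b, a)); split=> //; [right | rewrite hevalBE eq_ab subrr].
Qed.

Lemma off_hyps_inj x : positive (lift_weight x) -> off_hyps hyps x ->
  {in E &, injective (fun e => W (lift_weight x) e)}.
Proof.
move=> posx offx a b Ea Eb eq_ab; apply/eqP; apply: contraT => ab.
have [h [hl _ hx]] := equal_weights_label posx Ea Eb ab eq_ab.
by have := offx _ (mem_hyps hl); rewrite hx eqxx.
Qed.

Lemma optimal_face_le x y T : face_le hyps x y -> positive (lift_weight x) ->
  positive (lift_weight y) -> weighted_sum_optimal E c (lift_weight y) T ->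
  weighted_sum_optimal E c (lift_weight x) T.
Proof.
move=> xy posx posy opt; have [stT _] := opt; have [sTE _ _] := stT.
apply: locally_optimal => // a b Ta Eb NTb stTab.
apply: order_face_le xy posx posy _ Eb (optimal_swap opt Ta NTb stTab).
exact: (fintype.subsetP sTE).
Qed.

(** * Extreme supported points and generic weights *)

Lemma optimal_lt l T S : {in E &, injective (fun e => W l e)} ->
  weighted_sum_optimal E c l T -> spanning_tree E S -> tree_cost c S != tree_cost c T ->
  dot l (tree_cost c T) < dot l (tree_cost c S).
Proof.
move=> inj opt stS ne; rewrite lt_neqAle opt.2 // andbT.
apply: contraNneq ne => eq_TS; rewrite (optimal_unique simpE inj opt (_ : _ _ _ _ S)) //.
by split=> // S' stS'; rewrite -eq_TS opt.2.
Qed.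

Lemma optimal_Y_exN l T : positive l -> {in E &, injective (fun e => W l e)} ->
  weighted_sum_optimal E c l T -> Y_exN E c (tree_cost c T).
Proof.
move=> posl inj opt; have [stT _] := opt.
have minY z : image_set E c z -> z != tree_cost c T -> dot l (tree_cost c T) < dot l z.
  by move=> [S stS ->]; apply: optimal_lt.
have minY' z : image_set E c z -> dot l (tree_cost c T) <= dot l z.
  by move=> [S stS ->]; apply: opt.2.
split; first exists T => //.
  split; last by exists l.
  split=> // S stS [le_ST /eqP ne_ST].
  by have := opt.2 S stS; rewrite leNgt dot_leqq_lt.
(* A convex combination has at least the minimal value, and attains it only if every term with
   nonzero coefficient does; hence the minimizer is unique on the hull too. *)
have hull_ge u : convex_hull (image_set E c) u ->
    dot l (tree_cost c T) <= dot l u /\ (dot l u = dot l (tree_cost c T) -> u = tree_cost c T).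
  move=> [k [a [z [a_ge0 suma Yz ->]]]].
  have -> : dot l (\sum_i a i *: z i) =
      dot l (tree_cost c T) + \sum_i a i * (dot l (z i) - dot l (tree_cost c T)).
    rewrite dot_sumr (eq_bigr (fun i => a i * dot l (tree_cost c T)
      + a i * (dot l (z i) - dot l (tree_cost c T)))); last first.
      by move=> i _; rewrite dotZr; ring.
    by rewrite big_split /= -mulr_suml suma mul1r.
  have term_ge0 i : 0 <= a i * (dot l (z i) - dot l (tree_cost c T)).
    by rewrite mulr_ge0 // subr_ge0 minY'.
  split; first by rewrite lerDl sumr_ge0.
  move=> /eqP; rewrite -subr_eq0 addrC addKr psumr_eq0 // => /allP zero.
  rewrite (eq_bigr (fun i => a i *: tree_cost c T)); last first.
    move=> i _; have := zero i (mem_index_enum _); rewrite mulf_eq0 => /orP[/eqP->|].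
      by rewrite !scale0r.
    rewrite subr_eq0; have [-> // | ne] := eqVneq (z i) (tree_cost c T).
    by rewrite gt_eqF // minY.
  by rewrite -scaler_suml suma scale1r.
split.
  exists 1%N, (fun=> 1), (fun=> tree_cost c T); split=> //.
  - by rewrite big_ord_recl big_ord0 addr0.
  - by move=> _; exists T.
  by rewrite big_ord_recl big_ord0 addr0 scale1r.
move=> u v t /hull_ge[ge_u eq_u] /hull_ge[ge_v eq_v] /andP[t_gt0 t_lt1] def_y.
have := congr1 (dot l) def_y; rewrite dotDr !dotZr => eq_l.
by split; [apply: eq_u | apply: eq_v]; nra.
Qed.

(* An extreme point is exposed, and the exposing functional can be added, with
   a small factor, to a weight supporting the point. *)
Lemma Y_exN_exposed y : Y_exN E c y -> exists l, [/\ positive l, \sum_i l 0 i = 1,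
  exists2 T, spanning_tree E T & y = tree_cost c T
  & forall S, spanning_tree E S -> tree_cost c S != y -> dot l y < dot l (tree_cost c S)].
Proof.
move=> [[T [[stT _] [l0 pos0 [_ opt0]]] def_y] [_ extr]].
pose trees := [seq F <- enum {set {set V}} | `[< spanning_tree E F >] & tree_cost c F != y].
have mem_trees S : spanning_tree E S -> tree_cost c S != y -> S \in trees.
  by move=> stS ne; rewrite mem_filter ne andbT mem_enum; apply/andP; split=> //; apply/asboolP.
have treesP S : S \in trees -> spanning_tree E S /\ tree_cost c S != y.
  by rewrite mem_filter => /andP[/andP[/asboolP ? ?]].
pose vs := [seq tree_cost c F - y | F <- trees].
(* Either some [u] is strictly smaller at [y] than at all other tree costs, or a nonnegative
   relation among the differences makes [y] a convex combination of other points, against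
   extremality. *)
have [[u pos_u] | [a [a_ge0 [i ilt ai_gt0] sum0]]] := gordan vs.
  pose forms : seq (hyp R d.+1) :=
    [seq (delta_mx 0 i, 0) | i <- enum 'I_d.+1].
  have [e /andP[e_gt0 _] He] := small_step forms l0 (l0 + u).
  pose l1 := l0 + e *: (l0 + u - l0).
  have pos1 : positive l1.
    apply/forallP => i; have := He e; rewrite e_gt0 lexx.
    move=> /(_ isT _ (map_f _ (mem_enum _ i))); rewrite /heval /= !addr0 !(dotC (delta_mx _ _)).
    rewrite !dot_delta gt_eqF ?(forallP pos0) // -/l1 => sg1.
    by rewrite -sgr_gt0 sg1 sgr_gt0 (forallP pos0).
  have sum1 : 0 < \sum_i l1 0 i.
    rewrite (bigD1 ord0) //= ltr_wpDr ?(forallP pos1) // sumr_ge0 // => i _.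
    exact/ltW/(forallP pos1).
  exists ((\sum_i l1 0 i)^-1 *: l1); split.
  - by apply/forallP => i; rewrite mxE mulr_gt0 ?invr_gt0 ?(forallP pos1).
  - rewrite (eq_bigr (fun i => (\sum_i l1 0 i)^-1 * l1 0 i)); last by move=> i _; rewrite mxE.
    by rewrite -mulr_sumr mulVf // gt_eqF.
  - by exists T.
  move=> S stS ne; rewrite !dotZl ltr_pM2l ?invr_gt0 //.
  have := pos_u _ (map_f (fun S => tree_cost c S - y) (mem_trees S stS ne)).
  rewrite dotBr subr_gt0 /l1 [l0 + u]addrC addrK !dotDl !dotZl => lt_u.
  by rewrite ler_ltD // ?ltr_pM2l // def_y opt0.
have size_vs : size vs = size trees by rewrite size_map.
pose s := \sum_(j < size vs) a j.
have ai_le : a i <= s.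
  by rewrite /s (bigD1 (Ordinal ilt)) //= lerDl sumr_ge0.
have s_gt0 : 0 < s by apply: lt_le_trans ai_le.
(* Half the share of [z i] in the combination is split off; halving keeps [t] below 1 even if [z i]
   has the whole weight. The coefficients [b] below are what remains, rescaled to sum 1. *)
pose t := a i / s / 2.
have t_gt0 : 0 < t by rewrite !divr_gt0.
have t_le : t <= 2^-1 by rewrite /t ler_piMl ?invr_ge0 // ler_pdivrMr // mul1r.
have t_lt1 : t < 1 by apply: le_lt_trans t_le _; rewrite invf_lt1 ?ltr1n.
pose z (j : nat) := tree_cost c (nth finset.set0 trees j).
have Yz j : (j < size vs)%N -> image_set E c (z j) /\ z j != y.
  rewrite size_vs => jlt; have [stS ne] := treesP _ (mem_nth finset.set0 jlt).
  by split=> //; exists (nth finset.set0 trees j).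
have def_sy : \sum_(j < size vs) a j *: z j = s *: y.
  apply/eqP; rewrite -subr_eq0 scaler_suml -sumrB -[X in _ == X]sum0; apply/eqP.
  apply: eq_bigr => j _; rewrite (nth_map finset.set0) ?scalerBr //.
  by rewrite -size_vs.
pose b (j : 'I_(size vs)) := (a j / s - (j == i :> nat)%:R * t) / (1 - t).
pose w := \sum_j b j *: z j.
have hull_z j : (j < size vs)%N -> convex_hull (image_set E c) (z j).
  move=> jlt; have [Yzj _] := Yz j jlt.
  exists 1%N, (fun=> 1), (fun=> z j); split=> //.
    by rewrite big_ord_recl big_ord0 addr0.
  by rewrite big_ord_recl big_ord0 addr0 scale1r.
have hull_w : convex_hull (image_set E c) w.
  exists (size vs), b, (fun j => z j); split=> //.
  - move=> j; rewrite divr_ge0 ?subr_ge0 ?(ltW t_lt1) //.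
    case: eqVneq => [-> | _]; last by rewrite mul0r divr_ge0 // ltW.
    by rewrite mul1r /t ler_piMr ?divr_ge0 ?(ltW s_gt0) // invf_le1 ?ler1n.
  - rewrite -mulr_suml sumrB -mulr_suml -/s divff ?gt_eqF //.
    rewrite (bigD1 (Ordinal ilt)) //= eqxx mul1r big1 ?addr0 ?divff ?subr_eq0 ?gt_eqF // => j ne.
    by rewrite (negPf (_ : j != i :> nat)) ?mul0r.
  - by move=> j; apply: (Yz j _).1.
have def_y' : y = t *: z i + (1 - t) *: w.
  rewrite /w [X in _ + X]scaler_sumr (eq_bigr (fun j : 'I__ => s^-1 *: (a j *: z j)
      - (j == i :> nat)%:R *: (t *: z j))); last first.
    move=> j _; rewrite /b !scalerA -scalerBl; congr (_ *: _).
    by rewrite [s^-1 * _]mulrC mulrCA divff ?mulr1 // subr_eq0 gt_eqF.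
  rewrite sumrB -scaler_sumr def_sy scalerA mulVf ?gt_eqF // scale1r.
  rewrite (bigD1 (Ordinal ilt)) //= eqxx scale1r big1 ?addr0 => [|j ne]; first by rewrite addrC subrK.
  by rewrite (negPf (_ : j != i :> nat)) ?scale0r.
have [zy _] := extr (z i) w t (hull_z i ilt) hull_w (introT andP (conj t_gt0 t_lt1)) def_y'.
by have [_ /eqP] := Yz i ilt.
Qed.

Lemma exists_generic_weight l : positive l -> \sum_i l 0 i = 1 ->
  forall gs : seq (hyp R d), {in gs, forall g, heval g (project_weight l) != 0} ->
  exists x, [/\ off_hyps hyps x, positive (lift_weight x)
    & {in gs, forall g, Num.sg (heval g x) = Num.sg (heval g (project_weight l))}].
Proof.
move=> posl suml gs gs0; have [|x offx lex] := @generic_point _ _ (hyps ++ gs) (project_weight l).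
  move=> h; rewrite mem_cat => /orP[/mapP[h' h'l ->]|/gs0 h0]; last by exists (project_weight l).
  exact/heval_nonconst/hyps_neq0.
have le_hyps : face_le hyps (project_weight l) x by move=> h hin; apply: lex; rewrite mem_cat hin.
exists x; split.
- by move=> h hin; apply: offx; rewrite mem_cat hin.
- by apply: face_le_positive le_hyps; rewrite project_weightK.
move=> g gin; have [|/eqP|//] := lex g; first by rewrite mem_cat gin orbT.
by rewrite sgr_eq0 (negPf (gs0 g gin)).
Qed.

Lemma Y_exN_generic y : Y_exN E c y -> exists x T, [/\ off_hyps hyps x,
  positive (lift_weight x), weighted_sum_optimal E c (lift_weight x) T & y = tree_cost c T].
Proof.
move=> /Y_exN_exposed[l [posl suml [T stT def_y] exp_y]].
pose costs := [seq tree_cost c F | F <- enum {set {set V}} & `[< spanning_tree E F >]].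
(* That [y] is the unique minimum amounts to finitely many strict inequalities, which survive the
   perturbation to a generic weight. *)
pose gs := [seq project_hyp (z - y) | z <- costs & z != y].
have evalE z x : heval (project_hyp (z - y)) x = dot (lift_weight x) z - dot (lift_weight x) y.
  by rewrite heval_project dotC dotBr.
have gs_gt0 z : z \in [seq z <- costs | z != y] ->
    0 < heval (project_hyp (z - y)) (project_weight l).
  rewrite mem_filter => /andP[ne /mapP[S]]; rewrite mem_filter => /andP[/asboolP stS _] def_z.
  by rewrite evalE project_weightK // subr_gt0 def_z exp_y // -def_z.
have [|x [offx posx gsx]] := exists_generic_weight posl suml (gs := gs).
  by move=> g /mapP[z zin ->]; rewrite gt_eqF // gs_gt0.
exists x, T; split=> //; split=> // S stS; rewrite -def_y.
have [-> // | ne] := eqVneq (tree_cost c S) y.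
have zin : tree_cost c S \in [seq z <- costs | z != y].
  rewrite mem_filter ne; apply: map_f; rewrite mem_filter mem_enum; apply/andP; split=> //.
  exact/asboolP.
rewrite -subr_ge0 -evalE ltW // -sgr_gt0 gsx ?sgr_gt0 ?gs_gt0 //.
exact: (map_f (fun z => project_hyp (z - y))).
Qed.

(** * From the cells to the weight set decomposition *)

Section Decomposition.
Variables (A : seq (face_rec R d)).
Hypothesis A_hyps : describes_arrangement hyps A.

Local Notation pt k := (fr_point (nth (face_rec0 R d) A k)).

Definition relevant_cell k : Prop :=
  [/\ (k < size A)%N, off_hyps hyps (pt k) & positive (lift_weight (pt k))].

Lemma cell_at x : off_hyps hyps x -> positive (lift_weight x) ->
  exists2 k, relevant_cell k & signs hyps (pt k) = signs hyps x.
Proof.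
move=> offx posx; have [k klt kx] := face_index A_hyps x.
exists k => //; split=> //; first exact: off_hyps_signs offx.
exact: positive_signs posx.
Qed.

Lemma exists_relevant_cell : exists k, relevant_cell k.
Proof.
pose l : 'rV[R]_d.+1 := \row_i (d.+1%:R)^-1.
have posl : positive l by apply/forallP => i; rewrite mxE invr_gt0 ltr0n.
have suml : \sum_i l 0 i = 1.
  rewrite (eq_bigr (fun=> d.+1%:R^-1)) => [|i _]; last by rewrite mxE.
  by rewrite sumr_const card_ord -[LHS]mulr_natl divff // pnatr_eq0.
have [|x [offx posx _]] := exists_generic_weight posl suml (gs := [::]) => //.
by have [k relk _] := cell_at offx posx; exists k.
Qed.

(* What remains of the correctness of the algorithm once the search is known to
   reach all relevant cells and to find a minimum spanning tree for each. *)
Lemma decomposition_correct (es : seq ('rV[R]_d.+1 * stored R d)) :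
  uniq [seq en.1 | en <- es] ->
  (forall en, en \in es -> en.2.2 != [::] /\ forall k, k \in en.2.2 -> relevant_cell k /\
     exists2 T, weighted_sum_optimal E c (lift_weight (pt k)) T & en.1 = tree_cost c T) ->
  (forall k, relevant_cell k -> exists2 en, en \in es & k \in en.2.2) ->
  computes_decomposition E c (Output hyps A es).
Proof.
move=> uniq_keys sound complete.
have keyY : [set` [seq en.1 | en <- es]]%classic = Y_exN E c.
  apply/seteqP; split=> y /=.
    move=> /mapP[en /sound[ks0 ks_ok] ->]; case: en.2.2 ks0 ks_ok => // k ks _.
    case/(_ k (mem_head _ _)) => [[klt offk posk] [T opt ->]].
    exact: optimal_Y_exN posk (off_hyps_inj posk offk) opt.
  move=> /Y_exN_generic[x [T [offx posx opt def_y]]].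
  have [k relk kx] := cell_at offx posx; have [klt offk posk] := relk.
  have [en enes ken] := complete k relk; have [_ /(_ k ken)[_ [S optS def_en]]] := sound en enes.
  have optS' : weighted_sum_optimal E c (lift_weight x) S.
    by apply: optimal_face_le optS => //; apply/signs_face_le/esym.
  by rewrite def_y (optimal_unique simpE (off_hyps_inj posx offx) opt optS') -def_en map_f.
have mem_key en : en \in es -> Y_exN E c en.1 by move=> enes; rewrite -keyY /= map_f.
have Y_tree z : Y_exN E c z -> exists2 T, spanning_tree E T & z = tree_cost c T.
  by case=> [[T [[stT _] _] ->] _]; exists T.
split=> //=.
- move=> en enes; have [ks0 ks_ok] := sound en enes; split=> [k kks|].
    have [[klt offk _] _] := ks_ok k kks; split=> //.
    exact/(dim_cell (hyps_proper) A_hyps klt).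
  apply/seteqP; split=> l /=.
    move=> [k /= kks [[posl suml] /(closure_face_at _ _ _)lek]]; split=> // z /Y_tree[S stS ->].
    have [[_ _ posk] [T opt ->]] := ks_ok k kks.
    have posl' : positive (lift_weight (project_weight l)) by rewrite project_weightK.
    by have [_] := optimal_face_le lek posl' posk opt; rewrite project_weightK //; apply.
  move=> [[posl suml] minl].
  have [k0 k0ks] : exists k, k \in en.2.2.
    by case: en.2.2 ks0 => // k ks _; exists k; rewrite mem_head.
  have [[k0lt off0 pos0] [T0 opt0 def_y]] := ks_ok k0 k0ks.
  (* A short step from [l] towards the interior point of a cell of this entry reaches a generic [x],
     whose cell, possibly other than [k0], has [l] in its closure. The tree [T] of that cell has its
     cost in [Y_exN], so [T0] is no worse than [T] at [l] and at [pt k0], hence at [x]; by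
     uniqueness the two trees agree. *)
  have [e /andP[e_gt0 e_le1] He] := small_step hyps (project_weight l) (pt k0).
  pose x := project_weight l + e *: (pt k0 - project_weight l).
  have {}He h : h \in hyps -> Num.sg (heval h x) =
      if heval h (project_weight l) == 0 then Num.sg (heval h (pt k0))
      else Num.sg (heval h (project_weight l)).
    by move=> hh; apply: He; rewrite ?e_gt0 ?lexx.
  have offx : off_hyps hyps x.
    move=> h hh; rewrite -sgr_eq0 He //; have := off0 h hh.
    by case: (eqVneq (heval h (project_weight l)) 0); rewrite sgr_eq0.
  have lex : face_le hyps (project_weight l) x.
    move=> h hh; rewrite He //; case: (eqVneq (heval h (project_weight l)) 0) => [->|_].
      by left; rewrite sgr0.
    by right.
  have posx : positive (lift_weight x).
    by apply: face_le_positive lex; rewrite project_weightK.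
  have [k relk kx] := cell_at offx posx; have [klt offk posk] := relk.
  have [en' en'es ken'] := complete k relk.
  have [_ /(_ k ken')[_ [T optT def_y']]] := sound en' en'es.
  have optT' : weighted_sum_optimal E c (lift_weight x) T.
    by apply: optimal_face_le optT => //; apply/signs_face_le/esym.
  have optT0 : weighted_sum_optimal E c (lift_weight x) T0.
    split=> [|S stS]; first by case: opt0.
    apply: (@le_trans _ _ (dot (lift_weight x) (tree_cost c T))); last exact: optT'.2.
    rewrite -def_y -def_y' lift_weight_line project_weightK // !dotDl !dotZl lerD //.
      by rewrite ler_wpM2l ?subr_ge0 // minl //; apply: mem_key.
    rewrite ler_wpM2l ?(ltW e_gt0) // def_y def_y' opt0.2 //.
    by case: optT.
  have eq_key : en'.1 = en.1.
    by rewrite def_y def_y' (optimal_unique simpE (off_hyps_inj posx offx) optT' optT0).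
  have eq_en : en' = en.
    move: uniq_keys en'es enes eq_key; move: (es) => es'.
    elim: es' => //= e1 es' IH /andP[Ne1 /IH{}IH]; rewrite !inE.
    case/predU1P => [->|en'es]; case/predU1P => [->|enes] //; last exact: IH.
      by move=> eq_key; case/mapP: Ne1; exists en.
    by move=> eq_key; case/mapP: Ne1; exists en'.
  exists k; first by rewrite /= -eq_en.
  split=> //; apply/closure_face_at; apply: face_le_signs lex => //.
apply/seteqP; split=> l /=; last by move=> [y _ []].
move=> [posl suml]; have [k relk] := exists_relevant_cell.
have [en enes _] := complete k relk.
have es0 : [seq en.1 | en <- es] != [::] by case: (es) enes.
have [y yin miny] := seq_argmin (fun y => dot l y) es0.
by exists y; [rewrite -keyY | split=> // z; rewrite -keyY => /miny].
Qed.

(** * Breadth-first search *)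

Section Search.
Variable DT : forall V : finType, dynamic_forest V.
Hypothesis conE : connected_graph E.
Implicit Types (st : bfs_state R d DT V) (D : df (DT V)) (y : 'rV[R]_d.+1).

Local Notation dim k := (fr_dim (nth (face_rec0 R d) A k)).
Local Notation sup k := (fr_sup (nth (face_rec0 R d) A k)).
Local Notation adjacency := (incidence_graph A).1.

Definition mst_of k (Dy : df (DT V) * 'rV[R]_d.+1) : Prop :=
  weighted_sum_optimal E c (lift_weight (pt k)) (df_edges Dy.1) /\
  Dy.2 = tree_cost c (df_edges Dy.1).

Lemma adjacencyP k k' j : (k', j) \in nth [::] adjacency k -> exists i,
  [/\ (i < size A)%N, (dim i).+1 = d, positive (lift_weight (pt i)),
    fr_hyp (nth (face_rec0 R d) A i) = j & k \in sup i /\ k' \in sup i].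
Proof.
have [mem _ _] := incidence_graphP A.
case/mem=> f flt [/andP[/eqP dimf posf] eq_j sup_f]; exists f; split=> //.
by case: sup_f => ->; rewrite !inE !eqxx ?orbT.
Qed.

(** By closure the old tree is optimal on the facet. Only the two edges of the wall are tied there,
    as the facet lies in no second hyperplane; all other comparisons are strict and persist into the
    new cell. *)
Lemma cycle_test_mst k k' j D y : (k', j) \in nth [::] adjacency k ->
  relevant_cell k -> mst_of k (D, y) -> relevant_cell k' /\
  mst_of k' (cycle_test c (lift_weight (pt k')) (nth (inr ord0) labels j) D y).1.
Proof.
case/adjacencyP=> f [flt dimf posf eq_j [kf k'f]] [klt offk posk] [/= opt def_y].
have proper := hyps_proper.
have [wall_in wall0 only0] := dim_facet proper A_hyps flt dimf.
have [_ _ lek] := (mem_sup A_hyps k flt).1 kf.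
have [k'lt dimk' lek'] := (mem_sup A_hyps k' flt).1 k'f.
have posk' := face_le_positive posf lek'.
have relk' : relevant_cell k'.
  split=> //; apply/(dim_cell proper A_hyps k'lt).
  by rewrite dimk'.
split=> //; set l' := lift_weight (pt k').
have jlt : (j < size labels)%N.
  rewrite -(size_map (fun h => project_hyp (normal c h))) -eq_j.
  by have [_ _ _ _ /(_ f flt dimf)[]] := A_hyps.
rewrite eq_j (nth_map (inr ord0)) // in wall0 only0.
have labelj := mem_nth (inr ord0) jlt; set h := nth (inr ord0) labels j in wall0 only0 labelj *.
have opt0 := optimal_face_le lek posf posk opt.
case def_h: h labelj wall0 only0 => [[e e']|i] labelj wall0 only0; last first.
  by have := (positive_liftP (pt f)).1 posf i; rewrite wall0 ltxx.
have [Ee Ee' inc _] := labels_pair labelj; have ne := incomparable_neq inc.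
rewrite hevalBE in wall0; have {}wall0 := subr0_eq wall0.
have mono a b : a \in E -> b \in E -> (a != b) -> W (lift_weight (pt f)) a <= W (lift_weight (pt f)) b ->
    W l' a <= W l' b \/ ((a, b) = (e, e') \/ (a, b) = (e', e)).
  move=> Ea Eb ab; rewrite le_eqVlt => /predU1P[eq_ab | lt_ab].
    have [h' [h'l def_h' h'0]] := equal_weights_label posf Ea Eb ab eq_ab.
    have eq_h : h' = inl (e, e').
      by apply: hyps_inj => //; congr hyperplane; apply: only0 => //; apply: mem_hyps.
    by right; case: def_h' => eq_h'; rewrite eq_h' in eq_h; case: eq_h => -> ->; [left | right].
  left; rewrite leNgt; apply: contraL lt_ab => lt_ba; rewrite -leNgt.
  by apply: order_face_le lek' posf posk' Eb Ea (ltW lt_ba).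
rewrite /cycle_test /=; case: ltP => [lt_e | le_e].
  apply: (swap_testP simpE opt0 def_y Ee' Ee); rewrite 1?eq_sym // => a b Ea Eb nswap ab le_ab.
  case: (mono a b Ea Eb ab le_ab) => [//|[[-> ->]|eq_ab]]; first exact: ltW.
  by rewrite eq_ab eqxx in nswap.
apply: (swap_testP simpE opt0 def_y Ee Ee') => // a b Ea Eb nswap ab le_ab.
case: (mono a b Ea Eb ab le_ab) => [//|[eq_ab|[-> ->]]] //.
by rewrite eq_ab eqxx in nswap.
Qed.

(** [List.In] is used for the queue because forests carry no decidable equality. [inv_found] pays
    for each dictionary entry with a visited cell, which bounds the size of the dictionary. *)
Record search_inv st : Prop := SearchInv {
  inv_size : size (visited st) = size A;
  inv_visited : forall k, nth false (visited st) k -> relevant_cell k;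
  inv_queue : forall q, List.In q (queue st) -> nth false (visited st) q.1 /\ mst_of q.1 q.2;
  inv_balanced : balanced (@vec_lt R d) (found st);
  inv_sound : forall en, en \in inorder (found st) -> en.2.2 != [::] /\
    forall k, k \in en.2.2 -> nth false (visited st) k /\
      exists2 T, weighted_sum_optimal E c (lift_weight (pt k)) T & en.1 = tree_cost c T;
  inv_complete : forall k, nth false (visited st) k ->
    exists2 en, en \in inorder (found st) & k \in en.2.2;
  inv_found : (size (inorder (found st)) + count negb (visited st) <= size A)%N
}.

(** The work still to come: a cell counts one unit plus its degree, whether unvisited or waiting,
    until it leaves the queue. *)
Definition potential st : nat :=
  (\sum_(i < size A) (if nth false (visited st) i then 0 else (degree adjacency i).+1) +
   \sum_(q <- queue st) (degree adjacency q.1).+1)%N.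

(** The measure matched against the fuel; it drops by one with every cell taken from the queue. *)
Definition pending st : nat := (count negb (visited st) + size (queue st))%N.

Definition queued st : seq nat := [seq q.1 | q <- queue st].

Definition discover st k (Dy : df (DT V) * 'rV[R]_d.+1) : bfs_state R d DT V :=
  BfsState (set_nth false (visited st) k true) (rcons (queue st) (k, Dy))
    (upsert (@vcmp R d) Dy.2 (record_cell (lift_weight (pt k)) k) (found st)).1.

(** Discovery turns an unvisited cell into a waiting one, so neither measure changes; only removal
    from the queue lowers them. *)
Lemma discoverP st k Dy : search_inv st -> relevant_cell k -> ~~ nth false (visited st) k ->
  mst_of k Dy -> let st' := discover st k Dy in
  [/\ search_inv st', potential st' = potential st, pending st' = pending st
    & (forall i, nth false (visited st') i = (i == k) || nth false (visited st) i)].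
Proof.
case=> sizeV relV inQ bal sound complete found_size relk Nk mst /=.
have [klt _ _] := relk.
have nthV i : nth false (set_nth false (visited st) k true) i = (i == k) || nth false (visited st) i.
  by rewrite nth_set_nth /=; case: eqP.
have [bal' [s1 [s2 [o [def_s def_s' _ _]]]]] :=
  upsertP (@vec_lt_trans R d) (@vcmpP R d) Dy.2 (record_cell (lift_weight (pt k)) k) bal.
have countV : (count negb (set_nth false (visited st) k true)).+1 = count negb (visited st).
  have k_unvisited : (0 < count negb (visited st))%N.
    by rewrite -has_count; apply/(has_nthP false); exists k; rewrite ?sizeV.
  rewrite count_set_nth_ltn ?sizeV // (negbTE Nk) addn0 subn1 prednK //.
split=> //; last 2 first.
- rewrite /potential /= -cats1 big_cat big_seq1 /= addnA addnAC; congr (_ + _)%N.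
  rewrite (bigD1 (Ordinal klt)) //= nthV eqxx add0n [in RHS](bigD1 (Ordinal klt)) //= (negbTE Nk).
  rewrite addnC; congr (_ + _)%N; apply: eq_bigr => i ne.
  by rewrite nthV (negbTE (_ : i != k :> nat)).
- by rewrite /pending /= size_rcons -countV addSnnS.
split=> //=.
- by rewrite size_set_nth sizeV; apply/maxn_idPr.
- by move=> i; rewrite nthV => /predU1P[-> // | /relV].
- by move=> e /In_rcons[-> /= | /inQ[vis_e mst_e]]; rewrite nthV ?eqxx // vis_e orbT.
- move=> en; rewrite def_s' mem_cat inE => /or3P[ens1 | /eqP-> /= | ens2].
  + have [|en0 en_ok] := sound en; first by rewrite def_s mem_cat ens1.
    by split=> // i /en_ok[vis_i ?]; rewrite nthV vis_i orbT.
  + have [opt def_y] := mst.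
    have new i : i = k -> nth false (set_nth false (visited st) k true) i /\
        exists2 T, weighted_sum_optimal E c (lift_weight (pt i)) T & Dy.2 = tree_cost c T.
      by move=> ->; rewrite nthV eqxx; split=> //; exists (df_edges Dy.1).
    case: o def_s {def_s'} => [[l ks]|] def_s /=; last by split=> // i; rewrite inE => /eqP/new.
    split=> // i; rewrite inE => /predU1P[/new // | iks].
    have [|_ /(_ i iks)[vis_i ?]] := sound (Dy.2, (l, ks)).
      by rewrite def_s mem_cat mem_head orbT.
    by rewrite nthV vis_i orbT.
  have [|en0 en_ok] := sound en.
    by rewrite def_s mem_cat; case: (o) => [?|]; rewrite ?inE ens2 !orbT.
  by split=> // i /en_ok[vis_i ?]; rewrite nthV vis_i orbT.
- move=> i; rewrite nthV => /predU1P[-> | /complete[en enin ien]].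
    exists (Dy.2, record_cell (lift_weight (pt k)) k o).
      by rewrite def_s' mem_cat mem_head orbT.
    by case: (o) => [[l ks]|] /=; rewrite mem_head.
  move: enin; rewrite def_s mem_cat => /orP[ens1 | ].
    by exists en; rewrite // def_s' mem_cat ens1.
  case: o def_s def_s' => [[l ks]|] _ def_s'; last first.
    by move=> ens2; exists en; rewrite // def_s' mem_cat inE ens2 !orbT.
  rewrite inE => /predU1P[en_new | ens2]; last first.
    by exists en; rewrite // def_s' mem_cat inE ens2 !orbT.
  exists (Dy.2, record_cell (lift_weight (pt k)) k (Some (l, ks))).
    by rewrite def_s' mem_cat mem_head orbT.
  by rewrite en_new /= in ien; rewrite /= inE ien orbT.
move: found_size; rewrite -countV def_s def_s' !size_cat /=.
by case: (o) => [?|] /=; lia.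
Qed.

Definition ops_bound (L : nat) : Prop := forall (D : df (DT V)) e,
  [/\ (df_link D e).2 <= L, (df_cut D e).2 <= L, (df_mem D e).2 <= L & (df_joined D e).2 <= L]%N.

(** Of the [8 * d.+1], six parts belong to the cycle test and two to lifting the stored point to a
    weight. The last summand is the dictionary, with key comparisons of cost [2 * d.+1]. *)
Definition discovery_cost (L : nat) : nat :=
  (8 * d.+1 + 5 * L + 7 + (4 * d.+1 + 2) * (trunc_log 2 (size A).+1).+1)%N.

Lemma cycle_test_time L l h D y : ops_bound L ->
  ((cycle_test c l h D y).2 <= 6 * d.+1 + 5 * L + 1)%N.
Proof.
move=> opL; case: h => [[e f]|i] /=; last by lia.
have ef := swap_test_time c D y e f opL; have fe := swap_test_time c D y f e opL.
by case: ifP => _; lia.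
Qed.

Lemma discovery_upsert_time st k (Dy : df (DT V) * 'rV[R]_d.+1) : search_inv st ->
  ((upsert (@vcmp R d) Dy.2 (record_cell (lift_weight (pt k)) k) (found st)).2 <=
     (4 * d.+1 + 2) * (trunc_log 2 (size A).+1).+1 + 1)%N.
Proof.
move=> inv; apply: leq_trans (upsert_time (c := 2 * d.+1) _ _ _ (inv_balanced inv)) _ => //.
rewrite mulnA leq_add2r leq_mul2l ltnS leq_trunc_log ?orbT // ltnS.
by have := inv_found inv; apply: leq_trans; apply: leq_addr.
Qed.

Lemma visit_cons D y k j nbs st :
  let Dy := cycle_test c (lift_weight (pt k)) (nth (inr ord0) labels j) D y in
  let r := if nth false (visited st) k then (st, 1%N) else
    (discover st k Dy.1, (1 + ((1 + 2 * d.+1) + (1 + (Dy.2 +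
       ((upsert (@vcmp R d) Dy.1.2 (record_cell (lift_weight (pt k)) k) (found st)).2 + 1)))))%N) in
  visit c labels A D y ((k, j) :: nbs) st =
    ((visit c labels A D y nbs r.1).1, (1 + (r.2 + (visit c labels A D y nbs r.1).2))%N).
Proof. by rewrite /= /bind /=; case: (nth false (visited st) k). Qed.

Lemma visitP k0 D y nbs st : search_inv st -> relevant_cell k0 -> mst_of k0 (D, y) ->
  {subset nbs <= nth [::] adjacency k0} ->
  let r := visit c labels A D y nbs st in
  [/\ search_inv r.1,
      (forall k, nth false (visited st) k -> nth false (visited r.1) k) /\
        {subset queued st <= queued r.1},
      {in nbs, forall q, nth false (visited r.1) q.1},
      (forall k, nth false (visited r.1) k -> nth false (visited st) k \/ k \in queued r.1)
    & [/\ potential r.1 = potential st, pending r.1 = pending st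
        & forall L, ops_bound L -> (r.2 <= size nbs * (discovery_cost L).+1 + 1)%N]].
Proof.
move=> + rel0 mst0; elim: nbs st => [|[k j] nbs IH] st inv sub.
  split=> //=; [by split | by move=> k; left].
have sub' : {subset nbs <= nth [::] adjacency k0}.
  by move=> e enbs; apply: sub; rewrite inE enbs orbT.
rewrite visit_cons; set Dy := cycle_test _ _ _ _ _.
set up := (upsert _ _ _ _).2.
have [relk mstk] := cycle_test_mst (sub _ (mem_head _ _)) rel0 mst0.
case: ifPn => [vis_k | Nk] /=.
  have [inv' [mono sub_q] all_nbs new [pot pend time]] := IH st inv sub'.
  split=> //; last first.
    split=> // L /time le_time; rewrite mulSn.
    have cost_gt0 : (0 < discovery_cost L)%N by rewrite /discovery_cost addnS.
    by move: (size nbs * _)%N le_time => u le_time; lia.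
  by move=> e; rewrite inE => /predU1P[-> /= | /all_nbs //]; apply: mono.
have [inv1 pot1 pend1 vis1] := discoverP inv relk Nk mstk.
have [inv' [mono sub_q] all_nbs new [pot pend time]] := IH _ inv1 sub'.
have k_queued : k \in queued (visit c labels A D y nbs (discover st k Dy.1)).1.
  by apply: sub_q; rewrite /queued /= map_rcons mem_rcons mem_head.
split=> //.
- split=> [i vis_i | i iq]; first by apply: mono; rewrite vis1 vis_i orbT.
  by apply: sub_q; rewrite /queued /= map_rcons mem_rcons inE iq orbT.
- move=> e; rewrite inE => /predU1P[-> /= | /all_nbs //].
  by apply: mono; rewrite vis1 eqxx.
- move=> i /new[|]; last by right.
  by rewrite vis1 => /predU1P[-> | vis_i]; [right | left].
split; rewrite ?pot ?pend // => L opL; have := time L opL; rewrite [((size nbs).+1 * _)%N]mulSn.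
have := cycle_test_time (lift_weight (pt k)) (nth (inr ord0) labels j) D y opL.
have := discovery_upsert_time k Dy.1 inv; rewrite -/Dy -/up /discovery_cost.
by set u := (4 * d.+1 + 2)%N; move: (u * _)%N (size nbs * _)%N => v w; lia.
Qed.

(** Once the queue is empty, this says that the visited cells are closed under adjacency. *)
Definition closed st : Prop := forall k, nth false (visited st) k ->
  k \in queued st \/ forall q, q \in nth [::] adjacency k -> nth false (visited st) q.1.

Lemma bfsP fuel st : search_inv st -> closed st -> (pending st <= fuel)%N ->
  let r := bfs c labels A adjacency fuel st in
  [/\ search_inv r.1, queue r.1 = [::], closed r.1,
      (forall k, nth false (visited st) k -> nth false (visited r.1) k)
    & forall L, ops_bound L -> (r.2 <= potential st * (discovery_cost L + 3) + 1)%N].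
Proof.
elim: fuel st => [|fuel IH] st inv cl fuel_ok.
  have q0 : queue st = [::].
    by apply/size0nil; move: fuel_ok; rewrite /pending leqn0 addn_eq0 => /andP[_ /eqP].
  by split=> //= L _; apply: leq_addl.
rewrite [bfs _ _ _ _ _ _]/=; case def_q: (queue st) => [|[k [D y]] q].
  by split=> //= L _; apply: leq_addl.
pose st1 := BfsState (visited st) q (found st).
have inv1 : search_inv st1.
  case: inv => sizeV relV inQ bal sound complete found_size; split=> //= q' q'in.
  by apply: inQ; rewrite def_q; right.
have [vis_k mst_k] : nth false (visited st) k /\ mst_of k (D, y).
  by apply: (inv_queue inv (q := (k, (D, y)))); rewrite def_q; left.
have rel_k := inv_visited inv vis_k.
have [inv' [mono sub_q] all_nbs new [pot pend time]] :=
  visitP inv1 rel_k mst_k (fun q (h : q \in nth [::] adjacency k) => h).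
rewrite [bind _ _]/= -/st1; set st' := (visit _ _ _ _ _ _ _).1 in inv' mono sub_q all_nbs new pot pend *.
have pot_st : potential st = ((degree adjacency k).+1 + potential st')%N.
  by rewrite pot /potential def_q big_cons /= addnCA.
have pend_st : pending st = (pending st').+1 by rewrite pend /pending def_q /= addnS.
have cl' : closed st'.
  move=> i /new[vis_i | ]; last by left.
  have [|nbs_i] := cl i vis_i; last by right=> e /nbs_i/mono.
  rewrite /queued def_q inE => /predU1P[-> | iq]; last by left; apply: sub_q.
  by right=> e /all_nbs.
have [|inv'' q'' cl'' mono'' time''] := IH st' inv' cl'; first by rewrite -ltnS -pend_st.
split=> // [i vis_i | L opL]; first exact/mono''/mono.
have := time L opL; have := time'' L opL; rewrite pot_st /= -/st' -/(degree adjacency k).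
set U := discovery_cost L; set a := degree _ _; set b := potential _.
move=> t1 t2; apply: leq_trans (leq_add (leqnn 1) (leq_add t2 t1)) _.
by rewrite mulnDl; nia.
Qed.

(** The search starts with one cell in the queue; that cell is treated as a discovery from this
    empty state, so that [discoverP] covers it. *)
Definition initial_state : bfs_state R d DT V := BfsState (nseq (size A) false) [::] Leaf.

Lemma initial_inv : search_inv initial_state.
Proof.
have nth0 k : nth false (nseq (size A) false) k = false by rewrite nth_nseq if_same.
split=> //=; rewrite ?size_nseq //; try by move=> k; rewrite nth0.
  by split=> //; exists 0%N.
by rewrite add0n count_nseq mul1n.
Qed.

Lemma exploreP k0 : relevant_cell k0 ->
  let r := explore DT E c labels A adjacency k0 in
  computes_decomposition E c (Output hyps A (inorder r.1)) /\
  (size (inorder r.1) <= size A)%N /\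
  forall L, ops_bound L ->
    (r.2 <= (4 * d.+1 + 2) * #|E|.+1 ^ 2 + (df_empty (DT V)).2 + #|E| * (2 * L + d.+1 + 1)
       + 3 * size A * (discovery_cost L + 3) + size A + discovery_cost L + 2 * d.+1 + 6)%N.
Proof.
move=> rel0 r; set Dy := (kruskal DT E c (lift_weight (pt k0))).1.
have mst0 : mst_of k0 Dy by apply: kruskalP.
have N0 : ~~ nth false (visited initial_state) k0 by rewrite /= nth_nseq if_same.
have [inv1 pot1 pend1 vis1] := discoverP initial_inv rel0 N0 mst0.
set st1 := discover initial_state k0 Dy in inv1 pot1 pend1 vis1 *.
have vis_k0 : nth false (visited st1) k0 by rewrite vis1 eqxx.
have cl1 : closed st1.
  move=> k; rewrite vis1 /= nth_nseq if_same orbF => /eqP->; left.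
  by rewrite /queued /= mem_head.
have pend_le : (pending st1 <= size A)%N.
  by rewrite pend1 /pending /= addn0 count_nseq mul1n.
have [inv' q' cl' mono time] := bfsP inv1 cl1 pend_le.
set run := bfs _ _ _ _ _ _ in inv' q' cl' mono time; set st' := run.1 in inv' q' cl' mono.
have def_r : r.1 = found st' by [].
have def_time : r.2 = ((1 + 2 * d.+1) + ((kruskal DT E c (lift_weight (pt k0))).2 +
    ((upsert (@vcmp R d) Dy.2 (record_cell (lift_weight (pt k0)) k0) (found initial_state)).2 +
      ((size A).+1 + (1 + (run.2 + 1))))))%N by [].
rewrite def_r def_time {def_r def_time}.
have visited_all k : relevant_cell k -> nth false (visited st') k.
  have proper := hyps_proper.
  have axesP i : {in [seq project_hyp (normal c (inr i)) | i <- enum 'I_d.+1],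
      forall g, 0 < heval g (pt i)} <-> positive (lift_weight (pt i)).
    rewrite positive_liftP; split=> [pos j | pos g /mapP[j _ ->] //].
    by apply: pos; apply: map_f; rewrite mem_enum.
  move=> [klt offk /axesP posk]; have [k0lt off0 /axesP pos0] := rel0.
  (* With the coordinate hyperplanes as [G], the walk crosses only facets inside the weight set, and
     these are the ones entered in the incidence graph. *)
  apply: (cells_connected (P := fun i => nth false (visited st') i) proper A_hyps _ _
    (mono _ vis_k0) k0lt off0 pos0 klt offk posk).
    by move=> g /mapP[i _ ->]; apply/mem_hyps/labels_axis.
  move=> i k1 k2 ilt dimi /axesP posi k1i k2i vis_k1.
  have [l1 [l2 sup_i]] := facet_two_cells proper A_hyps ilt dimi.
  have [-> // | ne] := eqVneq k2 k1.
  have [mem _ _] := incidence_graphP A.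
  case: (cl' k1 vis_k1) => [|nbs]; first by rewrite /queued q'.
  apply: (nbs (k2, fr_hyp (nth (face_rec0 R d) A i))); apply/mem; exists i => //.
  split=> //; first by rewrite /relevant_facet dimi eqxx.
  move: k1i k2i ne; rewrite sup_i !inE.
  case/orP=> /eqP->; case/orP=> /eqP->; rewrite ?eqxx // => _; [left | right]; by [].
split; last split.
- apply: decomposition_correct.
  + have [sorted_keys _] := inv_balanced inv'.
    exact: sorted_uniq (@vec_lt_trans R d) (@vec_lt_irr R d) _ sorted_keys.
  + move=> en /(inv_sound inv')[ks0 ks_ok]; split=> // k /ks_ok[vis_k opt].
    by split=> //; apply: inv_visited vis_k.
  by move=> k /visited_all/(inv_complete inv').
- by apply: leq_trans (inv_found inv'); apply: leq_addr.
move=> L opL.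
have tk := kruskal_time E c (lift_weight (pt k0)) (L := L) (fun D e =>
  let: And4 hl _ _ hj := opL D e in conj hl hj).
have tu := discovery_upsert_time k0 Dy initial_inv.
(* One unit for each face, and twice the number of faces for the sum of the degrees. *)
have pot_le : (potential st1 <= 3 * size A)%N.
  have [_ deg _] := incidence_graphP A.
  rewrite pot1 /potential /= big_nil addn0 (eq_bigr (fun i : 'I_(size A) => 1 + degree adjacency i)%N).
    by rewrite big_split /= sum1_card card_ord mulSn leq_add2l deg.
  by move=> i _; rewrite nth_nseq if_same.
have tb := leq_trans (time L opL) (leq_add (leq_mul pot_le (leqnn _)) (leqnn 1)).
apply: leq_trans (leq_add (leqnn _) (leq_add tk (leq_add tu (leq_add (leqnn _)
  (leq_add (leqnn 1) (leq_add tb (leqnn 1))))))) _.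
set K1 := (_ * #|E|.+1 ^ 2)%N; set K2 := (#|E| * _)%N; set K3 := (3 * size A * _)%N.
rewrite /discovery_cost; set K4 := ((4 * d.+1 + 2) * (_).+1)%N.
by lia.
Qed.

End Search.
End Decomposition.
End WeightSet.

(** * Running time *)

Section GraphSize.
Local Open Scope nat_scope.
Variables (V : finType) (E : {set {set V}}).
Hypotheses (simpE : simple_graph E) (V_gt1 : 1 < #|V|).

(** Turns logarithms of quantities polynomial in the number of edges into multiples of [log n]. *)
Lemma card_edges_le : #|E| <= #|V| ^ 2.
Proof.
apply: (@leq_trans 'C(#|V|, 2)).
  rewrite -card_draws subset_leq_card //; apply/fintype.subsetP => e Ee.
  by rewrite inE simpE.
by rewrite bin2; case: #|V| => // n; rewrite /= expnS expn1; lia.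
Qed.

(** A connected graph with at least two vertices has no isolated vertex, so the edges cover all
    vertices, two apiece. *)
Lemma card_vertices_le : connected_graph E -> #|V| <= 2 * #|E|.
Proof.
move=> conE; have cover_all : [set: V]%SET \subset finset.cover E.
  apply/fintype.subsetP => u _; have [v uv] : exists v, u != v.
    case: (pickP (predC1 u)) => [v vu | all_u]; first by exists v; rewrite eq_sym.
    have : #|V| <= 1.
      rewrite -cardsT -(cards1 u) subset_leq_card //; apply/fintype.subsetP => v _.
      by rewrite inE; have := all_u v; rewrite inE => /negbFE.
    by rewrite leqNgt V_gt1.
  case/connectP: (conE u v) => -[|w p] /=; first by move=> _ vu; rewrite vu eqxx in uv.
  case/andP=> /andP[_ Euw] _ _; apply/bigcupP; exists [set u; w]%SET => //.
  by rewrite !inE eqxx.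
rewrite -cardsT; apply: leq_trans (subset_leq_card cover_all) _.
apply: leq_trans (leq_card_cover E) _.
rewrite [leqLHS](eq_bigr (fun=> 2)); last by move=> e Ee; apply: simpE.
by rewrite sum_nat_const mulnC.
Qed.

End GraphSize.

Lemma trunc_log_le b k n : 1 < b -> n <= b ^ k -> trunc_log b n <= k.
Proof. by move=> b_gt1 /(leq_trunc_log b); rewrite trunc_expnK. Qed.

Section RunningTime.
Local Open Scope nat_scope.
Variables (p d m n C ac : nat).
Hypotheses (d_gt0 : 0 < d) (m_gt0 : 0 < m) (n_gt1 : 1 < n) (mn : m <= n ^ 2) (nm : n <= 2 * m).

Local Notation X := (m ^ (2 * d) * trunc_log 2 n).

(** [kappa] comes from [2 N + 1 <= (2 p + 3) m^2], raised to the power [d]. [lambda] bounds the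
    logarithm of the number of faces in units of [l = log n]: the summand [8 d] is the exponent in
    [m^(2 d) <= 2^(8 d l)], from [m <= 2^(4 l)]. [delta] bounds the cost of a discovery in the same
    units. *)
Let kappa := (2 * p + 3) ^ d.
Let lambda := kappa + 1 + 8 * d.
Let delta := 8 * p + 5 * C + 7 + (4 * p + 2) * (lambda + 1).

(** The summands follow those of the running time, so that the bound can be checked one by one. *)
Definition time_constant : nat :=
  (2 * p + 3) * 4 + ((p + 1) + (((2 * p + 1) * (p + 1) + 1) +
  (ac * (kappa + (p + 1) * (p + 9)) + (((2 * p + 5) * kappa + 2) + (((2 * p + 1) * kappa + 1) + (1 +
  (((4 * p + 2) * 4 + C * 2 + (2 * C + p + 1) + 3 * (kappa * (delta + 3)) + kappa + delta
    + (2 * p + 6)) + ((4 * kappa + 1) + 1)))))))).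

Lemma total_time_le N a dc t_pairs t_project t_arr t_graph t_cells t_explore t_entries :
  N <= m ^ 2 + p -> a <= (2 * N + 1) ^ d ->
  dc = 8 * p + 5 * (C * trunc_log 2 n) + 7 + (4 * p + 2) * (trunc_log 2 a.+1).+1 ->
  t_pairs <= (2 * p + 3) * m.+1 ^ 2 ->
  t_project <= (2 * p + 1) * N + 1 ->
  t_arr <= ac * (N ^ d + N * trunc_log 2 N) ->
  t_graph <= (2 * p + 5) * a + 2 ->
  t_cells <= (2 * p + 1) * a + 1 ->
  t_explore <= (4 * p + 2) * m.+1 ^ 2 + C * (n * trunc_log 2 n) + m * (2 * (C * trunc_log 2 n) + p + 1)
    + 3 * a * (dc + 3) + a + dc + 2 * p + 6 ->
  t_entries <= 4 * a + 1 ->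
  t_pairs + (N + (t_project + (t_arr + (t_graph + (t_cells + (1 + (t_explore + (t_entries + 1))))))))
    <= time_constant * X.
Proof.
set l := trunc_log 2 n => leN lea def_dc; set M := m ^ (2 * d).
have l_gt0 : 0 < l by rewrite trunc_log_gt0.
have M_gt0 : 0 < M by rewrite expn_gt0 m_gt0.
have m2M : m ^ 2 <= M by rewrite leq_pexp2l //; lia.
have m2_gt0 : 0 < m ^ 2 by rewrite expn_gt0 m_gt0.
have X_gt0 : 0 < M * l by rewrite muln_gt0 M_gt0.
have m2X : m ^ 2 <= M * l by apply: leq_trans m2M _; rewrite leq_pmulr.
have mm2 : m <= m ^ 2 by rewrite -[leqLHS]expn1 leq_pexp2l.
have mulX k x y : x <= y * (M * l) -> k * x <= k * y * (M * l).
  by move=> xy; rewrite -mulnA leq_mul2l xy orbT.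
have addX x x' y y' : x <= y * (M * l) -> x' <= y' * (M * l) -> x + x' <= (y + y') * (M * l).
  by move=> xy xy'; rewrite mulnDl leq_add.
have constX k : k <= k * (M * l) by rewrite leq_pmulr.
have m1sq : m.+1 ^ 2 <= 4 * (M * l).
  apply: (@leq_trans (4 * m ^ 2)); last by rewrite leq_mul2l m2X orbT.
  by rewrite (_ : 4 = 2 ^ 2) // -expnMn leq_exp2r //; lia.
have N_le : N <= (p + 1) * m ^ 2.
  by apply: leq_trans leN _; rewrite mulnDl mul1n addnC leq_add2r leq_pmulr.
have NX : N <= (p + 1) * (M * l).
  by apply: leq_trans N_le _; rewrite leq_mul2l m2X ?orbT.
have N2_le : 2 * N + 1 <= (2 * p + 3) * m ^ 2.
  apply: (@leq_trans (2 * ((p + 1) * m ^ 2) + m ^ 2)).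
    by rewrite leq_add // leq_mul2l N_le orbT.
  by apply: eq_leq; ring.
have le_exp x y : x <= y -> x ^ d <= y ^ d by rewrite leq_exp2r.
have a_le : a <= kappa * M.
  by apply: leq_trans lea _; apply: leq_trans (le_exp _ _ N2_le) _; rewrite expnMn -expnM.
have aX : a <= kappa * (M * l).
  by apply: leq_trans a_le _; rewrite leq_mul2l leq_pmulr ?orbT.
have NdX : N ^ d <= kappa * (M * l).
  apply: leq_trans (le_exp N (2 * N + 1) _) _; first by lia.
  apply: leq_trans (le_exp _ _ N2_le) _; rewrite expnMn -expnM leq_mul2l.
  by rewrite leq_pmulr ?orbT.
(* [n < 2^(l + 1)], and [l + 1 <= 2 l] because [l] is positive. *)
have n_le : n <= 2 ^ (2 * l).
  apply/ltnW/(leq_trans (trunc_log_ltn n (isT : 1 < 2))).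
  by rewrite leq_pexp2l // -/l; lia.
have m_le : m <= 2 ^ (4 * l).
  apply: leq_trans mn _; apply: leq_trans (_ : (2 ^ (2 * l)) ^ 2 <= _); first by rewrite leq_exp2r.
  by rewrite -expnM leq_pexp2l //; lia.
have le_pow x : x <= 2 ^ (x * l).
  by apply: leq_trans (ltnW (ltn_expl x (isT : 1 < 2))) _; rewrite leq_pexp2l // leq_pmulr.
have log_a : trunc_log 2 a.+1 <= lambda * l.
  apply: trunc_log_le => //; apply: leq_trans (_ : (kappa + 1) * M <= _).
    by rewrite mulnDl mul1n -addn1 leq_add.
  rewrite /lambda [in leqRHS]mulnDl expnD leq_mul //.
  have -> : 8 * d * l = (4 * l) * (2 * d) by ring.
  by rewrite /M [in leqRHS]expnM leq_exp2r // muln_gt0.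
have log_N : trunc_log 2 N <= (p + 9) * l.
  apply: trunc_log_le => //; apply: leq_trans N_le _.
  have -> : (p + 9) * l = (p + 1) * l + (4 * l) * 2 by ring.
  by rewrite expnD leq_mul // expnM leq_exp2r.
have dc_le : dc <= delta * l.
  rewrite def_dc /delta; apply: (@leq_trans (8 * p * l + 5 * C * l + 7 * l + (4 * p + 2) * (lambda * l + l))).
    have log_a1 : (trunc_log 2 a.+1).+1 <= lambda * l + l by rewrite -[leqLHS]addn1 leq_add.
    by rewrite !leq_add ?leq_pmulr ?mulnA // leq_mul2l log_a1 orbT.
  by apply: eq_leq; ring.
move=> h1 h2 h3 h4 h5 h6 h7; rewrite /time_constant -/M.
apply: (addX); first by apply: leq_trans h1 _; apply: (mulX).
apply: (addX); first exact: NX.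
apply: (addX); first by apply: leq_trans h2 _; apply: (addX _ _ _ _ _ (constX 1)); apply: (mulX).
apply: (addX).
  apply: leq_trans h3 _; apply: (mulX); apply: (addX) => //.
  (* The sorting term [N log N] fits for every [d], including 1: [N] is of order [m^2], which is at
     most [m^(2 d)], and its logarithm is absorbed by the factor [log n]. *)
  rewrite (_ : (p + 1) * (p + 9) * (M * l) = (p + 1) * M * ((p + 9) * l)); last by ring.
  by rewrite leq_mul // (leq_trans N_le) // leq_mul2l m2M orbT.
apply: (addX); first by apply: leq_trans h4 _; apply: (addX _ _ _ _ _ (constX 2)); apply: (mulX).
apply: (addX); first by apply: leq_trans h5 _; apply: (addX _ _ _ _ _ (constX 1)); apply: (mulX).
apply: (addX); first exact: constX.
apply: (addX); last first.
  by apply: (addX _ _ _ _ _ (constX 1)); apply: leq_trans h7 _; apply: (addX _ _ _ _ _ (constX 1)); apply: (mulX).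
apply: leq_trans h6 _; rewrite -addnA.
apply: (addX _ _ _ _ _ (constX _)); apply: (addX); last first.
  by apply: leq_trans dc_le _; rewrite leq_mul2l leq_pmull ?orbT.
apply: (addX _ _ _ _ _ aX); apply: (addX); last first.
  rewrite -mulnA; apply: (mulX); apply: leq_trans (leq_mul a_le (_ : dc + 3 <= (delta + 3) * l)) _.
    by rewrite mulnDl leq_add ?leq_pmulr.
  by apply: eq_leq; ring.
apply: (addX); last first.
  apply: (@leq_trans (m ^ 2 * ((2 * C + p + 1) * l))).
    apply: leq_mul => //; rewrite (mulnDl (2 * C + p)) (mulnDl (2 * C)) mulnA.
    by rewrite !leq_add ?leq_pmulr ?leq_pmull.
  by rewrite mulnCA leq_mul2l leq_mul2r m2M !orbT.
apply: (addX); first by apply: (mulX).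
apply: (mulX); rewrite mulnA leq_mul2r (leq_trans nm) ?orbT // leq_mul2l.
by rewrite (leq_trans mm2) // orbT.
Qed.

End RunningTime.

Theorem theorem4p5 (d : nat) (hd : (0 < d)%N) (R : realType)
    (arr : arrangement_algorithm R d)
    (DT : forall V : finType, dynamic_forest V)
    (hDT : logarithmic_time DT) :
  exists K : nat,
  forall (V : finType) (E : {set {set V}}) (c : {set V} -> 'rV[R]_d.+1)
         (choose : seq nat -> nat),
    simple_graph E -> connected_graph E ->
    hyperplanes_distinct E c -> no_vertical_hyperplane E c ->
    (forall s, s != [::] -> choose s \in s) ->
    computes_decomposition E c (weight_set_algorithm arr DT choose E c).1 /\
    ((1 < #|V|)%N ->
     ((weight_set_algorithm arr DT choose E c).2
       <= K * (#|E| ^ (2 * d.+1 - 2) * trunc_log 2 #|V|))%N).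
Proof.
case: hDT => C opsC; exists (time_constant d.+1 d C (arr_const arr)).
move=> V E c choose simpE conE distinctE no_vertical chooseP.
have proper := hyps_proper hd distinctE.
have [+ project_time] := project_allP c hd (labels E c).
rewrite -/(hyps E c) => project_eq.
have [_ _ _ size_pairs pairs_time] := incomparable_pairsP c hd (enum_uniq E).
rewrite -cardE in size_pairs pairs_time.
have size_hyps : size (hyps E c) = (size (incomparable_pairs c (enum E)).1 + d.+1)%N.
  by rewrite size_map size_cat size_map -cardE card_ord.
set A := (arr_run arr (hyps E c)).1.
have A_hyps : describes_arrangement (hyps E c) A := arr_correct arr proper.
have [cells_mem cells_time] := relevant_cellsP 0 A.
have [_ _ graph_time] := incidence_graphP A.
set k := choose (relevant_cells 0 A).1.
have relk : relevant_cell E c A k.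
  have [k0 [k0lt off0 pos0]] := exists_relevant_cell hd A_hyps.
  have k0cell : k0 \in (relevant_cells 0 A).1.
    by apply/cells_mem; exists k0 => //; split=> //; apply/(dim_cell proper A_hyps).
  have cells0 : (relevant_cells 0 A).1 != [::] by case: (_.1) k0cell.
  have /cells_mem[j def_k [jlt dimj posj]] := chooseP _ cells0.
  rewrite /k def_k add0n; split=> //; exact/(dim_cell proper A_hyps).
set ex := explore DT E c (labels E c) A (incidence_graph A).1 k.
have [correct [size_found time]] :=
  exploreP hd simpE distinctE no_vertical A_hyps DT conE relk.
rewrite -/ex in correct size_found time.
have [entries_eq entries_time] := entriesP ex.1 [::].
have output_eq : (weight_set_algorithm arr DT choose E c).1 =
    Output (hyps E c) A (inorder ex.1).
  have -> : inorder ex.1 = (entries ex.1 [::]).1 by rewrite entries_eq cats0.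
  by rewrite /ex /k /A -project_eq.
have time_eq : (weight_set_algorithm arr DT choose E c).2 =
    ((incomparable_pairs c (enum E)).2 + (size (hyps E c) + ((project_all c (labels E c)).2 +
      ((arr_run arr (hyps E c)).2 + ((incidence_graph A).2 + ((relevant_cells 0 A).2 +
        (1 + (ex.2 + ((entries ex.1 [::]).2 + 1)))))))))%N.
  by rewrite size_hyps /ex /k /A -project_eq.
(* For a single vertex [trunc_log 2 1] is 0, so only the time bound asks for two vertices. *)
split=> [|V_gt1]; first by rewrite output_eq.
rewrite {}time_eq (_ : 2 * d.+1 - 2 = 2 * d)%N; last by lia.
have [empty_time opsL] := opsC V V_gt1.
have VE := card_vertices_le simpE V_gt1 conE.
have E_gt0 : (0 < #|E|)%N by lia.
have total := @total_time_le d.+1 d #|E| #|V| C (arr_const arr) hd E_gt0 V_gt1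
  (card_edges_le simpE V_gt1) VE (size (hyps E c)) (size A) (discovery_cost A (C * trunc_log 2 #|V|)).
apply: total.
- by rewrite size_hyps leq_add2r.
- exact: face_number A_hyps.
- by rewrite /discovery_cost; lia.
- exact: pairs_time.
- by move: project_time; rewrite size_map.
- by apply: arr_time => //; rewrite size_hyps addnS.
- exact: graph_time.
- exact: cells_time.
- apply: leq_trans (time (C * trunc_log 2 #|V|)%N opsL) _.
  by rewrite !leq_add2r leq_add2l.
by apply: leq_trans entries_time _; rewrite leq_add2r leq_mul2l size_found orbT.
Qed.
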